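(* Let $1<p,q<\infty$, $\omega\in\mathcal{D}$, $\upsilon$ a positive Borel measure on $\mathbb{D}$, $\varphi,\psi\in S(\mathbb{D})$ and $u_0,u_1\in H(\mathbb{D})$. Then $$\|u_0C_\varphi+u_1D^{(1)}_\psi\|_{A^p_\omega\to L^q_\upsilon}\approx\|u_0C_\varphi\|_{A^p_\omega\to L^q_\upsilon}+\|u_1D^{(1)}_\psi\|_{A^p_\omega\to L^q_\upsilon},$$ with constants independent of $u_0,u_1,\varphi,\psi,\upsilon$ (in particular $u_0C_\varphi+u_1D^{(1)}_\psi:A^p_\omega\to L^q_\upsilon$ is bounded if and only if both $u_0C_\varphi$ and $u_1D^{(1)}_\psi$ are bounded from $A^p_\omega$ to $L^q_\upsilon$).
   Context: $\mathbb{D}$ is the open unit disc, $dA$ the normalized area measure, $H(\mathbb{D})$ the analytic functions on $\mathbb{D}$, $S(\mathbb{D})$ the analytic self-maps of $\mathbb{D}$. For $u\in H(\mathbb{D})$, $\varphi\in S(\mathbb{D})$: $uC_\varphi f=u\,(f\circ\varphi)$ and $uD^{(1)}_\varphi f=u\,(f'\circ\varphi)$. A radial weight is a nonnegative $\omega\in L^1([0,1])$ extended by $\omega(z)=\omega(|z|)$; set $\hat\omega(r)=\int_r^1\omega(t)\,dt$, and assume $\hat\omega(r)>0$ for all $r<1$. $\hat{\mathcal{D}}$ is the class of radial weights with $\hat\omega(r)\le C\hat\omega(\frac{1+r}{2})$ for all $0\le r<1$ and some $C\ge1$; $\mathcal{D}$ is the class of $\omega\in\hat{\mathcal{D}}$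 for which additionally there are $K>1$, $C>1$ with $\hat\omega(r)\ge C\hat\omega(1-\frac{1-r}{K})$ for all $0\le r<1$. $A^p_\omega$ is the space of $f\in H(\mathbb{D})$ with $\|f\|^p_{A^p_\omega}=\int_{\mathbb{D}}|f|^p\omega\,dA<\infty$. $L^q_\upsilon=L^q(\mathbb{D},\upsilon)$. *)

(* Defs.v *)
From HB Require Import structures.
From mathcomp Require Import all_boot all_order all_algebra.
From mathcomp Require Import all_classical all_reals all_analysis.
From mathcomp.real_closed Require Import complex.
Import Order.TTheory GRing.Theory Num.Theory.
Import numFieldNormedType.Exports.

Set Implicit Arguments.
Unset Strict Implicit.
Unset Printing Implicit Defensive.

Local Open Scope ring_scope.
Local Open Scope classical_set_scope.

(* The complex plane, as a normed module over itself (so that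
   [derivable f z 1] is complex differentiability). *)
Definition Cx (R : realType) : normedModType (R[i])^o := (R[i])^o.

Definition toC (R : realType) (x : (R * R)%type) : Cx R := (x.1 +i* x.2)%C.

Definition cabs (R : realType) (z : Cx R) : R := ComplexField.Normc.normc z.

Definition disc2 (R : realType) : set (R * R)%type :=
  [set x | cabs (toC x) < 1].

Definition holoD (R : realType) (f : Cx R -> Cx R) : Prop :=
  forall z : Cx R, cabs z < 1 -> derivable f z 1.

Definition selfmapD (R : realType) (phi : Cx R -> Cx R) : Prop :=
  holoD phi /\ forall z : Cx R, cabs z < 1 -> cabs (phi z) < 1.

Definition omega_hat (R : realType) (omega : R -> R) (r : R) : \bar R :=
  (\int[lebesgue_measure]_(t in `[r, 1%R]) (omega t)%:E)%E.

Definition radial_weight (R : realType) (omega : R -> R) : Prop :=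
  [/\ measurable_fun (`[0%R, 1%R] : set R) omega,
      (forall t : R, 0 <= t <= 1 -> 0 <= omega t),
      lebesgue_measure.-integrable (`[0%R, 1%R] : set R) (fun t => (omega t)%:E)
    & (forall r : R, 0 <= r < 1 -> (0 < omega_hat omega r)%E)].

Definition Dhat (R : realType) (omega : R -> R) : Prop :=
  radial_weight omega /\
  exists C : R, 1 <= C /\
    forall r : R, 0 <= r < 1 ->
      (omega_hat omega r <= C%:E * omega_hat omega ((1 + r) / 2))%E.

Definition classD (R : realType) (omega : R -> R) : Prop :=
  Dhat omega /\
  exists K C : R, 1 < K /\ 1 < C /\
    forall r : R, 0 <= r < 1 ->
      (C%:E * omega_hat omega (1 - (1 - r) / K) <= omega_hat omega r)%E.

(* normalized area measure dA = dx dy / pi, via Lebesgue measure on R * R *)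
Definition normA (R : realType) (p : R) (omega : R -> R) (f : Cx R -> Cx R)
  : \bar R :=
  (((pi^-1)%:E *
    \int[(lebesgue_measure \x lebesgue_measure)%E]_(x in @disc2 R)
       ((cabs (f (toC x)) `^ p) * omega (cabs (toC x)))%:E) `^ p^-1)%E.

(* ||g||_{L^q_upsilon} for a positive Borel measure upsilon on D,
   represented as a measure on (the Borel sets of) R * R integrated over D *)
Definition normL (R : realType) (q : R)
  (ups : {measure set (R * R)%type -> \bar R}) (g : Cx R -> Cx R) : \bar R :=
  ((\int[ups]_(x in @disc2 R) (cabs (g (toC x)) `^ q)%:E) `^ q^-1)%E.

Definition opnorm (R : realType) (p q : R) (omega : R -> R)
  (ups : {measure set (R * R)%type -> \bar R})
  (T : (Cx R -> Cx R) -> (Cx R -> Cx R)) : \bar R :=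
  ereal_sup [set normL q ups (T f) |
              f in [set f | holoD f /\ (normA p omega f <= 1)%E]].

Definition wcomp (R : realType) (u phi : Cx R -> Cx R) (f : Cx R -> Cx R)
  : Cx R -> Cx R := fun z => u z * f (phi z).

Definition wdiff (R : realType) (u psi : Cx R -> Cx R) (f : Cx R -> Cx R)
  : Cx R -> Cx R := fun z => u z * derive1 f (psi z).

Definition wsum (R : realType) (u0 phi u1 psi : Cx R -> Cx R)
  (f : Cx R -> Cx R) : Cx R -> Cx R :=
  fun z => wcomp u0 phi f z + wdiff u1 psi f z.

(* Main.v *)
(* The upper bound is the triangle inequality.  For the lower bound, cut the disc into the layers
   [1 - K^-m <= |z| < 1 - K^-(m+1)] and spread about [K^(n+1)] lattice points [a] evenly on the
   circle [1 - |a| = K^-(n+1)].  Sub-mean-value estimates give numbers [c_a] that dominate [|f|]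
   and [(1 - |a|) |f'|] on the cell of [a], while Jensen's inequality and the geometric behaviour of
   the masses of the layers (this is what the class D provides) bound the norm of
   [sum_a +-c_a ((1 - |a|) / (1 - conj(a) z)) ^ N] by that of [f], for every choice of signs.
   Testing the sum of the two operators on these functions and averaging over the signs bounds, in
   [L^q], the image of each single atom.  Using three consecutive exponents [N] one eliminates
   either of the two terms algebraically, which bounds [c_a |u_0|] where [phi] falls in the cell of
   [a], and [c_a |u_1| / (1 - |a|)] where [psi] does. *)
Require Import Defs.
From HB Require Import structures.
From mathcomp Require Import all_boot all_order all_algebra.
From mathcomp Require Import all_classical all_reals all_analysis.
From mathcomp.real_closed Require Import complex.
From mathcomp Require Import measurable_realfun.
From mathcomp Require Import ring lra.
Import Order.TTheory GRing.Theory Num.Theory.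
Import numFieldNormedType.Exports.
Local Open Scope ring_scope.
Local Open Scope classical_set_scope.
Set Implicit Arguments.
Unset Strict Implicit.
Unset Printing Implicit Defensive.

(** * Complex moduli and derivatives *)

(** [phi] and [psi] are unrelated, so the values [s], [t] of an atom at [phi z] and [psi z] are
    independent numbers of modulus at most 1. Two exponents do not always separate the terms: the
    two equations are dependent when [M s = (M + 1) t]. With three, the elimination divides by
    [(M + 1)^2 - M (M + 2) = 1], thanks to the factor [M + i] produced by differentiation; it works
    even for [s = t]. The atom that matters at [z] varies with [z]. By convexity the mean over the
    signs dominates the [q]-th power of every term simultaneously and pointwise, so the choice may
    be made under the integral. The [c_a] are [p]-means of [f] over an entire layer, two steps
    beyond the cell of [a], against a Poisson-like kernel: the passage from circles to areas then
    rests on rotation invariance, and the squared kernels of one circle have a bounded sum. The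
    estimates for holomorphic functions all come from the mean value property, stated with one
    exceptional point where mere continuity is known; it follows from Goursat's lemma on rectangles
    in logarithmic polar coordinates. *)

Notation nc := (@ComplexField.Normc.normc _).

Section ComplexModulus.
Context {R : realType}.
Implicit Types (x y z w : R[i]) (f g : R[i] -> R[i]).

Lemma ncE (a b : R) : nc (a +i* b)%C = Num.sqrt (a ^+ 2 + b ^+ 2).
Proof. by []. Qed.

Lemma ncD x y : nc (x + y) <= nc x + nc y.
Proof. exact: le_normcD. Qed.

Lemma ncM x y : nc (x * y) = nc x * nc y.
Proof. exact: ComplexField.Normc.normcM. Qed.

Lemma ncV x : nc x^-1 = (nc x)^-1.
Proof. exact: ComplexField.Normc.normcV. Qed.

Lemma nc0 : nc (0 : R[i]) = 0.
Proof. exact: ComplexField.Normc.normc0. Qed.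

Lemma nc1 : nc (1 : R[i]) = 1.
Proof. exact: ComplexField.Normc.normc1. Qed.

Lemma ncN x : nc (- x) = nc x.
Proof. exact: normcN. Qed.

Lemma ncB x y : nc (x - y) <= nc x + nc y.
Proof. by rewrite -(ncN y) ncD. Qed.

Lemma nc_distC x y : nc (x - y) = nc (y - x).
Proof. by rewrite -ncN opprB. Qed.

Lemma nc_dist_ge x y : nc x - nc y <= nc (x - y).
Proof. by rewrite lerBlDr -{1}(subrK y x) ncD. Qed.

Lemma nc_ge0 x : 0 <= nc x.
Proof. by case: x => a b; exact: sqrtr_ge0. Qed.

Lemma nc_eq0 x : (nc x == 0) = (x == 0).
Proof.
apply/eqP/eqP => [|->]; last exact: nc0.
exact: ComplexField.Normc.eq0_normc.
Qed.

Lemma nc_gt0 x : (0 < nc x) = (x != 0).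
Proof. by rewrite lt_def nc_eq0 nc_ge0 andbT. Qed.

Lemma ncX x n : nc (x ^+ n) = nc x ^+ n.
Proof. by elim: n => [|n IH]; rewrite ?expr0 ?nc1// !exprS ncM IH. Qed.

Lemma nc_sqr x : nc x ^+ 2 = complex.Re x ^+ 2 + complex.Im x ^+ 2.
Proof. by case: x => a b; rewrite ncE sqr_sqrtr// addr_ge0 ?sqr_ge0. Qed.

Lemma nc_real (a : R) : nc (a%:C)%C = `|a|.
Proof. by rewrite ncE expr0n addr0 sqrtr_sqr. Qed.

Lemma nc_nat n : nc (n%:R : R[i]) = n%:R.
Proof.
by rewrite -(rmorph_nat (real_complex R)) nc_real normr_nat.
Qed.

Lemma Re_le_nc x : `|complex.Re x| <= nc x.
Proof.
rewrite -sqrtr_sqr; case: x => a b /=.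
by rewrite ler_wsqrtr// lerDl sqr_ge0.
Qed.

Lemma Im_le_nc x : `|complex.Im x| <= nc x.
Proof.
rewrite -sqrtr_sqr; case: x => a b /=.
by rewrite ler_wsqrtr// lerDr sqr_ge0.
Qed.

Lemma nc_le_ReIm (a b : R) : nc (a +i* b)%C <= `|a| + `|b|.
Proof.
rewrite -[leRHS]ger0_norm ?addr_ge0// -sqrtr_sqr ncE ler_wsqrtr//.
rewrite sqrrD !real_normK ?num_real// -addrA lerD2l lerDr.
by rewrite mulrn_wge0// mulr_ge0.
Qed.

Lemma norm_complexE x : `|x| = ((nc x)%:C)%C.
Proof. by case: x. Qed.

Lemma conj_nc x : (x * x^*)%C = ((nc x ^+ 2)%:C)%C.
Proof.
rewrite nc_sqr; case: x => a b; apply/eqP; rewrite eq_complex /=.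
by apply/andP; split; apply/eqP; ring.
Qed.

Lemma ReD x y : complex.Re (x + y) = complex.Re x + complex.Re y.
Proof. by case: x y => [? ?] [? ?]. Qed.
Lemma ReN x : complex.Re (- x) = - complex.Re x.
Proof. by case: x => [? ?]. Qed.
Lemma ImN x : complex.Im (- x) = - complex.Im x.
Proof. by case: x => [? ?]. Qed.
Lemma ImD x y : complex.Im (x + y) = complex.Im x + complex.Im y.
Proof. by case: x y => [? ?] [? ?]. Qed.
Lemma ReM x y : complex.Re (x * y) =
  complex.Re x * complex.Re y - complex.Im x * complex.Im y.
Proof. by case: x y => [? ?] [? ?]. Qed.
Lemma ImM x y : complex.Im (x * y) =
  complex.Re x * complex.Im y + complex.Im x * complex.Re y.
Proof. by case: x y => [a b] [c d] /=. Qed.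

(** Turns bounds on a real part, which is what the mean value property gives, into bounds on a
    modulus. *)
Lemma exists_rotation_to_nc x :
  exists2 c : R[i], nc c = 1 & c * x = ((nc x)%:C)%C.
Proof.
have [->|x0] := eqVneq x 0.
  by exists 1; rewrite ?nc1// mulr0 nc0.
exists (((nc x)%:C)%C / x).
  by rewrite ncM ncV nc_real ger0_norm ?nc_ge0// divff// nc_eq0.
by rewrite mulfVK.
Qed.

End ComplexModulus.

(* Complex differentiability in terms of real epsilons: avoids filters on the complex plane. *)
Definition cdiff {R : realType} (f : R[i] -> R[i]) (z d : R[i]) : Prop :=
  forall e : R, 0 < e -> exists2 eta : R, 0 < eta &
    forall h : R[i], nc h < eta -> nc (f (z + h) - f z - d * h) <= e * nc h.

Definition ccont {R : realType} (f : R[i] -> R[i]) (z : R[i]) : Prop :=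
  forall e : R, 0 < e -> exists2 eta : R, 0 < eta &
    forall h : R[i], nc h < eta -> nc (f (z + h) - f z) <= e.

Section ComplexDifferentiation.
Context {R : realType}.
Implicit Types (x y z w d : R[i]) (f g : R[i] -> R[i]).

Lemma cdiff_cvg f z d : cdiff f z d ->
  (h : Cx R)^-1 *: ((f : Cx R -> Cx R) (h + z) - f z) @[h --> (0 : Cx R)^'] --> (d : Cx R).
Proof.
move=> fd; apply/cvgrPdist_le => e e0.
have eE : e = ((nc (e : R[i]))%:C)%C by rewrite -norm_complexE gtr0_norm.
have e0' : 0 < nc (e : R[i]) by rewrite nc_gt0 gt_eqF.
have [eta eta0 H] := fd _ e0'.
have eta0C : 0 < ((eta)%:C)%C :> R[i] by rewrite ltcR.
near=> h.
have h0 : h != 0 :> R[i] by near: h; exact: nbhs_dnbhs_neq.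
have hlt : nc (h : R[i]) < eta.
  rewrite -ltcR -norm_complexE -[X in `|X|]subr0 -normrN opprB.
  near: h; apply: (@nbhs_dnbhs (Cx R)).
  exact: (@nbhsx_ballx _ (Cx R) 0 _ eta0C).
rewrite norm_complexE eE lecR.
have -> : (d : R[i]) - h^-1 * (f (h + z) - f z) =
    - (h^-1 * (f (z + h) - f z - d * h)).
  by rewrite [h + z]addrC; field.
rewrite ncN ncM ncV mulrC ler_pdivrMr ?nc_gt0//.
exact: H.
Unshelve. all: by end_near.
Qed.

Lemma cvg_cdiff f z d :
  (h : Cx R)^-1 *: ((f : Cx R -> Cx R) (h + z) - f z) @[h --> (0 : Cx R)^'] --> (d : Cx R) ->
  cdiff f z d.
Proof.
move=> /cvgrPdist_le fd e e0.
have eC : 0 < (e%:C)%C :> R[i] by rewrite ltcR.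
have /nbhs_ballP [r /= r0] := fd _ eC.
have rE : r = ((nc (r : R[i]))%:C)%C by rewrite -norm_complexE gtr0_norm.
move=> H; exists (nc (r : R[i])); first by rewrite nc_gt0 gt_eqF.
move=> h hr; have [->|h0] := eqVneq h 0.
  by rewrite addr0 subrr mulr0 subr0 nc0 mulr0.
have := H h; rewrite /ball /= sub0r normrN norm_complexE rE ltcR => /(_ hr h0).
rewrite norm_complexE lecR => K.
have -> : f (z + h) - f z - d * h = - (h * ((d : R[i]) - h^-1 * (f (h + z) - f z))).
  by rewrite [h + z]addrC; field.
by rewrite ncN ncM mulrC ler_wpM2r ?nc_ge0.
Qed.

Lemma derivable_cdiff (f : Cx R -> Cx R) z :
  derivable f z 1 -> cdiff f z (derive1 f z).
Proof.
move=> fz; apply: cvg_cdiff; rewrite /derive1.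
suff : cvg ((h : Cx R)^-1 *: ((f : Cx R -> Cx R) (h + z) - f z) @[h --> (0 : Cx R)^']) by [].
move: fz; rewrite /derivable /=.
set u := (fun h => _); set v := (fun h => _).
suff -> : u = v by [].
by rewrite /u /v; apply/funext => h /=; rewrite /shift /= scaler1.
Qed.

Lemma cdiff_derivable (f : Cx R -> Cx R) z d :
  cdiff f z d -> derivable f z 1 /\ derive1 f z = d.
Proof.
move=> /cdiff_cvg fz; split.
  apply/cvg_ex; exists (d : Cx R); move: fz.
  set u := (fun h => _); set v := (fun h => _).
  suff -> : u = v by [].
  by rewrite /u /v; apply/funext => h /=; rewrite /shift /= scaler1.
exact: (cvg_lim _ fz).
Qed.

Lemma cdiff_ccont f z d : cdiff f z d -> ccont f z.
Proof.
move=> fd e e0; have [eta eta0 H] := fd 1 ltr01.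
have D0 : 0 < 1 + nc d by rewrite ltr_pwDl// nc_ge0.
exists (Num.min eta (e / (1 + nc d))).
  by rewrite lt_min eta0 divr_gt0.
move=> h; rewrite lt_min => /andP[h1 h2].
have -> : f (z + h) - f z = (f (z + h) - f z - d * h) + d * h by rewrite subrK.
rewrite (le_trans (ncD _ _))// ncM.
rewrite (le_trans (lerD (H _ h1) (lexx _)))// -mulrDl.
by rewrite mulrC -ler_pdivlMr// ltW.
Qed.

Lemma cdiff_cst (c : R[i]) z : cdiff (fun=> c) z 0.
Proof.
move=> e e0; exists 1 => // h _; rewrite subrr mul0r subrr nc0.
by rewrite mulr_ge0 ?nc_ge0 ?ltW.
Qed.

Lemma cdiff_id z : cdiff id z 1.
Proof.
move=> e e0; exists 1 => // h _; rewrite (_ : id (z + h) - _ - _ = 0) ?nc0; last by rewrite /=; ring.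
by rewrite mulr_ge0 ?nc_ge0 ?ltW.
Qed.

Lemma cdiffD f g z d d' : cdiff f z d -> cdiff g z d' ->
  cdiff (fun x => f x + g x) z (d + d').
Proof.
move=> fd gd e e0; have e2 : 0 < e / 2 by rewrite divr_gt0.
have [a a0 Ha] := fd _ e2; have [b b0 Hb] := gd _ e2.
exists (Num.min a b); first by rewrite lt_min a0.
move=> h; rewrite lt_min => /andP[h1 h2].
have -> : f (z + h) + g (z + h) - (f z + g z) - (d + d') * h =
  (f (z + h) - f z - d * h) + (g (z + h) - g z - d' * h) by ring.
rewrite (le_trans (ncD _ _))// (le_trans (lerD (Ha _ h1) (Hb _ h2)))//.
by rewrite -mulrDl -splitr.
Qed.

Lemma cdiffM f g z d d' : cdiff f z d -> cdiff g z d' ->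
  cdiff (fun x => f x * g x) z (f z * d' + g z * d).
Proof.
move=> fd gd e e0.
have Mg : 0 < 1 + nc (g z) + nc (f z) + nc d.
  by rewrite !ltr_pwDl// ?nc_ge0// !addr_gt0 ?ltr_pwDl ?nc_ge0.
pose M := 1 + nc (g z) + nc (f z) + nc d.
have e3 : 0 < e / 3 / M by rewrite !divr_gt0.
have e3' : 0 < Num.min 1 (e / 3 / M) by rewrite lt_min ltr01.
have [a a0 Ha] := fd _ e3; have [b b0 Hb] := gd _ e3.
have [c c0 Hc] := cdiff_ccont gd e3'.
exists (Num.min (Num.min a b) c); first by rewrite !lt_min a0 b0.
move=> h; rewrite !lt_min => /andP[/andP[h1 h2] h3].
have -> : f (z + h) * g (z + h) - f z * g z - (f z * d' + g z * d) * h =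
  (f (z + h) - f z - d * h) * g (z + h) + f z * (g (z + h) - g z - d' * h)
  + d * (g (z + h) - g z) * h by ring.
have hc := Hc _ h3.
have gb : nc (g (z + h)) <= M.
  rewrite -[g (z + h)](subrK (g z)) (le_trans (ncD _ _))//.
  have : nc (g (z + h) - g z) <= 1 by rewrite (le_trans hc)// ge_min lexx.
  have := nc_ge0 (f z); have := nc_ge0 d; rewrite /M; lra.
have eM : e = e / 3 / M * M + e / 3 / M * M + e / 3 / M * M.
  by rewrite mulfVK ?gt_eqF//; field.
have h0 := nc_ge0 h.
have -> : e * nc h = e / 3 / M * nc h * M + M * (e / 3 / M * nc h) + M * (e / 3 / M) * nc h.
  by rewrite [in LHS]eM; ring.
have M1 : nc (f z) <= M.
  by have := nc_ge0 (g z); have := nc_ge0 d; rewrite /M; lra.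
have M2 : nc d <= M.
  by have := nc_ge0 (g z); have := nc_ge0 (f z); rewrite /M; lra.
rewrite (le_trans (ncD _ _))// lerD//.
  rewrite (le_trans (ncD _ _))// lerD// ncM.
    by rewrite ler_pM ?nc_ge0// Ha.
  by rewrite ler_pM ?nc_ge0// Hb.
rewrite !ncM ler_wpM2r// ler_pM ?nc_ge0//.
by rewrite (le_trans hc)// ge_min lexx orbT.
Qed.

Lemma cdiffZ f (c : R[i]) z d : cdiff f z d -> cdiff (fun x => c * f x) z (c * d).
Proof.
move=> fd; have := cdiffM (cdiff_cst c z) fd.
by rewrite mulr0 addr0.
Qed.

Lemma cdiffX f z d n : cdiff f z d ->
  cdiff (fun x => f x ^+ n) z (n%:R * f z ^+ n.-1 * d).
Proof.
move=> fd; elim: n => [|n IH].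
  by rewrite !mul0r; exact: cdiff_cst.
have := cdiffM fd IH.
rewrite (_ : (fun x => f x * f x ^+ n) = (fun x => f x ^+ n.+1)); last first.
  by apply/funext => x; rewrite exprS.
congr cdiff; case: n {IH} => [|n] /=.
  by rewrite !expr0 !mul1r; ring.
by rewrite -[n.+2]addn1 natrD [f z ^+ n.+1]exprS; ring.
Qed.

Lemma cdiff_comp_affine f (a b : R[i]) z d : cdiff f (a + b * z) d ->
  cdiff (fun x => f (a + b * x)) z (b * d).
Proof.
move=> fd e e0; have B0 : 0 < 1 + nc b by rewrite ltr_pwDl// nc_ge0.
have [eta eta0 H] := fd (e / (1 + nc b)) (divr_gt0 e0 B0).
exists (eta / (1 + nc b)); first by rewrite divr_gt0.
move=> h; rewrite ltr_pdivlMr// => hh.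
have bh : nc (b * h) <= nc h * (1 + nc b).
  by rewrite ncM mulrC ler_wpM2l ?nc_ge0// lerDr.
rewrite mulrDr addrA [b * d]mulrC -mulrA (le_trans (H _ (le_lt_trans bh hh)))//.
rewrite -mulrA ler_pM2l// mulrC ler_pdivrMr//.
Qed.

Lemma cdiff_affineV (a b : R[i]) z : a + b * z != 0 ->
  cdiff (fun x => (a + b * x)^-1) z (- b * (a + b * z) ^- 2).
Proof.
set l := a + b * z => l0 e e0.
have L0 : 0 < nc l by rewrite nc_gt0.
have B0 : 0 < 1 + nc b by rewrite ltr_pwDl// nc_ge0.
(* The first bound keeps [|l + b h| >= |l| / 2]; the second makes the exact remainder
   [(b h)^2 / (l^2 (l + b h))] at most [e |h|]. *)
exists (Num.min (nc l / 2 / (1 + nc b)) (e * nc l ^+ 3 / 2 / (1 + nc b) ^+ 2)).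
  by rewrite lt_min !divr_gt0 ?exprn_gt0// mulr_gt0// exprn_gt0.
move=> h; rewrite lt_min !ltr_pdivlMr ?exprn_gt0// => /andP[h1 h2].
have bb : nc (b * h) <= nc h * (1 + nc b).
  by rewrite ncM mulrC ler_wpM2l ?nc_ge0// lerDr.
have l1 : nc l / 2 <= nc (l + b * h).
  have := nc_dist_ge l (- (b * h)); rewrite opprK ncN => K.
  by move: bb h1 K; lra.
have l10 : 0 < nc (l + b * h) by rewrite (lt_le_trans _ l1)// divr_gt0.
have l1n : l + b * h != 0 by rewrite -nc_gt0.
have -> : (a + b * (z + h))^-1 - l^-1 - - b * l ^- 2 * h =
    (b * h) ^+ 2 / (l ^+ 2 * (l + b * h)).
  rewrite mulrDr addrA -/l; field; exact/andP.
rewrite ncM ncV ncX [nc (l ^+ 2 * _)]ncM ncX ler_pdivrMr; last by rewrite mulr_gt0 ?exprn_gt0.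
apply: (@le_trans _ _ (nc h ^+ 2 * (1 + nc b) ^+ 2)).
  by rewrite -exprMn lerXn2r// ?nnegrE ?mulr_ge0 ?nc_ge0 ?ltW.
rewrite [in leLHS]expr2 -!mulrA [leRHS]mulrCA ler_wpM2l ?nc_ge0//.
apply: (@le_trans _ _ (e * (nc l ^+ 2 * (nc l / 2)))).
  move: (ltW h2); rewrite [nc l ^+ 3]exprSr; lra.
rewrite [nc l ^+ 2]expr2 -[nc l * nc l * _]mulrA; apply: ler_wpM2l; first exact: ltW.
by do 2 (apply: ler_wpM2l; first exact: nc_ge0).
Qed.

End ComplexDifferentiation.

(** * Goursat's lemma and the mean value property *)

Section RectangleBisection.
Context {R : realType}.
Variable J : R -> R -> R -> R -> R.

(** The last quarter is the default: if each of the other three carries less than a quarter of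
    [|J|], additivity forces it to carry at least that much. *)
Definition heavy_quarter (r : (R * R) * (R * R)) : (R * R) * (R * R) :=
  let: ((a, b), (c, d)) := r in
  let m := (a + b) / 2 in let n := (c + d) / 2 in
  let k := `|J a b c d| / 4 in
  if k <= `|J a m c n| then ((a, m), (c, n)) else
  if k <= `|J m b c n| then ((m, b), (c, n)) else
  if k <= `|J a m n d| then ((a, m), (n, d)) else ((m, b), (n, d)).

Variables a b c d : R.
Hypotheses (ab : a <= b) (cd : c <= d).
Hypothesis Jadd : forall a' b' c' d' : R, a <= a' -> a' <= b' -> b' <= b ->
  c <= c' -> c' <= d' -> d' <= d ->
  let m := (a' + b') / 2 in let n := (c' + d') / 2 in
  J a' b' c' d' = J a' m c' n + J m b' c' n + J a' m n d' + J m b' n d'.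
Hypothesis Jsmall : forall s t : R, a <= s <= b -> c <= t <= d ->
  forall e : R, 0 < e -> exists2 eta : R, 0 < eta &
  forall a' b' c' d' : R, a <= a' -> a' <= s -> s <= b' -> b' <= b ->
  c <= c' -> c' <= t -> t <= d' -> d' <= d ->
  b' - a' < eta -> d' - c' < eta ->
  `|J a' b' c' d'| <= e * ((b' - a') + (d' - c')) ^+ 2.

Let r n := iter n heavy_quarter ((a, b), (c, d)).
Let A n := (r n).1.1. Let B n := (r n).1.2.
Let C n := (r n).2.1. Let D n := (r n).2.2.

Let rE n : r n = ((A n, B n), (C n, D n)).
Proof. by rewrite /A /B /C /D; case: (r n) => [[? ?] [? ?]]. Qed.

Let stepP n : [/\ a <= A n, A n <= B n, B n <= b, c <= C n & C n <= D n /\ D n <= d] ->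
  [/\ A n <= A n.+1, A n.+1 <= B n.+1, B n.+1 <= B n, C n <= C n.+1 &
   [/\ C n.+1 <= D n.+1, D n.+1 <= D n,
     B n.+1 - A n.+1 = (B n - A n) / 2, D n.+1 - C n.+1 = (D n - C n) / 2
   & `|J (A n) (B n) (C n) (D n)| / 4 <= `|J (A n.+1) (B n.+1) (C n.+1) (D n.+1)|]].
Proof.
move=> [h1 h2 h3 h4 [h5 h6]].
have Jn := Jadd h1 h2 h3 h4 h5 h6.
have E : r n.+1 = heavy_quarter (r n) by [].
move: E; rewrite (rE n.+1) (rE n) /heavy_quarter.
set m := (A n + B n) / 2 in Jn *; set l := (C n + D n) / 2 in Jn *.
have m1 : A n <= m /\ m <= B n by rewrite /m; split; lra.
have l1 : C n <= l /\ l <= D n by rewrite /l; split; lra.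
have m2 : m - A n = (B n - A n) / 2 /\ B n - m = (B n - A n) / 2 by rewrite /m; split; lra.
have l2 : l - C n = (D n - C n) / 2 /\ D n - l = (D n - C n) / 2 by rewrite /l; split; lra.
case: m1 => ? ?; case: l1 => ? ?; case: m2 => ? ?; case: l2 => ? ?.
case: ifPn => [k1 [-> -> -> ->]|k1]; first by split => //; split.
case: ifPn => [k2 [-> -> -> ->]|k2]; first by split => //; split.
case: ifPn => [k3 [-> -> -> ->]|k3 [-> -> -> ->]]; first by split => //; split.
split => //; split => //.
move: k1 k2 k3; rewrite -!ltNge => k1 k2 k3.
set j0 := `|J (A n) (B n) (C n) (D n)| in k1 k2 k3 *.
have : j0 <= `|J (A n) m (C n) l| + `|J m (B n) (C n) l| + `|J (A n) m l (D n)|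
   + `|J m (B n) l (D n)|.
  rewrite /j0 Jn (le_trans (ler_normD _ _))// lerD2r.
  by rewrite (le_trans (ler_normD _ _))// lerD2r ler_normD.
lra.
Qed.

Let inv n : [/\ a <= A n, A n <= B n, B n <= b, c <= C n & C n <= D n /\ D n <= d].
Proof.
elim: n => [|n IH]; first by [].
have [? ? ? ? [? ? _ _ _]] := stepP IH.
case: IH => ? ? ? ? [? ?]; split => //.
- exact: (le_trans _ (_ : A n <= _)).
- exact: (le_trans (_ : _ <= B n)).
- exact: (le_trans _ (_ : C n <= _)).
- split => //; exact: (le_trans (_ : _ <= D n)).
Qed.

Let width n : B n - A n = (b - a) / 2 ^+ n /\ D n - C n = (d - c) / 2 ^+ n.
Proof.
elim: n => [|n [IH1 IH2]]; first by rewrite expr0 !divr1.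
have [_ _ _ _ [_ _ -> -> _]] := stepP (inv n).
by rewrite IH1 IH2 !exprSr !invfM !mulrA.
Qed.

Let heavy n : `|J a b c d| / 4 ^+ n <= `|J (A n) (B n) (C n) (D n)|.
Proof.
elim: n => [|n IH]; first by rewrite expr0 divr1.
have [_ _ _ _ [_ _ _ _ H]] := stepP (inv n).
apply: le_trans H; rewrite exprSr invfM mulrA.
by rewrite ler_pM2r// invr_gt0.
Qed.

Let mono (X : nat -> R) : (forall n, X n <= X n.+1) -> forall n m, (n <= m)%N -> X n <= X m.
Proof.
move=> H n m /subnK <-; elim: (m - n)%N => [//|k IH].
by rewrite addSn (le_trans IH).
Qed.

Let nested (X Y : nat -> R) : (forall n, X n <= X n.+1) -> (forall n, Y n.+1 <= Y n) ->
  (forall n, X n <= Y n) -> exists s, forall n, X n <= s <= Y n.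
Proof.
move=> Xm Ym XY.
have Ym' : forall n m, (n <= m)%N -> Y m <= Y n.
  move=> n m nm; rewrite -lerN2; apply: (mono (X := fun k => - Y k)) => // k.
  by rewrite lerN2.
have XYall n m : X n <= Y m.
  have := XY (maxn n m); have := mono Xm (leq_maxl n m).
  by have := Ym' _ _ (leq_maxr n m) => *; lra.
exists (sup (range X)) => n; apply/andP; split.
  by apply: ub_le_sup; [exists (Y 0%N) => _ [m _ <-]|exists n].
by apply: ge_sup; [exists (X 0%N); exists 0%N|move=> _ [m _ <-]].
Qed.

(** Goursat's argument for an additive rectangle function: [n] bisections divide [|J|] by at most
    [4^n] and the square of the half-perimeter by exactly [4^n], so smallness at the common point of
    the nested rectangles passes back to the whole rectangle. *)
Lemma rect_additive_eq0 : J a b c d = 0.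
Proof.
have [s Hs] : exists s, forall n, A n <= s <= B n.
  by apply: nested => n; have [] := stepP (inv n); have [] := inv n.
have [t Ht] : exists s, forall n, C n <= s <= D n.
  by apply: nested => n; have [_ _ _ ? []] := stepP (inv n); have [_ _ _ _ []] := inv n.
have js : a <= s <= b by have /andP[] := Hs 0%N => ->.
have jt : c <= t <= d by have /andP[] := Ht 0%N => ->.
apply/eqP; rewrite -normr_le0; apply/ler_addgt0Pl => e e0; rewrite addr0.
pose W := (b - a) + (d - c).
have W0 : 0 <= W by rewrite /W addr_ge0// subr_ge0.
(* Chosen so that the final bound [e W^2 / (1 + W^2)] is at most [e]; the added 1 also covers
   [W = 0]. *)
have e1 : 0 < e / (1 + W ^+ 2) by rewrite divr_gt0// ltr_pwDl// sqr_ge0.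
have [eta eta0 H] := Jsmall js jt e1.
have [n Hn] : exists n, W / 2 ^+ n < eta.
  exists (Num.bound (W / eta)).
  rewrite ltr_pdivrMr ?exprn_gt0// mulrC -ltr_pdivrMr//.
  have := @archi_boundP R (W / eta) (divr_ge0 W0 (ltW eta0)).
  move=> /lt_le_trans; apply; rewrite -natrX ler_nat.
  by apply: ltnW; exact: ltn_expl.
have [w1 w2] := width n.
have iv := inv n; case: iv => ? ? ? ? [? ?].
have /andP[? ?] := Hs n; have /andP[? ?] := Ht n.
have p2 : 0 < 2 ^+ n :> R by rewrite exprn_gt0.
have H1 : B n - A n < eta.
  rewrite w1 (le_lt_trans _ Hn)// ler_pM2r ?invr_gt0// /W lerDl subr_ge0//.
have H2 : D n - C n < eta.
  rewrite w2 (le_lt_trans _ Hn)// ler_pM2r ?invr_gt0// /W lerDr subr_ge0//.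
have := H (A n) (B n) (C n) (D n); rewrite w1 w2 -mulrDl -/W.
rewrite -w1 -w2 => /(_ _ _ _ _ _ _ _ _ H1 H2) K.
have {}K := le_trans (heavy n) (K _ _ _ _ _ _ _ _).
have {}K : `|J a b c d| / 4 ^+ n <= e / (1 + W ^+ 2) * (W / 2 ^+ n) ^+ 2 by exact: K.
move: K; rewrite exprMn exprVn -exprM mulnC exprM.
rewrite (_ : 2 ^+ 2 = 4 :> R); last by rewrite -natrX.
rewrite mulrA ler_pM2r ?invr_gt0 ?exprn_gt0// => K.
apply: (le_trans K).
have W1 : 0 < 1 + W ^+ 2 by rewrite ltr_pwDl// sqr_ge0.
by rewrite mulrAC ler_pdivrMr// ler_pM2l// lerDr.
Qed.

End RectangleBisection.

(** * Integrals of continuous functions over segments *)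

Notation leb := (@lebesgue_measure _).
Notation iseg g a b := (\int[leb]_(x in `[a, b]) g x).

Section SegmentIntegral.
Context {R : realType}.
Implicit Types (g : R -> R) (a b : R).

Lemma continuous_on_segment g a b : (forall x, a <= x <= b -> {for x, continuous g}) ->
  {within `[a, b], continuous g}.
Proof.
move=> H; apply: continuous_in_subspaceT => x; rewrite inE /= in_itv /= => xab.
exact: H.
Qed.

Lemma segment_integrable g a b : (forall x, a <= x <= b -> {for x, continuous g}) ->
  leb.-integrable `[a, b] (EFin \o g).
Proof.
move=> H; apply: continuous_compact_integrable; first exact: segment_compact.
exact: continuous_on_segment.
Qed.

Lemma iseg_split g a m b : (forall x, a <= x <= b -> {for x, continuous g}) ->
  a <= m <= b -> iseg g a b = iseg g a m + iseg g m b.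
Proof.
move=> H /andP[am mb].
have gi := segment_integrable H.
have := @Rintegral_itvB R g (BLeft a) (BRight b) m gi.
rewrite !bnd_simp => /(_ am mb) E.
rewrite -(@Rintegral_itv_obnd_cbnd R m (BRight b) g).
  by rewrite -E addrC subrK.
apply: integrableS gi => //; apply: subset_itvr.
by rewrite bnd_simp.
Qed.

Lemma iseg_cst (k : R) a b : a <= b -> iseg (fun=> k) a b = k * (b - a).
Proof.
move=> ab; rewrite Rintegral_cst//= lebesgue_measure_itv /= lte_fin.
move: ab; rewrite le_eqVlt => /predU1P[->|ab]; first by rewrite ltxx subrr.
by rewrite ab.
Qed.

Lemma iseg_le g1 g2 a b : (forall x, a <= x <= b -> {for x, continuous g1}) ->
  (forall x, a <= x <= b -> {for x, continuous g2}) ->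
  (forall x, a <= x <= b -> g1 x <= g2 x) -> iseg g1 a b <= iseg g2 a b.
Proof.
move=> c1 c2 H; apply: le_Rintegral => //; try exact: segment_integrable.
Qed.

Lemma iseg_lin g1 g2 (k : R) a b : (forall x, a <= x <= b -> {for x, continuous g1}) ->
  (forall x, a <= x <= b -> {for x, continuous g2}) ->
  iseg (fun x => k * g1 x + g2 x) a b = k * iseg g1 a b + iseg g2 a b.
Proof.
move=> c1 c2.
have i1 := segment_integrable c1; have i2 := segment_integrable c2.
rewrite -(RintegralZl k _ i1)//; apply: RintegralD => //.
by apply: (integrableZl _ k i1).
Qed.

Lemma isegB g1 g2 a b : (forall x, a <= x <= b -> {for x, continuous g1}) ->
  (forall x, a <= x <= b -> {for x, continuous g2}) ->
  iseg (fun x => g1 x - g2 x) a b = iseg g1 a b - iseg g2 a b.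
Proof.
move=> c1 c2; by apply: RintegralB => //; apply: segment_integrable.
Qed.

Lemma iseg_near_cst g (k M : R) a b : a <= b ->
  (forall x, a <= x <= b -> {for x, continuous g}) ->
  (forall x, a <= x <= b -> `|g x - k| <= M) ->
  `|iseg g a b - k * (b - a)| <= M * (b - a).
Proof.
move=> ab cg H.
have cc (c : R) x : a <= x <= b -> {for x, continuous (fun=> c : R)}.
  by move=> _; exact: cst_continuous.
have L : (k - M) * (b - a) <= iseg g a b.
  rewrite -iseg_cst//; apply: iseg_le => // [x|x /H]; first exact: cc.
  by rewrite ler_norml => /andP[]; lra.
have U : iseg g a b <= (k + M) * (b - a).
  rewrite -iseg_cst//; apply: iseg_le => // [x|x /H]; first exact: cc.
  by rewrite ler_norml => /andP[]; lra.
by rewrite ler_norml; apply/andP; split; lra.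
Qed.

End SegmentIntegral.

(** * Goursat's lemma for a Cauchy-Riemann pair *)

Lemma dist_in_segment {R : realDomainType} (a b x y : R) :
  a <= x <= b -> a <= y <= b -> `|x - y| <= b - a.
Proof. by move=> /andP[? ?] /andP[? ?]; rewrite ler_norml; apply/andP; split; lra. Qed.

Lemma dist_endpoints_sum {R : realDomainType} (a b s : R) : a <= s <= b ->
  `|a - s| + `|b - s| <= b - a.
Proof. by move=> /andP[? ?]; rewrite ler0_norm ?subr_le0// ger0_norm ?subr_ge0//; lra. Qed.

Lemma sum4_le {R : realDomainType} (u v x X Y : R) : 0 <= X -> u + v <= X -> x <= Y ->
  v + x + (u + x) <= (X + Y) * 2 /\ x + v + (x + u) <= (Y + X) * 2.
Proof. by move=> *; split; lra. Qed.

(** Real differentiability of [U + i V] in the variable [s + i t], with the complex-linear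
    derivative [al + i be]; nothing is asked of the derivative at other points. *)
Definition cauchy_riemann {R : realType} (U V : R -> R -> R) (s t : R) : Prop :=
  exists al be : R, forall e : R, 0 < e -> exists2 eta : R, 0 < eta &
  forall h k, `|h| < eta -> `|k| < eta ->
  `|U (s + h) (t + k) - U s t - (al * h - be * k)| <= e * (`|h| + `|k|) /\
  `|V (s + h) (t + k) - V s t - (be * h + al * k)| <= e * (`|h| + `|k|).

Section Goursat.
Context {R : realType}.
Variables (U V : R -> R -> R) (a b : R).
Hypothesis CR : forall s t, a <= s <= b -> cauchy_riemann U V s t.

Let contU s : a <= s <= b -> continuous (U s).
Proof.
move=> sab t; have [al [be H]] := CR t sab.
apply/cvgrPdist_le => e e0.
have B0 : 0 < 1 + `|be| by rewrite ltr_pwDl.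
have [eta eta0 K] := H 1 ltr01.
near=> t'.
have k1 : `|t' - t| < eta by rewrite distrC; near: t'; apply/nbhs_ballP; exists eta.
have k2 : `|t' - t| < e / (1 + `|be|).
  rewrite distrC; near: t'; apply/nbhs_ballP; exists (e / (1 + `|be|)) => //; exact: divr_gt0.
have [+ _] := K 0 (t' - t) (eq_ind_r (fun x => x < eta) eta0 (normr0 R)) k1.
rewrite addr0 subrKC normr0 mulr0 sub0r add0r mul1r opprK => L.
rewrite distrC -[U s t' - U s t](addrK (be * (t' - t))).
rewrite (le_trans (ler_normB _ _))// normrM.
rewrite (le_trans (lerD L (lexx _)))//.
by rewrite -[X in X + _]mul1r -mulrDl mulrC -ler_pdivlMr// ltW.
Unshelve. all: by end_near.
Qed.

Let contV t s : a <= s <= b -> {for s, continuous (V^~ t)}.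
Proof.
move=> sab; have [al [be H]] := CR t sab.
apply/cvgrPdist_le => e e0.
have B0 : 0 < 1 + `|be| by rewrite ltr_pwDl.
have [eta eta0 K] := H 1 ltr01.
near=> t'.
have k1 : `|t' - s| < eta by rewrite distrC; near: t'; apply/nbhs_ballP; exists eta.
have k2 : `|t' - s| < e / (1 + `|be|).
  rewrite distrC; near: t'; apply/nbhs_ballP; exists (e / (1 + `|be|)) => //; exact: divr_gt0.
have [_] := K (t' - s) 0 k1 (eq_ind_r (fun x => x < eta) eta0 (normr0 R)).
rewrite addr0 subrKC normr0 mulr0 !addr0 mul1r => L.
rewrite distrC -[V t' t - V s t](subrK (be * (t' - s))).
rewrite (le_trans (ler_normD _ _))// normrM.
rewrite (le_trans (lerD L (lexx _)))//.
by rewrite -[X in X + _]mul1r -mulrDl mulrC -ler_pdivlMr// ltW.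
Unshelve. all: by end_near.
Qed.

Let J a' b' c d :=
  (iseg (U b') c d - iseg (U a') c d) - (iseg (V^~ d) a' b' - iseg (V^~ c) a' b').

(** This is the imaginary part of the contour integral of [U + i V] around the rectangle, the half
    from which the mean value property follows. On a small rectangle each pair of opposite sides
    contributes [al] times the area up to an error, and the two main terms cancel. *)
Lemma goursat c d : a <= b -> c <= d ->
  iseg (U b) c d - iseg (U a) c d = iseg (V^~ d) a b - iseg (V^~ c) a b.
Proof.
move=> ab cd; apply/eqP; rewrite -subr_eq0; apply/eqP.
apply: (@rect_additive_eq0 R J) => // [a' b' c' d' h1 h2 h3 h4 h5 h6 m n|s t sab tcd e e0].
  have m1 : a' <= m <= b' by apply/andP; rewrite /m; split; lra.
  have n1 : c' <= n <= d' by apply/andP; rewrite /n; split; lra.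
  have cV y x : a' <= x <= b' -> {for x, continuous (V^~ y)}.
    by move=> /andP[? ?]; apply: contV; apply/andP; split; lra.
  have cU x : a' <= x <= b' -> forall y, c' <= y <= d' -> {for y, continuous (U x)}.
    by move=> /andP[? ?] y _; apply: contU; apply/andP; split; lra.
  have aa : a' <= a' <= b' by rewrite lexx.
  have bb : a' <= b' <= b' by rewrite lexx andbT.
  rewrite /J (iseg_split (cU _ aa) n1) (iseg_split (cU _ bb) n1).
  rewrite (iseg_split (cV d') m1) (iseg_split (cV c') m1).
  ring.
have [al [be H]] := CR t sab.
have e4 : 0 < e / 2 by rewrite divr_gt0.
have [eta eta0 K] := H _ e4.
exists eta => // a' b' c' d' h1 h2 h3 h4 h5 h6 h7 h8 w1 w2.
pose D := (b' - a') + (d' - c').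
have ss : a' <= s <= b' by rewrite h2.
have tt : c' <= t <= d' by rewrite h6.
have cd' : c' <= d' by rewrite (le_trans h6).
have ab' : a' <= b' by rewrite (le_trans h2).
have aa : a' <= a' <= b' by rewrite lexx.
have bb : a' <= b' <= b' by rewrite lexx andbT.
have cc : c' <= c' <= d' by rewrite lexx.
have dd : c' <= d' <= d' by rewrite lexx andbT.
have cU x y : a' <= x <= b' -> {for y, continuous (U x)}.
  by move=> /andP[? ?]; apply: contU; rewrite (le_trans h1)//= (le_trans _ h4).
have cV y x : a' <= x <= b' -> {for x, continuous (V^~ y)}.
  by move=> /andP[? ?]; apply: contV; rewrite (le_trans h1)//= (le_trans _ h4).
have Ea : `|a' - s| + `|b' - s| <= b' - a'.
  exact: dist_endpoints_sum.
have Ec : `|c' - t| + `|d' - t| <= d' - c'.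
  exact: dist_endpoints_sum.
have est s1 t1 : a' <= s1 <= b' -> c' <= t1 <= d' ->
   `|U s1 t1 - U s t - (al * (s1 - s) - be * (t1 - t))| <= e / 2 * (`|s1 - s| + `|t1 - t|) /\
   `|V s1 t1 - V s t - (be * (s1 - s) + al * (t1 - t))| <= e / 2 * (`|s1 - s| + `|t1 - t|).
  move=> s1ab t1cd.
  have := K (s1 - s) (t1 - t); rewrite !subrKC; apply.
    exact: le_lt_trans (dist_in_segment s1ab ss) w1.
  exact: le_lt_trans (dist_in_segment t1cd tt) w2.
clear K w1 w2 h1 h2 h3 h4 h5 h6 h7 h8 H.
have B1 t1 : c' <= t1 <= d' -> `|(U b' t1 - U a' t1) - al * (b' - a')| <= e * D.
  move=> t1cd; have [E1 _] := est _ _ bb t1cd; have [E2 _] := est _ _ aa t1cd.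
  have -> : U b' t1 - U a' t1 - al * (b' - a') =
   (U b' t1 - U s t - (al * (b' - s) - be * (t1 - t)))
   - (U a' t1 - U s t - (al * (a' - s) - be * (t1 - t))) by ring.
  rewrite (le_trans (ler_normB _ _))// (le_trans (lerD E1 E2))//.
  rewrite -mulrDr -mulrA ler_pM2l// mulrC ler_pdivrMr//.
  by apply: (sum4_le _ Ea (dist_in_segment t1cd tt)).1; rewrite subr_ge0.
have B2 s1 : a' <= s1 <= b' -> `|(V s1 d' - V s1 c') - al * (d' - c')| <= e * D.
  move=> s1ab.
  have [_ E1] := est _ _ s1ab dd; have [_ E2] := est _ _ s1ab cc.
  have -> : V s1 d' - V s1 c' - al * (d' - c') =
   (V s1 d' - V s t - (be * (s1 - s) + al * (d' - t)))
   - (V s1 c' - V s t - (be * (s1 - s) + al * (c' - t))) by ring.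
  rewrite (le_trans (ler_normB _ _))// (le_trans (lerD E1 E2))//.
  rewrite -mulrDr -mulrA ler_pM2l// mulrC ler_pdivrMr//.
  by apply: (sum4_le _ Ec (dist_in_segment s1ab ss)).2; rewrite subr_ge0.
rewrite /J -(@isegB _ (U b') (U a')); [|by move=> y _; apply: cU..].
rewrite -(@isegB _ (V^~ d') (V^~ c')); [|by move=> y; apply: cV..].
have I1 := @iseg_near_cst R (fun y => U b' y - U a' y) _ _ _ _ cd' _ B1.
have I2 := @iseg_near_cst R (fun x => V x d' - V x c') _ _ _ _ ab' _ B2.
have {}I1 := I1 (fun y _ => cvgB (cU b' y bb) (cU a' y aa)).
have {}I2 := I2 (fun x xab => cvgB (cV d' x xab) (cV c' x xab)).
move: I1 I2; rewrite /D; set X := Rintegral _ _ _; set Y := Rintegral _ _ _ => I1 I2.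
have -> : X - Y = (X - al * (b' - a') * (d' - c')) - (Y - al * (d' - c') * (b' - a')) by ring.
rewrite (le_trans (ler_normB _ _))// (le_trans (lerD (I1 (fun y => nbhs_filter y)) (I2 (fun y => nbhs_filter y))))//.
by rewrite -mulrDr expr2 mulrA (addrC (d' - c')).
Qed.

End Goursat.

(** * Polar coordinates *)

Definition cis {R : realType} (t : R) : R[i] := (cos t +i* sin t)%C.

Section Polar.
Context {R : realType}.
Implicit Types (s t h k r e : R) (z w d : R[i]) (F : R[i] -> R[i]).

Lemma cisD s t : cis (s + t) = cis s * cis t.
Proof.
apply/eqP; rewrite eq_complex ReM ImM /= cosD sinD eqxx/=.
by apply/eqP; ring.
Qed.

Lemma cis0 : cis (0 : R) = 1.
Proof. by rewrite /cis cos0 sin0. Qed.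

Lemma nc_cis t : nc (cis t) = 1.
Proof. by rewrite ncE cos2Dsin2 sqrtr1. Qed.

Lemma cisD2pi t : cis (t + pi *+ 2) = cis t.
Proof. by rewrite /cis cosD2pi sinD2pi. Qed.

Lemma polarE r t : (r%:C)%C * cis t = (r * cos t +i* (r * sin t))%C.
Proof. by apply/eqP; rewrite eq_complex ReM ImM /= !mul0r subr0 addr0 !eqxx. Qed.

Lemma nc_polar r t : nc ((r%:C)%C * cis t) = `|r|.
Proof. by rewrite ncM nc_cis mulr1 nc_real. Qed.

Lemma is_derive_eps (g : R -> R) (x d : R) : is_derive x 1 g d ->
  forall e, 0 < e -> exists2 eta, 0 < eta &
  forall h, `|h| < eta -> `|g (x + h) - g x - d * h| <= e * `|h|.
Proof.
move=> [gx gd] e e0.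
move: gx gd; rewrite /derivable /derive => /cvg_ex [l gl].
rewrite (cvg_lim _ gl)// => ld; rewrite {}ld in gl.
move/cvgrPdist_le : gl => /(_ _ e0) /nbhs_ballP [eta /= eta0 H].
exists eta => // h he; have [->|h0] := eqVneq h 0.
  by rewrite addr0 subrr mulr0 subr0 normr0 mulr0.
have := H h; rewrite /ball /= sub0r normrN => /(_ he h0).
rewrite /= /shift /= scaler1 => K.
have -> : g (x + h) - g x - d * h = - (h * (d - h^-1 * (g (h + x) - g x))).
  by rewrite [h + x]addrC; field.
by rewrite normrN normrM mulrC ler_wpM2r.
Qed.

(** Complex differentiability of the exponential at 0, assembled from the real derivatives of
    [expR], [cos] and [sin]. *)
Lemma expR_cis_expand e : 0 < e -> exists2 eta, 0 < eta &
  forall h k, `|h| < eta -> `|k| < eta ->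
  nc (((expR h)%:C)%C * cis k - 1 - (h +i* k)%C) <= e * (`|h| + `|k|).
Proof.
move=> e0; have e4 : 0 < e / 4 by rewrite divr_gt0.
have [a a0 Ha] := is_derive_eps (is_derive_expR 0) e4.
have [b b0 Hb] := is_derive_eps (is_derive_cos 0) e4.
have [c c0 Hc] := is_derive_eps (is_derive_sin 0) e4.
(* The bound [e / 4] on [k] absorbs the cross term [h k]. *)
exists (Num.min (Num.min (Num.min a b) (Num.min c 1)) (e / 4)).
  by rewrite !lt_min a0 b0 c0 ltr01.
move=> h k; rewrite !lt_min.
move=> /andP[/andP[/andP[ha _] /andP[_ h1]] _] /andP[/andP[/andP[_ kb] /andP[kc _]] ke].
have {ha}A := Ha _ ha; have {kb}B := Hb _ kb; have {kc}C := Hc _ kc.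
move: A B C; rewrite !add0r expR0 cos0 sin0 mul1r oppr0 mul0r !subr0 mul1r ?addr0 => A B C.
have h2 : `|1 + h| <= 2 by rewrite (le_trans (ler_normD _ _))// normr1; lra.
have -> : ((expR h)%:C)%C * cis k - 1 - (h +i* k)%C =
   (((expR h - 1 - h) * cos k + (1 + h) * (cos k - 1)) +i*
     ((expR h - 1 - h) * sin k + (1 + h) * (sin k - k) + h * k))%C.
  rewrite polarE; apply/eqP; rewrite eq_complex /= ; apply/andP; split; apply/eqP; ring.
rewrite (le_trans (nc_le_ReIm _ _))//.
have ck : `|cos k| <= 1 by rewrite ler_norml cos_geN1 cos_le1.
have sk : `|sin k| <= 1 by rewrite ler_norml sin_geN1 sin_le1.
have E1 : `|(expR h - 1 - h) * cos k| <= e / 4 * `|h|.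
  by rewrite normrM -[leRHS]mulr1 ler_pM.
have E2 : `|(expR h - 1 - h) * sin k| <= e / 4 * `|h|.
  by rewrite normrM -[leRHS]mulr1 ler_pM.
have E3 : `|(1 + h) * (cos k - 1)| <= 2 * (e / 4 * `|k|).
  by rewrite normrM ler_pM.
have E4 : `|(1 + h) * (sin k - k)| <= 2 * (e / 4 * `|k|).
  by rewrite normrM ler_pM.
have E5 : `|h * k| <= e / 4 * `|h| by rewrite normrM mulrC ler_wpM2r// ltW.
have N1 := ler_normD ((expR h - 1 - h) * cos k) ((1 + h) * (cos k - 1)).
have N2 := ler_normD ((expR h - 1 - h) * sin k + (1 + h) * (sin k - k)) (h * k).
have N3 := ler_normD ((expR h - 1 - h) * sin k) ((1 + h) * (sin k - k)).
have P1 : 0 <= e * `|h| by rewrite mulr_ge0// ltW.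
have P2 : 0 <= e * `|k| by rewrite mulr_ge0// ltW.
rewrite (le_trans (lerD N1 (le_trans N2 (lerD N3 (lexx _)))))//.
rewrite (le_trans (lerD (lerD E1 E3) (lerD (lerD E2 E4) E5)))//.
by move: P1 P2; clear; lra.
Qed.

(** Chain rule for [F (exp (s + i t))], with derivative [d z]. In these coordinates an annulus about
    0 becomes a rectangle, its circles become the sides [s] constant, and [dt] is the angular
    measure. *)
Lemma cauchy_riemann_polar F s t d : cdiff F (((expR s)%:C)%C * cis t) d ->
  cauchy_riemann (fun s t => complex.Re (F (((expR s)%:C)%C * cis t)))
    (fun s t => complex.Im (F (((expR s)%:C)%C * cis t))) s t.
Proof.
set z := _ * cis t => Fd.
exists (complex.Re (d * z)), (complex.Im (d * z)) => e e0.
have Z0 : 0 < 1 + nc z by rewrite ltr_pwDl// nc_ge0.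
have D0 : 0 < 1 + nc (d * z) by rewrite ltr_pwDl// nc_ge0.
have e1 : 0 < e / 4 / (1 + nc z) by rewrite !divr_gt0.
have e2 : 0 < Num.min 1 (e / 2 / (1 + nc (d * z))).
  by rewrite lt_min ltr01 !divr_gt0.
have [a a0 Ha] := Fd _ e1; have [b b0 Hb] := expR_cis_expand e2.
exists (Num.min b (a / 4 / (1 + nc z))); first by rewrite lt_min b0 !divr_gt0.
move=> h k; rewrite !lt_min => /andP[h1 h2] /andP[k1 k2].
have Ehk := Hb _ _ h1 k1.
pose E : R[i] := ((expR h)%:C)%C * cis k.
have zE : ((expR (s + h))%:C)%C * cis (t + k) = z + z * (E - 1).
  rewrite /z /E expRD cisD rmorphM /=; ring.
pose m := `|h| + `|k|.
have m0 : 0 <= m by rewrite addr_ge0.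
have E1 : nc (E - 1) <= 2 * m.
  rewrite -[E - 1](subrK (h +i* k)%C) (le_trans (ncD _ _))//.
  rewrite (le_trans (lerD Ehk (nc_le_ReIm _ _)))// mulrDl mul1r lerD2r.
  by rewrite ler_piMl// ge_min lexx.
have H1 : nc (z * (E - 1)) < a.
  rewrite ncM (le_lt_trans (ler_wpM2l (nc_ge0 z) E1))//.
  have : (1 + nc z) * (2 * m) < a.
    rewrite mulrC -ltr_pdivlMr// mulrC -ltr_pdivlMr// /m.
    move: h2 k2; set q := a / 4 / _; set q' := a / _ / 2.
    have -> : q' = 2 * q by rewrite /q /q'; field; rewrite gt_eqF.
    lra.
  apply: le_lt_trans; rewrite ler_wpM2r ?lerDr//.
  by rewrite mulr_ge0.
have K := Ha _ H1.
have L : nc (F (z + z * (E - 1)) - F z - d * z * (h +i* k)%C) <= e * m.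
  have -> : F (z + z * (E - 1)) - F z - d * z * (h +i* k)%C =
    (F (z + z * (E - 1)) - F z - d * (z * (E - 1))) + d * z * (E - 1 - (h +i* k)%C).
    by ring.
  rewrite (le_trans (ncD _ _))// [leRHS](_ : _ = e / 2 * m + e / 2 * m); last by field.
  apply: lerD.
    rewrite (le_trans K)// ncM.
    apply: (@le_trans _ _ (e / 4 / (1 + nc z) * ((1 + nc z) * (2 * m)))).
      by rewrite ler_pM2l// ler_pM ?nc_ge0// lerDr.
    by rewrite mulrA mulfVK ?gt_eqF// mulrA (_ : e / 4 * 2 = e / 2)//; field.
  rewrite ncM.
  apply: (@le_trans _ _ ((1 + nc (d * z)) * (e / 2 / (1 + nc (d * z)) * m))).
    rewrite ler_pM ?nc_ge0 ?lerDr// (le_trans Ehk)// ler_wpM2r//.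
    by rewrite ge_min lexx orbT.
  by rewrite mulrA mulrCA divff ?mulr1// gt_eqF.
rewrite zE; split; apply: le_trans L.
  have := Re_le_nc (F (z + z * (E - 1)) - F z - d * z * (h +i* k)%C).
  by rewrite !ReD !ReN (ReM (d * z)).
have := Im_le_nc (F (z + z * (E - 1)) - F z - d * z * (h +i* k)%C).
by rewrite !ImD !ImN (ImM (d * z)) (addrC (complex.Re (d * z) * _)).
Qed.

End Polar.

(** * Continuity in real coordinates *)

Section ContComp.
Context {R : realType} {T : topologicalType} (g1 g2 : T -> R) (p : T) (F : R[i] -> R[i]).
Hypotheses (c1 : {for p, continuous g1}) (c2 : {for p, continuous g2}).
Hypothesis cF : ccont F (g1 p +i* g2 p)%C.

Let near_comp (e : R) : 0 < e ->
  \forall x \near p, nc (F (g1 x +i* g2 x)%C - F (g1 p +i* g2 p)%C) <= e.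
Proof.
move=> e0; have [eta eta0 H] := cF e0.
have eta2 : 0 < eta / 2 by rewrite divr_gt0.
near=> x.
have d1 : `|g1 p - g1 x| < eta / 2 by near: x; exact: (cvgrPdist_lt _ _).1.
have d2 : `|g2 p - g2 x| < eta / 2 by near: x; exact: (cvgrPdist_lt _ _).1.
have E : (g1 x +i* g2 x)%C = (g1 p +i* g2 p)%C + ((g1 x - g1 p) +i* (g2 x - g2 p))%C.
  by apply/eqP; rewrite eq_complex /= !subrKC !eqxx.
rewrite E; apply: H.
rewrite (le_lt_trans (nc_le_ReIm _ _))// [ltRHS]splitr ltrD// distrC//.
Unshelve. all: by end_near.
Qed.

Lemma Re_comp_continuous : {for p, continuous (fun x => complex.Re (F (g1 x +i* g2 x)%C))}.
Proof.
apply/cvgrPdist_le => e e0; have := near_comp e0; apply: filterS => x.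
by apply: le_trans; rewrite distrC -ReN -ReD Re_le_nc.
Qed.

Lemma nc_comp_continuous : {for p, continuous (fun x => nc (F (g1 x +i* g2 x)%C))}.
Proof.
apply/cvgrPdist_le => e e0; have := near_comp e0; apply: filterS => x.
apply: le_trans; rewrite ler_norml lerNl opprB nc_dist_ge /= nc_distC.
exact: nc_dist_ge.
Qed.

End ContComp.

Lemma eq_of_continuous_accumulation {R : realType} (M : R -> R) (x c : R) :
  {for x, continuous M} ->
  (forall eta, 0 < eta -> exists2 y, `|x - y| < eta & M y = c) -> M x = c.
Proof.
move=> /cvgrPdist_lt cM H; apply/eqP; rewrite -subr_eq0 -normr_le0.
apply/ler_addgt0Pl => e e0; rewrite addr0.
have /nbhs_ballP [eta /= eta0 K] := cM _ e0.
have [y xy <-] := H _ eta0; apply: ltW; exact: K.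
Qed.

(** * The mean value property with one exceptional point *)

Section MeanValue.
Context {R : realType}.
Variables (F : R[i] -> R[i]) (p : R[i]).
Hypothesis cF : forall z, nc z < 1 -> ccont F z.
Hypothesis dF : forall z, nc z < 1 -> z != p -> exists d, cdiff F z d.

Let M (r : R) := iseg (fun t => complex.Re (F ((r%:C)%C * cis t))) 0 (pi *+ 2).

Let pi2 : 0 <= pi *+ 2 :> R.
Proof. by rewrite mulrn_wge0// pi_ge0. Qed.

(** Goursat's lemma on [[ln r1, ln r2] x [0, 2 pi]]: the sides [t = 0] and [t = 2 pi] carry the same
    values and cancel, which leaves the two circular means. The hypothesis on [p] keeps the
    exceptional point off the rectangle. *)
Let M_const (r1 r2 : R) : 0 < r1 -> r1 <= r2 -> r2 < 1 -> (nc p < r1 \/ r2 < nc p) ->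
  M r1 = M r2.
Proof.
move=> r10 r12 r21 pr; have r20 : 0 < r2 by exact: lt_le_trans r12.
pose U (s t : R) := complex.Re (F (((expR s)%:C)%C * cis t)).
pose V (s t : R) := complex.Im (F (((expR s)%:C)%C * cis t)).
have CR s t : ln r1 <= s <= ln r2 -> cauchy_riemann U V s t.
  move=> /andP[s1 s2].
  have e1 : r1 <= expR s by rewrite -(lnK r10) ler_expR.
  have e2 : expR s <= r2 by rewrite -(lnK r20) ler_expR.
  have zs : nc (((expR s)%:C)%C * cis t) = expR s by rewrite nc_polar gtr0_norm// expR_gt0.
  have [] := @dF (((expR s)%:C)%C * cis t).
  - by rewrite zs (le_lt_trans e2).
  - apply/eqP => E; move: pr; rewrite -E zs => -[|].
      by rewrite ltNge e1.
    by rewrite ltNge e2.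
  - by move=> d; exact: cauchy_riemann_polar.
have ln12 : ln r1 <= ln r2 by rewrite ler_ln.
have := goursat CR ln12 pi2.
rewrite /U /V !lnK//.
have -> : cis (pi *+ 2) = cis (0 : R) by rewrite -[pi *+ 2]add0r cisD2pi.
by rewrite subrr => /eqP; rewrite subr_eq0 => /eqP.
Qed.

Let cont2 (r t : R) : `|r| < 1 ->
  {for (r, t), continuous (fun x : R * R => nc (F ((x.1 * cos x.2) +i* (x.1 * sin x.2))%C))}.
Proof.
move=> r1.
apply: (@nc_comp_continuous _ _ (fun x : R * R => x.1 * cos x.2) (fun x => x.1 * sin x.2)).
- apply: cvgM; first exact: cvg_fst.
  apply: (@continuous_comp _ _ _ snd cos); first exact: cvg_snd.
  exact: continuous_cos.
- apply: cvgM; first exact: cvg_fst.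
  apply: (@continuous_comp _ _ _ snd sin); first exact: cvg_snd.
  exact: continuous_sin.
- by apply: cF; rewrite -polarE nc_polar.
Qed.

Let bounded (rho : R) : 0 <= rho -> rho < 1 -> exists B : R, forall r t, `|r| <= rho ->
  0 <= t <= pi *+ 2 -> nc (F ((r%:C)%C * cis t)) <= B.
Proof.
move=> rho0 rho1.
pose K := `[-rho, rho]%classic `*` `[0, pi *+ 2 : R]%classic.
have cK : compact K by apply: compact_setX; exact: segment_compact.
pose G := fun x : R * R => nc (F ((x.1 * cos x.2) +i* (x.1 * sin x.2))%C).
have cG : {within K, continuous G}.
  apply: continuous_in_subspaceT => -[r t]; rewrite inE => -[/= ].
  rewrite in_itv /= => h _; apply: cont2; apply: le_lt_trans rho1.
  by rewrite ler_norml.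
have := compact_bounded (continuous_compact cG cK).
case=> B [Br HB]; exists (B + 1) => r t rr tt.
have : `|G (r, t)| <= B + 1.
  apply: (HB (B + 1)); first by rewrite ltrDl.
  exists (r, t) => //; split; rewrite /= in_itv //= -?ler_norml//.
by rewrite ger0_norm ?nc_ge0// /G /= -polarE.
Qed.

Let contt (r t : R) : `|r| < 1 -> 
  {for t, continuous (fun t : R => complex.Re (F ((r%:C)%C * cis t)))}.
Proof.
move=> r1.
rewrite (_ : (fun t => _) = (fun t : R => complex.Re (F ((r * cos t) +i* (r * sin t))%C))); last first.
  by apply/funext => x; rewrite polarE.
apply: (@Re_comp_continuous R R (fun t : R => r * cos t) (fun t : R => r * sin t)).
- by apply: cvgM; [exact: cvg_cst|exact: continuous_cos].
- by apply: cvgM; [exact: cvg_cst|exact: continuous_sin].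
- by apply: cF; rewrite -polarE nc_polar.
Qed.

Let contr (r t : R) : `|r| < 1 -> 
  {for r, continuous (fun r : R => complex.Re (F ((r%:C)%C * cis t)))}.
Proof.
move=> r1.
rewrite (_ : (fun r => _) = (fun r : R => complex.Re (F ((r * cos t) +i* (r * sin t))%C))); last first.
  by apply/funext => x; rewrite polarE.
apply: (@Re_comp_continuous R R (fun r : R => r * cos t) (fun r : R => r * sin t)).
- by apply: cvgM; [exact: cvg_id|exact: cvg_cst].
- by apply: cvgM; [exact: cvg_id|exact: cvg_cst].
- by apply: cF; rewrite -polarE nc_polar.
Qed.

Let M_cont (r : R) : 0 <= r < 1 -> {for r, continuous M}.
Proof.
move=> /andP[r0 r1].
pose rho := (r + 1) / 2.
have rrho : r < rho by rewrite /rho; lra.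
have rho1 : rho < 1 by rewrite /rho; lra.
have rho0 : 0 <= rho by rewrite (le_trans r0)// ltW.
have [B HB] := bounded rho0 rho1.
have inI x : x \in `]-rho, rho[%classic -> `|x| < rho.
  by rewrite inE /= in_itv /= ltr_norml.
have H : {in `]-rho, rho[%classic, continuous M}.
  apply: (@continuity_under_integral R _ _ (@lebesgue_measure R)
     (fun r t => complex.Re (F ((r%:C)%C * cis t))) `[0, pi *+ 2]%classic _ (-rho) rho
     _ _ (fun=> B)).
  - exact: measurable_itv.
  - move=> x /mem_set/inI xr; apply: segment_integrable => t _; apply: contt.
    exact: lt_trans rho1.
  - by apply: aeW => t _ x /inI xr; apply: contr; exact: lt_trans rho1.
  - by apply: segment_integrable => x _; exact: cst_continuous.
  - move=> x /mem_set/inI xr; apply: aeW => t; rewrite /= in_itv /= => tt.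
    by rewrite (le_trans (Re_le_nc _))// HB// ltW.
apply: H; rewrite inE /= in_itv /= rrho andbT; apply: (lt_le_trans _ r0).
rewrite oppr_lt0 /rho; lra.
Qed.

(** The circular mean is constant on either side of the radius [|p|], and its continuity glues the
    two ranges together and to the centre. The exceptional point makes the result applicable to
    divided differences, of which only continuity is known at the base point. *)
Lemma mean_value_property (r : R) : 0 <= r < 1 ->
  iseg (fun t => complex.Re (F ((r%:C)%C * cis t))) 0 (pi *+ 2)
  = complex.Re (F 0) * (pi *+ 2).
Proof.
have M0 : M 0 = complex.Re (F 0) * (pi *+ 2).
  rewrite /M; under eq_Rintegral do rewrite mul0r.
  by rewrite iseg_cst// subr0.
rewrite -M0 -/(M r); pose q := nc p; have q0 : 0 <= q := nc_ge0 p.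
have step a : 0 < a -> a < 1 -> (forall eta, 0 < eta -> exists2 y, `|a - y| < eta & M y = M 0) ->
   M a = M 0.
  by move=> a0 a1; apply: eq_of_continuous_accumulation; apply: M_cont; rewrite ltW.
(* below |p| the mean is constant and tends to its value at the centre *)
have small a : 0 < a -> a < 1 -> a < q -> M a = M 0.
  move=> a0 a1 aq; apply/esym; apply: eq_of_continuous_accumulation.
    by apply: M_cont; rewrite lexx ltr01.
  move=> eta eta0; exists (Num.min a (eta / 2)).
    rewrite sub0r normrN ger0_norm.
      by rewrite gt_min orbC ltr_pdivrMr// mulr2n mulrDr mulr1 ltrDl eta0.
    by rewrite le_min !ltW// divr_gt0.
  apply: M_const => //; last by right.
    by rewrite lt_min a0 divr_gt0.
  by rewrite ge_min lexx.
have large b a : 0 < b -> b <= a -> a < 1 -> q < b -> M a = M b.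
  by move=> b0 ba a1 qb; apply/esym; apply: M_const => //; left.
have atq : q < 1 -> M q = M 0.
  move=> q1; have [->//|qn0] := eqVneq q 0.
  have q00 : 0 < q by rewrite lt_def qn0.
  apply: step => // eta eta0; exists (Num.max (q / 2) (q - eta / 2)).
    have h1 : q / 2 < q by lra.
    have h2 : q - eta / 2 < q by lra.
    rewrite ger0_norm; last by rewrite subr_ge0 ge_max !ltW.
    rewrite ltrBlDr -ltrBlDl lt_max; apply/orP; right; lra.
  apply: small.
  - by rewrite lt_max divr_gt0.
  - rewrite gt_max; apply/andP; split; lra.
  - rewrite gt_max; apply/andP; split; lra.
move=> /andP[r0 r1]; have [-> //|rn0] := eqVneq r 0.
have {rn0} r00 : 0 < r by rewrite lt_def rn0.
have [rq|qr|rq] := ltgtP r q; [exact: small| |by rewrite rq; apply: atq; rewrite -rq].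
have q1 : q < 1 by exact: lt_trans r1.
rewrite -(atq q1); apply/esym; apply: eq_of_continuous_accumulation.
  by apply: M_cont; rewrite q0.
move=> eta eta0; exists (Num.min r (q + eta / 2)).
  have h : q + eta / 2 > q by lra.
  rewrite distrC ger0_norm; last by rewrite subr_ge0 le_min !ltW.
  rewrite ltrBlDr gt_min; apply/orP; right; lra.
apply/esym; apply: large => //.
- by rewrite lt_min r00; lra.
- by rewrite ge_min lexx.
- rewrite lt_min qr; lra.
Qed.

End MeanValue.

(** * Cauchy's estimate and a pointwise bound by a circular mean *)

Definition divided_difference {R : realType} (h : R[i] -> R[i]) (w d x : R[i]) : R[i] :=
  if x == w then d else (h x - h w) / (x - w).

Section LocalEstimates.
Context {R : realType}.
Implicit Types (z w d x : R[i]) (f g h : R[i] -> R[i]) (r s B : R).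

Lemma cdiff_local f g z d rho : 0 < rho ->
  (forall x, nc (x - z) < rho -> f x = g x) -> cdiff f z d -> cdiff g z d.
Proof.
move=> rho0 fg fd e e0; have [eta eta0 H] := fd _ e0.
exists (Num.min eta rho); first by rewrite lt_min eta0.
move=> k; rewrite lt_min => /andP[k1 k2].
have <- : f (z + k) = g (z + k) by apply: fg; rewrite [z + k]addrC addrK.
have <- : f z = g z by apply: fg; rewrite subrr nc0.
exact: H.
Qed.

Lemma divided_difference_cdiff h w d z d' : z != w -> cdiff h z d' ->
  exists d'', cdiff (divided_difference h w d) z d''.
Proof.
move=> zw hd; have nz : 0 < nc (z - w) by rewrite nc_gt0 subr_eq0.
have zw0 : - w + 1 * z != 0 by rewrite mul1r addrC subr_eq0.
have := cdiffM (cdiffD hd (cdiff_cst (- h w) z)) (cdiff_affineV zw0).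
set d'' := (X in cdiff _ _ X) => H; exists d''.
apply: cdiff_local H; first exact: nz.
move=> x xz; rewrite /divided_difference; case: eqP => [xw|_].
  by move: xz; rewrite xw nc_distC ltxx.
by rewrite mul1r [- w + x]addrC.
Qed.

Lemma divided_difference_ccont h w d : cdiff h w d -> ccont (divided_difference h w d) w.
Proof.
move=> hd e e0; have [eta eta0 H] := hd _ e0; exists eta => // k k1.
rewrite /divided_difference eqxx; case: eqP => [_|/eqP kw].
  by rewrite subrr nc0 ltW.
have k0 : k != 0 by apply: contraNN kw => /eqP ->; rewrite addr0.
have -> : w + k - w = k by rewrite addrC addKr.
have -> : (h (w + k) - h w) / k - d = (h (w + k) - h w - d * k) / k by field.
by rewrite ncM ncV ler_pdivrMr ?nc_gt0// H.
Qed.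

Lemma ccontM f g z : ccont f z -> ccont g z -> ccont (fun x => f x * g x) z.
Proof.
move=> cf cg e e0.
pose m := 1 + nc (f z) + nc (g z).
have m0 : 0 < m by rewrite /m -addrA ltr_pwDl// addr_ge0// nc_ge0.
have e2 : 0 < Num.min 1 (e / 2 / m) by rewrite lt_min ltr01 !divr_gt0.
have [a a0 Ha] := cf _ e2; have [b b0 Hb] := cg _ e2.
exists (Num.min a b); first by rewrite lt_min a0.
move=> k; rewrite lt_min => /andP[k1 k2].
have -> : f (z + k) * g (z + k) - f z * g z =
  f (z + k) * (g (z + k) - g z) + (f (z + k) - f z) * g z by ring.
have {}Ha := Ha _ k1; have {}Hb := Hb _ k2.
have F : nc (f (z + k)) <= m.
  rewrite -[f (z + k)](subrK (f z)) (le_trans (ncD _ _))//.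
  have : nc (f (z + k) - f z) <= 1 by rewrite (le_trans Ha)// ge_min lexx.
  have := nc_ge0 (g z); rewrite /m; lra.
have G : nc (g z) <= m by have := nc_ge0 (f z); rewrite /m; lra.
rewrite (le_trans (ncD _ _))// !ncM.
have -> : e = m * (e / 2 / m) + e / 2 / m * m by field; rewrite gt_eqF.
rewrite lerD// ler_pM ?nc_ge0//.
  by rewrite (le_trans Hb)// ge_min lexx orbT.
by rewrite (le_trans Ha)// ge_min lexx orbT.
Qed.

Lemma polar_comp_continuous f r t : ccont f ((r%:C)%C * cis t) ->
  {for t, continuous (fun t : R => complex.Re (f ((r%:C)%C * cis t)))} /\
  {for t, continuous (fun t : R => nc (f ((r%:C)%C * cis t)))}.
Proof.
move=> cf.
rewrite (_ : (fun t : R => complex.Re _) =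
  (fun t : R => complex.Re (f ((r * cos t) +i* (r * sin t))%C))); last first.
  by apply/funext => x; rewrite polarE.
rewrite (_ : (fun t : R => nc _) =
  (fun t : R => nc (f ((r * cos t) +i* (r * sin t))%C))); last first.
  by apply/funext => x; rewrite polarE.
have c1 : {for t, continuous (fun t : R => r * cos t)}.
  by apply: cvgM; [exact: cvg_cst|exact: continuous_cos].
have c2 : {for t, continuous (fun t : R => r * sin t)}.
  by apply: cvgM; [exact: cvg_cst|exact: continuous_sin].
by split; [apply: (@Re_comp_continuous R R (fun t : R => r * cos t) (fun t : R => r * sin t))
  |apply: (@nc_comp_continuous R R (fun t : R => r * cos t) (fun t : R => r * sin t))] => //;
  rewrite -polarE.
Qed.

Lemma twopi_gt0 : 0 < pi *+ 2 :> R.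
Proof. by rewrite mulrn_wgt0// pi_gt0. Qed.

(** Cauchy's estimate. The divided difference at 0 of [x |-> f (w + s x)] is continuous with value
    [s d] at 0, so [s |d|] is a mean over the circle of radius [1/2], where the quotient is at most
    [2 B / (1/2) = 4 B]. *)
Lemma derivative_le_of_bounded f w d s B : 0 < s ->
  (forall x, nc (x - w) < s -> exists d', cdiff f x d') -> cdiff f w d ->
  (forall x, nc (x - w) < s -> nc (f x) <= B) -> nc d <= 4 * B / s.
Proof.
move=> s0 fd wd fB.
have [c c1 cd] := exists_rotation_to_nc d.
pose G x := f (w + ((s%:C)%C * x)).
have Gd x : nc x < 1 -> exists d', cdiff G x d'.
  move=> x1; have [|d' Hd'] := fd (w + (s%:C)%C * x).
    by rewrite addrC addKr ncM nc_real gtr0_norm// -[ltRHS]mulr1 ltr_pM2l.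
  by exists ((s%:C)%C * d'); exact: cdiff_comp_affine.
have G0 : cdiff G 0 ((s%:C)%C * d) by apply: cdiff_comp_affine; rewrite mulr0 addr0.
pose F x := c * divided_difference G 0 ((s%:C)%C * d) x.
have dF z : nc z < 1 -> z != 0 -> exists d, cdiff F z d.
  move=> z1 z0; have [d' Hd'] := Gd _ z1.
  have [d'' Hd''] := @divided_difference_cdiff G 0 ((s%:C)%C * d) z d' z0 Hd'.
  by exists (c * d''); exact: cdiffZ.
have cF z : nc z < 1 -> ccont F z.
  move=> z1; have [->|z0] := eqVneq z 0.
    apply: ccontM; first exact: cdiff_ccont (cdiff_cst _ _).
    exact: divided_difference_ccont.
  by have [d' Hd'] := dF _ z1 z0; exact: cdiff_ccont Hd'.
have r2 : 0 <= (2^-1 : R) < 1 by rewrite invr_ge0 ler0n invf_lt1// ltr1n.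
have := mean_value_property cF dF r2.
have -> : complex.Re (F 0) = s * nc d.
  by rewrite /F /divided_difference eqxx mulrCA cd ReM /= mulr0 subr0.
move=> E.
have : s * nc d * (pi *+ 2) <= 4 * B * (pi *+ 2).
  rewrite -E -[X in _ <= _ * X]subr0 -(iseg_cst (4 * B) (ltW twopi_gt0)).
  apply: iseg_le.
  - move=> t _; apply: (polar_comp_continuous _).1; apply: cF.
    by rewrite nc_polar gtr0_norm ?invr_gt0//; case/andP: r2.
  - by move=> t _; exact: cst_continuous.
  - move=> t _; rewrite (le_trans (ler_norm _))// (le_trans (Re_le_nc _))//.
    set x := _ * cis t.
    have nx : nc x = 2^-1 by rewrite nc_polar gtr0_norm ?invr_gt0.
    have x0 : x != 0 by rewrite -nc_gt0 nx invr_gt0.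
    rewrite /F /divided_difference (negbTE x0) ncM c1 mul1r subr0 ncM ncV nx invrK.
    have b1 : nc (G x) <= B.
      by apply: fB; rewrite addrC addKr ncM nc_real gtr0_norm// nx ltr_pdivrMr// mulr2n mulrDr mulr1 ltrDl.
    have b2 : nc (G 0) <= B.
      by apply: fB; rewrite mulr0 addr0 subrr nc0.
    by have := ncB (G x) (G 0); lra.
by rewrite ler_pM2r ?twopi_gt0// ler_pdivlMr// mulrC.
Qed.

(** With [y = x / (x - w)] the hypothesis gives [|y - 1| <= |y|]: the point [y] is no further from 1
    than from 0. *)
Lemma Re_div_ge_half x w : nc w < nc x -> 2^-1 <= complex.Re (x / (x - w)).
Proof.
move=> wx; have xw : x - w != 0.
  by rewrite subr_eq0; apply: contraTN wx => /eqP ->; rewrite ltxx.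
set y := x / _.
have : nc (y - 1) <= nc y.
  have -> : y - 1 = w / (x - w) by rewrite /y; field.
  by rewrite /y !ncM ler_wpM2r ?nc_ge0// ltW.
move=> H; have : nc (y - 1) ^+ 2 <= nc y ^+ 2 by rewrite lerXn2r ?nnegrE ?nc_ge0.
by rewrite !nc_sqr ReD ReN ImD ImN /= oppr0 addr0; lra.
Qed.

(** The function [x (h x - h w) / (x - w)] vanishes at 0, hence has mean 0 on the circle. After a
    rotation making [h w] nonnegative, the part with [h w] has real part at least [|h w| / 2], and
    the part with [h x] is at most [r / (r - |w|)] times [|h x|]. *)
Lemma point_le_circle_mean h w r : (forall z, nc z < 1 -> exists d, cdiff h z d) ->
  nc w < r -> r < 1 ->
  nc (h w) * pi <= r / (r - nc w) * iseg (fun t => nc (h ((r%:C)%C * cis t))) 0 (pi *+ 2).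
Proof.
move=> hd wr r1.
have r0 : 0 < r by rewrite (le_lt_trans _ wr)// nc_ge0.
have w1 : nc w < 1 by exact: lt_trans r1.
have [d wd] := hd _ w1.
have [c c1 cw] := exists_rotation_to_nc (h w).
pose F x := c * (x * divided_difference h w d x).
have dF z : nc z < 1 -> z != w -> exists d, cdiff F z d.
  move=> z1 z0; have [d' Hd'] := hd _ z1.
  have [d'' Hd''] := @divided_difference_cdiff h w d z d' z0 Hd'.
  by have := cdiffZ c (cdiffM (@cdiff_id _ z) Hd''); set e := (X in cdiff _ _ X); exists e.
have cF z : nc z < 1 -> ccont F z.
  move=> z1; have [->|z0] := eqVneq z w.
    apply: ccontM; first exact: cdiff_ccont (cdiff_cst _ _).
    apply: ccontM; first exact: cdiff_ccont (@cdiff_id _ _).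
    exact: divided_difference_ccont.
  by have [d' Hd'] := dF _ z1 z0; exact: cdiff_ccont Hd'.
have rr : 0 <= r < 1 by rewrite r1 ltW.
have := mean_value_property cF dF rr.
have -> : complex.Re (F 0) = 0 by rewrite /F mul0r mulr0.
rewrite mul0r => E.
pose k := r / (r - nc w).
have polar1 t : nc ((r%:C)%C * cis t) = r by rewrite nc_polar gtr0_norm.
have hc t : ccont h ((r%:C)%C * cis t).
  have [|d' Hd'] := hd ((r%:C)%C * cis t); first by rewrite polar1.
  exact: cdiff_ccont Hd'.
have : 0 <= iseg (fun t => k * nc (h ((r%:C)%C * cis t)) + - (nc (h w) / 2)) 0 (pi *+ 2).
  rewrite -[X in X <= _]E; apply: iseg_le.
  - by move=> t _; apply: (polar_comp_continuous _).1; apply: cF; rewrite polar1.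
  - move=> t _; apply: cvgD; last exact: cvg_cst.
    by apply: cvgM; [exact: cvg_cst|exact: (polar_comp_continuous (hc t)).2].
  move=> t _; set x := _ * cis t.
  have nx : nc x = r by exact: polar1.
  have xw : x != w by apply: contraTN wr => /eqP <-; rewrite nx ltxx.
  have wx : nc w < nc x by rewrite nx.
  rewrite /F /divided_difference (negbTE xw).
  have -> : c * (x * ((h x - h w) / (x - w))) = (c * h x) * (x / (x - w)) - (c * h w) * (x / (x - w)).
    by ring.
  rewrite cw ReD ReN; apply: lerD.
    rewrite (le_trans (ler_norm _))// (le_trans (Re_le_nc _))//.
    rewrite 2!ncM c1 mul1r mulrC ler_wpM2r ?nc_ge0// ncM ncV nx /k ler_pM2l//.
    rewrite lef_pV2 ?posrE ?subr_gt0//; first by rewrite -nx nc_dist_ge.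
    by rewrite nc_gt0 subr_eq0.
  rewrite lerN2 ReM /= mul0r subr0 ler_wpM2l ?nc_ge0//.
  exact: Re_div_ge_half.
rewrite iseg_lin.
- rewrite iseg_cst ?(ltW twopi_gt0)// subr0 mulNr subr_ge0 /k => H.
  apply: le_trans H; rewrite le_eqVlt; apply/orP; left; apply/eqP.
  by rewrite mulr2n; field.
- by move=> t _; exact: (polar_comp_continuous (hc t)).2.
- by move=> t _; exact: cst_continuous.
Qed.

End LocalEstimates.

(** * Radial integration in the plane *)

Section Leb1.
Local Open Scope ereal_scope.
Context {R : realType}.
Local Notation mu := (@lebesgue_measure R).

Lemma lebesgue_shift (a : R) (A : set R) : measurable A ->
  mu ((fun x => (x + a)%R) @^-1` A) = mu A.
Proof.
move=> mA; have mf : measurable_fun [set: measurableTypeR R]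
    ((fun x => (x + a)%R) : measurableTypeR R -> measurableTypeR R).
  exact: measurable_funD.
rewrite [RHS](@lebesgue_measure_unique R
  (measure_function_pushforward__canonical__measure_function_Measure mu mf))//.
move=> _ [[b c] _ <-]; rewrite /= /pushforward/=.
rewrite (_ : _ @^-1` _ = `](b - a)%R, (c - a)%R]%classic); last first.
  by apply/seteqP; split => x; rewrite /= !in_itv /= ltrBlDr lerBrDr.
by rewrite !lebesgue_measure_itv /= !lte_fin ltrD2r -!EFinB opprB addrA subrK.
Qed.

Lemma lebesgue_scale (a : R) (A : set R) : (0 < a)%R -> measurable A ->
  mu ((fun x => (a * x)%R) @^-1` A) = (a^-1)%:E * mu A.
Proof.
move=> a0 mA; have mf : measurable_fun [set: measurableTypeR R]
    ((fun x => (a * x)%R) : measurableTypeR R -> measurableTypeR R).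
  exact: measurable_funM.
have a0' : (0 <= a)%R by exact: ltW.
pose k : {nonneg R} := NngNum a0'.
pose m1 := mscale k (measure_function_pushforward__canonical__measure_function_Measure mu mf).
have := @lebesgue_measure_unique R m1.
rewrite /m1 /mscale /pushforward /= => H.
rewrite [in RHS]H// => [|_ [[b c] _ <-]].
  by rewrite muleA -EFinM mulVf ?mul1e// gt_eqF.
rewrite /mscale /= /pushforward (_ : _ @^-1` _ = `](a^-1 * b)%R, (a^-1 * c)%R]%classic); last first.
  apply/seteqP; split => x; rewrite /= !in_itv /= => /andP[h1 h2]; apply/andP; split.
  - by rewrite mulrC ltr_pdivrMr// mulrC.
  - by rewrite mulrC ler_pdivlMr// mulrC.
  - by move: h1; rewrite mulrC ltr_pdivrMr// mulrC.
  - by move: h2; rewrite mulrC ler_pdivlMr// mulrC.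
rewrite !lebesgue_measure_itv /= !lte_fin ltr_pM2l ?invr_gt0//.
case: ifP => _; last by rewrite mule0.
by rewrite -!EFinB -EFinM mulrBr !mulrA divff ?gt_eqF// !mul1r.
Qed.

End Leb1.

(** * Planar Lebesgue measure under shears, dilations and rotations *)

Notation leb2 := (@lebesgue_measure _ \x @lebesgue_measure _)%E.

Section Leb2.
Local Open Scope ereal_scope.
Context {R : realType}.
Local Notation mu := (@lebesgue_measure R).
Local Notation T := (measurableTypeR R).
Implicit Types (A : set (T * T)).

Lemma leb2E A : measurable A -> (mu \x mu) A = \int[mu]_x mu (xsection A x).
Proof. by []. Qed.

Lemma leb2E_ysection A : measurable A -> (mu \x mu) A = \int[mu]_y mu (ysection A y).
Proof.
move=> mA; have := @product_measure_unique _ _ T T R mu mu (mu \x^ mu)%E.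
by move=> -> // B C mB mC; exact: product_measure2E.
Qed.

Lemma measurable_xshear (a : R) :
  measurable_fun [set: T * T] (fun x => (x.1 + a * x.2, x.2)%R : T * T).
Proof.
apply: measurable_fun_pair => //.
by apply: measurable_funD => //; apply: measurable_funM.
Qed.

Lemma measurable_yshear (a : R) :
  measurable_fun [set: T * T] (fun x => (x.1, x.2 + a * x.1)%R : T * T).
Proof.
apply: measurable_fun_pair => //.
by apply: measurable_funD => //; apply: measurable_funM.
Qed.

Lemma leb2_yshear (a : R) A : measurable A ->
  (mu \x mu) ((fun x => (x.1, x.2 + a * x.1)%R) @^-1` A) = (mu \x mu) A.
Proof.
move=> mA; rewrite !leb2E//; last first.
  by rewrite -[X in measurable X]setTI; exact: measurable_yshear.
apply: eq_integral => x _.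
rewrite -(@lebesgue_shift R (a * x) (xsection A x)); last exact: measurable_xsection.
by congr mu; apply/seteqP; split => y; rewrite /xsection /= !inE.
Qed.

Lemma leb2_xshear (a : R) A : measurable A ->
  (mu \x mu) ((fun x => (x.1 + a * x.2, x.2)%R) @^-1` A) = (mu \x mu) A.
Proof.
move=> mA; rewrite !leb2E_ysection//; last first.
  by rewrite -[X in measurable X]setTI; exact: measurable_xshear.
apply: eq_integral => x _.
rewrite -(@lebesgue_shift R (a * x) (ysection A x)); last exact: measurable_ysection.
by congr mu; apply/seteqP; split => y; rewrite /ysection /= !inE.
Qed.

Lemma leb2_scale (a : R) A : (0 < a)%R -> measurable A ->
  (mu \x mu) ((fun x => (a * x.1, a * x.2)%R) @^-1` A) = ((a ^+ 2)^-1)%:E * (mu \x mu) A.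
Proof.
move=> a0 mA.
have m1 : measurable_fun [set: T * T] (fun x => (x.1, a * x.2)%R : T * T).
  by apply: measurable_fun_pair => //; apply: measurable_funM.
have m2 : measurable_fun [set: T * T] (fun x => (a * x.1, x.2)%R : T * T).
  by apply: measurable_fun_pair => //; apply: measurable_funM.
pose B : set (T * T) := (fun x => (x.1, a * x.2)%R) @^-1` A.
have mB : measurable B by rewrite -[X in measurable X]setTI; exact: m1.
have -> : (fun x => (a * x.1, a * x.2)%R) @^-1` A = (fun x => (a * x.1, x.2)%R) @^-1` B by [].
have ai : (0 <= a^-1)%R by rewrite invr_ge0 ltW.
transitivity ((a^-1)%:E * (mu \x mu) B).
  rewrite !leb2E_ysection//; last first.
    by rewrite -[X in measurable X]setTI; exact: m2.
  rewrite -ge0_integralZl_EFin//; last exact: measurable_fun_ysection.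
  apply: eq_integral => y _.
  by rewrite -(@lebesgue_scale R a (ysection B y))//; exact: measurable_ysection.
rewrite expr2 invfM EFinM -muleA; congr (_ * _).
rewrite !leb2E// -ge0_integralZl_EFin//; last exact: measurable_fun_xsection.
apply: eq_integral => x _.
by rewrite -(@lebesgue_scale R a (xsection A x))//; exact: measurable_xsection.
Qed.

Definition rotate (c s : R) (x : T * T) : T * T :=
  (c * x.1 - s * x.2, s * x.1 + c * x.2)%R.

Lemma measurable_rotate (c s : R) : measurable_fun setT (rotate c s).
Proof.
apply: measurable_fun_pair; first by apply: measurable_funB; apply: measurable_funM.
by apply: measurable_funD; apply: measurable_funM.
Qed.

(** A rotation with [s <> 0] is a product of three shears, the outer two with parameter
    [k = (c - 1) / s], minus the tangent of the half angle. Shears preserve the measure because they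
    translate each section. *)
Let leb2_rotate_neq0 (c s : R) A : (c ^+ 2 + s ^+ 2 = 1)%R -> s != 0%R -> measurable A ->
  (mu \x mu) (rotate c s @^-1` A) = (mu \x mu) A.
Proof.
move=> cs s0 mA; pose k := ((c - 1) / s)%R.
have E : rotate c s = (fun x => (x.1 + k * x.2, x.2)%R) \o (fun x => (x.1, x.2 + s * x.1)%R)
   \o (fun x => (x.1 + k * x.2, x.2)%R).
  apply/funext => -[x y]; rewrite /rotate /=.
  have ks : (k * s = c - 1)%R by rewrite /k mulfVK.
  have kc : (k * (1 + c) = - s)%R.
    apply: (mulfI s0); rewrite mulrA [(s * k)%R]mulrC ks.
    have -> : ((c - 1) * (1 + c) = c ^+ 2 + s ^+ 2 - 1 - s * s)%R by ring.
    by rewrite cs; ring.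
  congr pair.
    have -> : (x + k * y + k * (y + s * (x + k * y)) = x + k * s * x + (k * (1 + (k * s + 1))) * y)%R.
      by ring.
    by rewrite ks subrK kc; ring.
  have -> : (y + s * (x + k * y) = s * x + (1 + k * s) * y)%R by ring.
  by rewrite ks; ring.
have m1 : measurable ((fun x : T * T => (x.1 + k * x.2, x.2)%R : T * T) @^-1` A).
  by rewrite -[X in measurable X]setTI; exact: measurable_xshear.
have m2 := measurable_yshear s measurableT m1; rewrite setTI in m2.
rewrite E; rewrite -[RHS](leb2_xshear k mA) -[RHS](leb2_yshear s m1).
exact: (leb2_xshear k m2).
Qed.

Lemma leb2_rotate (c s : R) A : (c ^+ 2 + s ^+ 2 = 1)%R -> measurable A ->
  (mu \x mu) (rotate c s @^-1` A) = (mu \x mu) A.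
Proof.
move=> cs mA; have [s0|] := eqVneq s 0%R; last by move=> ?; exact: leb2_rotate_neq0.
have [c1|c1] : c = 1%R \/ c = (-1)%R.
  by move: cs; rewrite s0 expr0n addr0 => /eqP; rewrite sqrf_eq1 => /orP[]/eqP; auto.
  have -> : rotate c s = id.
    by apply/funext => -[x y]; rewrite /rotate /= c1 s0; congr pair; ring.
  by [].
(* The half turn, for which [k] makes no sense, is the square of the quarter turn. *)
have o : (0 ^+ 2 + 1 ^+ 2 = 1 :> R)%R by rewrite expr0n expr1n add0r.
have -> : rotate c s = rotate 0 1 \o rotate 0 1.
  by apply/funext => -[x y]; rewrite /rotate /= c1 s0; congr pair; ring.
have m1 := measurable_rotate 0 1 measurableT mA; rewrite setTI in m1.
by rewrite -(leb2_rotate_neq0 o (oner_neq0 _) mA) -(leb2_rotate_neq0 o (oner_neq0 _) m1).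
Qed.

Lemma integral_rotate (c s : R) (f : T * T -> \bar R) : (c ^+ 2 + s ^+ 2 = 1)%R ->
  measurable_fun setT f -> (forall x, 0 <= f x) ->
  \int[mu \x mu]_x f (rotate c s x) = \int[mu \x mu]_x f x.
Proof.
move=> cs mf f0.
have := @ge0_integral_pushforward _ _ _ _ R _ (measurable_rotate c s) (mu \x mu) setT f
   measurableT mf (fun x _ => f0 x).
rewrite preimage_setT => <-.
apply: (eq_measure_integral (mu \x mu)%E
  (m1 := measure_function_pushforward__canonical__measure_function_Measure
    (mu \x mu)%E (measurable_rotate c s))) => A mA _.
exact: leb2_rotate.
Qed.

End Leb2.

(** * The image of planar measure under the modulus *)

Section RadialMeasure.
Local Open Scope ereal_scope.
Context {R : realType}.
Local Notation mu := (@lebesgue_measure R).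
Local Notation T := (measurableTypeR R).

(** The combination of [max] and [min] covers empty intervals and negative endpoints by one formula,
    as the uniqueness theorem for measures has to be fed all half-open intervals. *)
Lemma measure_ocitv_quadratic (m : {measure set T -> \bar R}) (k : R) :
  m `]-oo, 0%R]%classic = 0 ->
  (forall b : R, (0 < b)%R -> m `]0%R, b]%classic = (b ^+ 2 * k)%:E) ->
  forall a b : R, m `]a, b]%classic =
    (((Num.max b 0) ^+ 2 - (Num.min (Num.max a 0) (Num.max b 0)) ^+ 2) * k)%:E.
Proof.
move=> m0 mb a b.
have mb' c : (0 <= c)%R -> m `]0%R, c]%classic = (c ^+ 2 * k)%:E.
  rewrite le_eqVlt => /predU1P[<-|]; last exact: mb.
  by rewrite set_itv_ge ?bnd_simp ?ltxx// measure0 expr0n mul0r.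
have neg c d : (d <= 0)%R -> m `]c, d]%classic = 0.
  move=> d0; apply/eqP; rewrite -measure_le0 -m0 le_measure ?inE//.
  by apply: subset_itv; rewrite ?bnd_simp.
have [b0|b0] := leP b 0%R.
  by rewrite neg// (min_idPr _) ?le_max ?lexx ?orbT// subrr mul0r.
have [a0|a0] := leP a 0%R.
  rewrite (min_idPl (ltW b0)) expr0n subr0 -mb//.
  rewrite (@itv_bndbnd_setU _ _ _ (BRight 0%R)) ?bnd_simp ?(ltW b0)//.
  rewrite measureU//; last first.
    apply/seteqP; split => // x [/=]; rewrite !in_itv /= => /andP[_ x0] /andP[].
    by rewrite ltNge x0.
  rewrite -[RHS]add0e; congr (_ + _); exact: neg.
have [ba|ab] := leP b a.
  by rewrite set_itv_ge ?bnd_simp -?leNgt// measure0 subrr mul0r.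
have := mb' _ (ltW b0).
rewrite (@itv_bndbnd_setU _ _ _ (BRight a)) ?bnd_simp ?(ltW a0) ?(ltW ab)//.
rewrite measureU//; last first.
  apply/seteqP; split => // x [/=]; rewrite !in_itv /= => /andP[_ x0] /andP[].
  by rewrite ltNge x0.
move=> E0; have {E0} E : m `]0%R, a]%classic + m `]a, b]%classic = (b ^+ 2 * k)%:E by exact: E0.
rewrite mb' ?ltW// in E.
have : m `]a, b]%classic \is a fin_num.
  rewrite ge0_fin_numE//; apply: (@le_lt_trans _ _ (b ^+ 2 * k)%:E); last by rewrite ltry.
  by rewrite -(mb' _ (ltW b0)) le_measure ?inE//; apply: subset_itv; rewrite ?bnd_simp ?ltW.
move: E; case: (m _) => // r; rewrite -EFinD => -[E] _; congr EFin.
by rewrite mulrBl -E addrAC subrr add0r.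
Qed.

Lemma measure_quadratic_unique (m1 m2 : {measure set T -> \bar R}) (k1 k2 : R) :
  m1 `]-oo, 0%R]%classic = 0 -> m2 `]-oo, 0%R]%classic = 0 -> (0 <= k1)%R -> (0 < k2)%R ->
  (forall b : R, (0 < b)%R -> m1 `]0%R, b]%classic = (b ^+ 2 * k1)%:E) ->
  (forall b : R, (0 < b)%R -> m2 `]0%R, b]%classic = (b ^+ 2 * k2)%:E) ->
  forall A, measurable A -> m1 A = (k1 / k2)%:E * m2 A.
Proof.
move=> z1 z2 k10 k20 h1 h2 A mA.
have k0 : (0 <= k1 / k2)%R by rewrite divr_ge0// ltW.
pose k : {nonneg R} := NngNum k0.
have H1 := measure_ocitv_quadratic z1 h1.
have H2 := measure_ocitv_quadratic z2 h2.
change (m1 A = mscale k m2 A).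
apply: (@measure_unique _ R T (@ocitv R) (fun n => `](- n%:R)%R, n%:R]%classic)) => //.
- exact: ocitvI.
- by move=> n; exact: is_ocitv.
- apply/seteqP; split => // x _; exists (Num.bound `|x|%R) => //=.
  rewrite in_itv /=.
  have xb := archi_boundP (normr_ge0 x).
  by move: xb; rewrite ltr_norml => /andP[-> /ltW].
- move=> _ [[a b] _ <-] /=; rewrite /mscale H1 H2 -EFinM; congr EFin => /=.
  by rewrite mulrCA mulfVK ?gt_eqF.
- by move=> n /=; rewrite H1 ltry.
Qed.

Definition nrm2 (x : T * T) : R := nc (x.1 +i* x.2)%C.

Lemma nrm2_scale (b : R) (x : T * T) :
  nrm2 ((b * x.1)%R, (b * x.2)%R) = (`|b| * nrm2 x)%R.
Proof.
rewrite /nrm2 -nc_real -ncM; apply: f_equal.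
by apply/eqP; rewrite eq_complex /= !mul0r subr0 addr0 !eqxx.
Qed.

Lemma measurable_nrm2 : measurable_fun [set: T * T] (nrm2 : T * T -> T).
Proof.
rewrite (_ : nrm2 = (@Num.sqrt R) \o (fun x : T * T => x.1 ^+ 2 + x.2 ^+ 2)%R)//.
apply: measurableT_comp.
  by apply: continuous_measurable_fun; exact: sqrt_continuous.
by apply: measurable_funD; apply: measurable_funX.
Qed.

(** Its vertical section at [t > 0] has length [t], so the first coordinate carries the area of the
    wedge to [t dt]: a linear model of the radial measure. *)
Definition wedge : set (T * T) := [set x | (0 < x.2)%R /\ (x.2 < x.1)%R].

Lemma measurable_wedge : measurable wedge.
Proof.
have -> : wedge = ([set x | 0 < x.2]%R `&` [set x | x.2 < x.1]%R) by [].
apply: measurableI; rewrite -[X in measurable X]setTI.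
  by apply: (measurable_fun_ltr (f := fun=> 0%R) (g := snd)) => //.
by apply: (measurable_fun_ltr (f := snd) (g := fst)).
Qed.

Let m1 := measure_function_pushforward__canonical__measure_function_Measure
  (mu \x mu)%E measurable_nrm2.
Let m2 := measure_function_pushforward__canonical__measure_function_Measure
  (mrestr (mu \x mu)%E measurable_wedge) (@measurable_fst _ _ T T).

Let leb2_square_finite (A : set (T * T)) : measurable A ->
  (forall x, A x -> (`|x.1| <= 1)%R /\ (`|x.2| <= 1)%R) -> (mu \x mu) A \is a fin_num.
Proof.
move=> mA H; rewrite ge0_fin_numE//.
apply: (@le_lt_trans _ _ ((mu \x mu) (`[(-1)%R, 1%R]%classic `*` `[(-1)%R, 1%R]%classic))).
  rewrite le_measure ?inE//; first exact: measurableX.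
  by move=> x /H[]; rewrite !ler_norml /= !in_itv /= => -> ->.
by rewrite product_measure1E//= !lebesgue_measure_itv /= !lte_fin ifT ?ltry//; lra.
Qed.

Let m1_0 : m1 `]-oo, 0%R]%classic = 0.
Proof.
rewrite /m1 /= /pushforward.
have -> : nrm2 @^-1` `]-oo, 0%R]%classic = [set 0%R] `*` [set 0%R].
  apply/seteqP; split => [[x y]|[x y]] /=.
    rewrite in_itv /= => n0.
    have : nrm2 (x, y) == 0%R by rewrite eq_le n0 nc_ge0.
    by rewrite /nrm2 nc_eq0 eq_complex => /andP[/eqP/= -> /eqP/= ->].
  by case=> /= -> ->; rewrite in_itv /= (_ : nrm2 _ = 0%R)//; exact: nc0.
rewrite product_measure1E// [X in X * _](_ : _ = 0) ?mul0e//; exact: lebesgue_measure_set1.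
Qed.

Let m2_0 : m2 `]-oo, 0%R]%classic = 0.
Proof.
rewrite /m2 /= /pushforward /mrestr.
rewrite (_ : _ `&` _ = set0) ?measure0//.
apply/seteqP; split => // -[x y] [/=]; rewrite in_itv /= => x0 [/= y0 yx].
by have := lt_le_trans (lt_trans y0 yx) x0; rewrite ltxx.
Qed.

Let scaling (A : set (T * T)) (b : R) : (0 < b)%R -> measurable A ->
  (mu \x mu) A = (b ^+ 2)%:E * (mu \x mu) ((fun x => (b * x.1, b * x.2)%R) @^-1` A).
Proof.
move=> b0 mA; rewrite leb2_scale// muleA -EFinM divff ?mul1e// expf_neq0// gt_eqF//.
Qed.

Let k1 := fine ((mu \x mu) (nrm2 @^-1` `]0%R, 1%R]%classic)).
Let k2 := fine ((mu \x mu) ((fst : T * T -> T) @^-1` `]0%R, 1%R]%classic `&` wedge)).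

Let mB1 (b : R) : measurable (nrm2 @^-1` `]0%R, b]%classic).
Proof. by rewrite -[X in measurable X]setTI; apply: measurable_nrm2. Qed.

Let mB2 (b : R) : measurable ((fst : T * T -> T) @^-1` `]0%R, b]%classic `&` wedge).
Proof.
apply: measurableI; last exact: measurable_wedge.
by rewrite -[X in measurable X]setTI; exact: measurable_fst.
Qed.

Let k1E : (mu \x mu) (nrm2 @^-1` `]0%R, 1%R]%classic) = k1%:E.
Proof.
rewrite fineK//; apply: (leb2_square_finite (mB1 1)) => -[x y] /=.
rewrite in_itv /= => /andP[_ h]; split.
  exact: le_trans (Re_le_nc (x +i* y)%C) h.
exact: le_trans (Im_le_nc (x +i* y)%C) h.
Qed.

Let k2E : (mu \x mu) ((fst : T * T -> T) @^-1` `]0%R, 1%R]%classic `&` wedge) = k2%:E.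
Proof.
rewrite fineK//; apply: (leb2_square_finite (mB2 1)) => -[x y] [/=].
rewrite in_itv /= => /andP[x0 x1] [/= y0 yx]; split.
  by rewrite gtr0_norm.
by rewrite gtr0_norm// (le_trans (ltW yx)).
Qed.

Let k2_gt0 : (0 < k2)%R.
Proof.
rewrite -lte_fin -k2E.
apply: (@lt_le_trans _ _ ((mu \x mu) (`]2^-1%R, 1%R]%classic `*` `]0%R, 2^-1%R]%classic))).
  rewrite product_measure1E//= !lebesgue_measure_itv /= !lte_fin !ifT.
  - by rewrite -!EFinB -EFinM lte_fin; lra.
  - by lra.
  - by lra.
apply: le_measure; rewrite ?inE; [exact: measurableX|exact: mB2|].
move=> [x y] [/=]; rewrite !in_itv /= => /andP[? ?] /andP[? ?].
have x01 : (0 < x <= 1)%R by apply/andP; split; lra.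
by split; [rewrite /= ?in_itv /=|split => /=; lra].
Qed.

Let k1_gt0 : (0 < k1)%R.
Proof.
rewrite -lte_fin -k1E.
apply: (@lt_le_trans _ _ ((mu \x mu) (`]0%R, 2^-1%R]%classic `*` `]0%R, 2^-1%R]%classic))).
  rewrite product_measure1E//= !lebesgue_measure_itv /= !lte_fin !ifT.
  - by rewrite -!EFinB -EFinM lte_fin; lra.
  - by lra.
apply: le_measure; rewrite ?inE; [exact: measurableX|exact: mB1|].
move=> [x y] [/=]; rewrite !in_itv /= => /andP[? ?] /andP[? ?].
rewrite /nrm2 nc_gt0 eq_complex /= negb_and gt_eqF//=.
by rewrite (le_trans (nc_le_ReIm _ _))// !gtr0_norm//; lra.
Qed.

(** Both sides are measures in [A] that scale by [b^2] under dilations, so they are determined on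
    []0, b]] by their values on []0, 1]] and hence are proportional. What matters about the constant
    later is that it is positive. *)
Lemma radial_pushforward : exists2 k : R, (0 < k)%R & forall A : set T, measurable A ->
  (mu \x mu) (nrm2 @^-1` A) = k%:E * (mu \x mu) ((fst : T * T -> T) @^-1` A `&` wedge).
Proof.
exists (k1 / k2)%R; first by rewrite divr_gt0.
move=> A mA.
have H1 (b : R) : (0 < b)%R -> (mu \x mu) (nrm2 @^-1` `]0%R, b]%classic) = (b ^+ 2 * k1)%:E.
  move=> b0; have E := scaling b0 (mB1 b).
  apply: (etrans E); rewrite [RHS]EFinM; congr (_ * _); apply: etrans k1E.
  apply: f_equal; apply/seteqP; split => x; rewrite /= !in_itv /= nrm2_scale gtr0_norm//;
    rewrite pmulr_rgt0// => /andP[-> h];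
    by move: h; rewrite -ler_pdivlMl// mulVf// gt_eqF.
have H2 (b : R) : (0 < b)%R -> (mu \x mu) ((fst : T * T -> T) @^-1` `]0%R, b]%classic `&` wedge) = (b ^+ 2 * k2)%:E.
  move=> b0; have E := scaling b0 (mB2 b).
  apply: (etrans E); rewrite [RHS]EFinM; congr (_ * _); apply: etrans k2E.
  by apply: f_equal; apply/seteqP; split => -[x y]; rewrite /wedge /= !in_itv /= !pmulr_rgt0// ltr_pM2l//
    -ler_pdivlMl// mulVf// gt_eqF.
exact: (measure_quadratic_unique m1_0 m2_0 (ltW k1_gt0) k2_gt0 H1 H2).
Qed.

End RadialMeasure.

Section RadialIntegral.
Local Open Scope ereal_scope.
Context {R : realType}.
Local Notation mu := (@lebesgue_measure R).
Local Notation T := (measurableTypeR R).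

Lemma integral_mrestr d (S : measurableType d) (m : {measure set S -> \bar R}) (D : set S)
    (mD : measurable D) (f : S -> \bar R) :
  measurable_fun setT f -> (forall x, 0 <= f x) ->
  \int[mrestr m mD]_x f x = \int[m]_(x in D) f x.
Proof.
move=> mf f0.
have z : mrestr m mD (~` D) = 0 by rewrite /mrestr setICl measure0.
rewrite [LHS](ge0_negligible_integral (measurableC mD) measurableT mf (fun x _ => f0 x) z).
rewrite setTD setCK; apply: eq_measure_integral => A mA AD.
by rewrite /mrestr /=; congr (m _); apply/setIidPl.
Qed.

Lemma radial_integral : exists2 k : R, (0 < k)%R & forall f : T -> \bar R,
  measurable_fun setT f -> (forall x, 0 <= f x) ->
  \int[mu \x mu]_x f (nrm2 x) = k%:E * \int[mu]_t ((Num.max t 0%R)%:E * f t).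
Proof.
have [k k0 Hk] := @radial_pushforward R.
exists k => // f mf f0.
have k0' : (0 <= k)%R by exact: ltW.
pose kn : {nonneg R} := NngNum k0'.
pose m2 := measure_function_pushforward__canonical__measure_function_Measure
  (mrestr (mu \x mu)%E (@measurable_wedge R)) (@measurable_fst _ _ T T).
have E1 : \int[mu \x mu]_x f (nrm2 x) = \int[mscale kn m2]_t f t.
  have := @ge0_integral_pushforward _ _ _ _ R _ (@measurable_nrm2 R) (mu \x mu) setT f
    measurableT mf (fun x _ => f0 x).
  rewrite preimage_setT => <-.
  apply: (eq_measure_integral (mscale kn m2)
    (m1 := measure_function_pushforward__canonical__measure_function_Measure
    (mu \x mu)%E (@measurable_nrm2 R))) => A mA _.
  exact: Hk.
rewrite E1 ge0_integral_mscale//; congr (_ * _).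
have -> : \int[m2]_t f t = \int[mrestr (mu \x mu)%E (@measurable_wedge R)]_x f x.1.
  by rewrite /m2 ge0_integral_pushforward// preimage_setT.
have mf1 : measurable_fun [set: T * T] (fun x : T * T => f x.1) by exact: measurableT_comp.
rewrite integral_mrestr// integral_mkcond fubini_tonelli1//=; last 2 first.
- by apply/(measurable_restrictT _ (@measurable_wedge R)); exact: measurable_funTS.
- by move=> x; rewrite /patch; case: ifP.
apply: eq_integral => x _; rewrite /fubini_F.
transitivity (\int[mu]_(y in `]0%R, x[%classic) f x).
  rewrite [RHS]integral_mkcond; apply: eq_integral => y _; rewrite /patch /=.
  rewrite (_ : ((x, y) \in @wedge R) = (y \in `]0%R, x[%classic))//.
  by apply/idP/idP; rewrite !inE /wedge /= in_itv /=; [move=> [-> ->]|move/andP].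
rewrite integral_cst//= muleC; congr (_ * _).
rewrite lebesgue_measure_itv /= lte_fin; case: ltP => x0 //.
by rewrite sube0.
Qed.

End RadialIntegral.

(** * Weighted masses of annuli *)

Section Layers.
Context {R : realType}.
Local Notation mu := (@lebesgue_measure R).
Local Notation T := (measurableTypeR R).

(* The weight extended by zero, so that it is measurable on the whole line. *)
Definition weight0 (omega : R -> R) (t : R) : R := if 0 <= t < 1 then omega t else 0.

Lemma weight0_ge0 omega t : radial_weight omega -> 0 <= weight0 omega t.
Proof.
case=> _ o0 _ _; rewrite /weight0; case: ifP => // /andP[t0 t1].
by rewrite o0// t0 ltW.
Qed.

Lemma measurable_weight0 omega : radial_weight omega ->
  measurable_fun [set: T] (weight0 omega : T -> T).
Proof.
case=> mo _ _ _.
rewrite (_ : weight0 omega = omega \_ `[0, 1[%classic).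
  apply/(measurable_restrictT _ _).1 => //.
  apply: measurable_funS mo => //; apply: subset_itvl.
  by rewrite bnd_simp.
apply/funext => t; rewrite /weight0 /patch.
rewrite (_ : (t \in `[0, 1[%classic) = (0 <= t < 1))//.
by apply/idP/idP; rewrite inE /= in_itv.
Qed.

Definition annulus (a b : R) : set (T * T) := [set x | a <= nrm2 x < b].

Lemma measurable_annulus a b : measurable (annulus a b).
Proof.
have := @measurable_nrm2 R measurableT `[a, b[%classic (measurable_itv _).
by rewrite setTI; congr measurable; apply/seteqP; split => x; rewrite /annulus /= in_itv.
Qed.

Definition annulus_mass (omega : R -> R) (a b : R) : \bar R :=
  (\int[mu \x mu]_(x in annulus a b) (weight0 omega (nrm2 x))%:E)%E.

(** Radial integration gives the density [t omega(t)], and [a <= t <= 1] on the annulus. The lower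
    bound degenerates at [a = 0]; for this reason positivity of the layer masses is later claimed
    for positive indices. *)
Lemma annulus_mass_bounds omega : radial_weight omega ->
  exists2 k : R, 0 < k & forall a b, 0 <= a -> a <= b -> b < 1 ->
  let d := fine (omega_hat omega a) - fine (omega_hat omega b) in
  [/\ annulus_mass omega a b \is a fin_num,
    fine (annulus_mass omega a b) <= k * d & k * a * d <= fine (annulus_mass omega a b)].
Proof.
move=> ow; have [mo o0 io oh] := ow.
have [k k0 Hk] := @radial_integral R.
exists k => // a b a0 ab b1 d.
have fin r : 0 <= r -> omega_hat omega r \is a fin_num.
  move=> r0; apply: integrable_fin_num => //.
  by apply: integrableS io => //; apply: subset_itvr; rewrite bnd_simp.
have mw : measurable_fun [set: T] (fun t : T => (weight0 omega t)%:E).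
  by apply/measurable_EFinP; exact: measurable_weight0.
have w0 t : (0 <= (weight0 omega t)%:E)%E by rewrite lee_fin weight0_ge0.
have mab : measurable (`[a, b[%classic : set T) by exact: measurable_itv.
have sub01 x : (`[a, b[%classic `|` `[b, 1]%classic) x -> 0 <= x <= 1.
  rewrite /= !in_itv /= => -[/andP[ax xb]|/andP[bx ->]].
    by rewrite (le_trans a0 ax) ltW// (lt_trans xb).
  by rewrite (le_trans a0)// (le_trans ab).
have dE : (\int[mu]_(t in `[a, b[) (weight0 omega t)%:E = d%:E)%E.
  rewrite EFinB !fineK ?fin//; last exact: le_trans ab.
  rewrite /omega_hat (_ : `[a, 1]%classic = `[a, b[%classic `|` `[b, 1]%classic :> set T); last first.
    by rewrite -itv_bndbnd_setU// bnd_simp// ltW.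
  rewrite ge0_integral_setU//=; last 3 first.
  - by apply/measurable_EFinP; apply: measurable_funS mo => // x /sub01; rewrite /= in_itv.
  - by move=> x /sub01/o0; rewrite lee_fin.
  - apply/disj_setPS => x [/=]; rewrite !in_itv /= => /andP[_ xb] /andP[bx _].
    by move: xb; rewrite ltNge bx.
  rewrite addeK; last by apply: fin; exact: le_trans ab.
  apply: eq_integral => x; rewrite inE /= in_itv /= => /andP[ax xb].
  by rewrite /weight0 (le_trans a0 ax) (lt_trans xb b1).
pose f (t : T) : \bar R := ((fun t => (weight0 omega t)%:E) \_ (`[a, b[%classic : set T)) t.
have mf : measurable_fun setT f.
  exact: ((measurable_restrictT _ mab).1 (measurable_funTS mw)).
have f0 t : (0 <= f t)%E by rewrite /f /patch; case: ifP.
have E : annulus_mass omega a b =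
    (k%:E * \int[mu]_(t in `[a, b[) ((Num.max t 0)%:E * (weight0 omega t)%:E))%E.
  rewrite /annulus_mass integral_mkcond [in RHS]integral_mkcond.
  transitivity (\int[mu \x mu]_x f (nrm2 x))%E.
    apply: eq_integral => x _; rewrite /f /patch.
    rewrite (_ : (x \in annulus a b) = (nrm2 x \in `[a, b[%classic))//.
  rewrite Hk//; congr (_ * _)%E; apply: eq_integral => t _.
  by rewrite /f /patch; case: ifP => //; rewrite mule0.
have mmax : measurable_fun (`[a, b[%classic : set T) (fun t : T => (Num.max t 0)%:E).
  apply/measurable_EFinP; apply: measurable_funTS.
  by apply: measurable_maxr.
have up : (\int[mu]_(t in `[a, b[) ((Num.max t 0)%:E * (weight0 omega t)%:E) <= d%:E)%E.
  rewrite -dE; apply: ge0_le_integral => //.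
  - by move=> t _; apply: mule_ge0 => //; rewrite lee_fin le_max lexx orbT.
  - by apply: emeasurable_funM => //; exact: measurable_funTS.
  - exact: measurable_funTS.
  - move=> t /=; rewrite in_itv /= => /andP[_ tb].
    rewrite -[leRHS]mul1e lee_wpmul2r// lee_fin ge_max ler01 andbT.
    by rewrite (le_trans (ltW tb))// ltW.
have lo : ((a * d)%:E <= \int[mu]_(t in `[a, b[) ((Num.max t 0)%:E * (weight0 omega t)%:E))%E.
  rewrite EFinM -dE -ge0_integralZl_EFin//; last exact: measurable_funTS.
  apply: ge0_le_integral => //.
  - by move=> t _; apply: mule_ge0 => //; rewrite lee_fin.
  - by apply: emeasurable_funM => //; exact: measurable_funTS.
  - by apply: emeasurable_funM => //; exact: measurable_funTS.
  - move=> t /=; rewrite in_itv /= => /andP[at' _].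
    by rewrite lee_wpmul2r// lee_fin le_max at'.
move: up lo; set I := (\int[mu]_(t in _) _)%E => up lo.
have I_fin : I \is a fin_num.
  rewrite fin_numElt (le_lt_trans _ (ltry d)) ?andbT//.
  by rewrite (lt_le_trans _ lo)// ltNyr.
move: E up lo; rewrite -/I -(fineK I_fin) -EFinM !lee_fin => -> up lo; split => //=.
  by rewrite ler_wpM2l// ltW.
by rewrite -mulrA ler_wpM2l// ltW.
Qed.

End Layers.

(** * Masses of the layers *)

Section LayerWeights.
Context {R : realType}.
Local Notation mu := (@lebesgue_measure R).

Definition layer_radius (K : R) (m : nat) : R := 1 - K^-1 ^+ m.

Definition layer_mass (omega : R -> R) (K : R) (m : nat) : R :=
  fine (annulus_mass omega (layer_radius K m) (layer_radius K m.+1)).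

Lemma layer_radius_ge0 K m : 1 < K -> 0 <= layer_radius K m.
Proof.
move=> K1; rewrite subr_ge0 exprn_ile1// ?invr_ge0 ?ltW ?invf_lt1//.
- exact: lt_trans K1.
- exact: lt_trans K1.
Qed.

Lemma layer_radius_lt1 K m : 1 < K -> layer_radius K m < 1.
Proof.
by move=> K1; rewrite gtrBl exprn_gt0// invr_gt0 (lt_trans _ K1).
Qed.

Lemma layer_radiusS K m : layer_radius K m.+1 = 1 - (1 - layer_radius K m) / K.
Proof. by rewrite /layer_radius exprSr subKr. Qed.

Lemma layer_radius_mono K m n : 1 < K -> (m <= n)%N ->
  layer_radius K m <= layer_radius K n.
Proof.
move=> K1 mn; have K0 : 0 < K by exact: lt_trans K1.
have Ki0 : 0 <= K^-1 by rewrite invr_ge0 ltW.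
have Ki1 : K^-1 <= 1 by rewrite ltW// invf_lt1.
by rewrite lerD2l lerN2 -(subnK mn) exprD ler_piMl ?exprn_ge0 ?exprn_ile1.
Qed.

Lemma omega_hat_fin (omega : R -> R) r : radial_weight omega -> 0 <= r ->
  omega_hat omega r \is a fin_num.
Proof.
move=> [mo o0 io oh] r0; apply: integrable_fin_num => //.
by apply: integrableS io => //; apply: subset_itvr; rewrite bnd_simp.
Qed.

Lemma omega_hat_anti (omega : R -> R) r s : radial_weight omega -> 0 <= r -> r <= s ->
  fine (omega_hat omega s) <= fine (omega_hat omega r).
Proof.
move=> ow r0 rs; have [mo o0 io oh] := ow.
apply: fine_le; [exact: omega_hat_fin (le_trans r0 rs)|exact: omega_hat_fin|].
apply: ge0_subset_integral => //.
- apply/measurable_EFinP; apply: measurable_funS mo => //; apply: subset_itvr.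
  by rewrite bnd_simp.
- move=> x /=; rewrite in_itv /= => /andP[rx x1].
  by rewrite lee_fin o0// x1 (le_trans r0).
- by apply: subset_itvr; rewrite bnd_simp.
Qed.

(** The mass of layer [m] is comparable to a difference of tails [h (r m) - h (r m.+1)]. The lower
    condition of class D, with its own [K] as ratio of the layers, makes the tails decay by
    [kap = C2^-1]; the doubling condition, iterated [j] times with [2^j >= K], bounds their decay by
    [Lam = C1^j]. *)
Lemma layer_mass_bounds (omega : R -> R) : classD omega ->
  exists K kap Lam c : R, [/\ 1 < K, 0 < kap < 1, 1 <= Lam, 0 < c &
    [/\ forall m, annulus_mass omega (layer_radius K m) (layer_radius K m.+1) \is a fin_num,
        forall n, (0 < n)%N -> 0 < layer_mass omega K n,
        forall n m, (0 < n)%N -> (n <= m)%N ->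
          layer_mass omega K m <= c * kap ^+ (m - n) * layer_mass omega K n &
        forall n m, (0 < n)%N -> (m <= n)%N ->
          layer_mass omega K m <= c * Lam ^+ (n - m) * layer_mass omega K n]].
Proof.
move=> [[ow [C1 [C11 H1]]] [K [C2 [K1 [C21 H2]]]]].
have [k k0 Hk] := annulus_mass_bounds ow.
pose h r := fine (omega_hat omega r).
pose r := layer_radius K.
have K0 : 0 < K by exact: lt_trans K1.
have r0 m : 0 <= r m by exact: layer_radius_ge0.
have r1 m : r m < 1 by exact: layer_radius_lt1.
have rS m : r m <= r m.+1 by exact: layer_radius_mono.
have C10 : 0 < C1 by exact: lt_le_trans C11.
have C20 : 0 < C2 by exact: lt_trans C21.
have hE s : 0 <= s -> omega_hat omega s = (h s)%:E by move=> s0; rewrite fineK// omega_hat_fin.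
have h0 s : 0 <= s < 1 -> 0 < h s.
  move=> s01; have [_ _ _ oh] := ow; have := oh _ s01.
  by rewrite hE ?lte_fin//; case/andP: s01.
have hD m : h (r m.+1) <= C2^-1 * h (r m).
  rewrite ler_pdivlMl//; have := H2 (r m); rewrite r0 r1 => /(_ isT).
  by rewrite -layer_radiusS !hE// lee_fin.
pose j := Num.bound K.
pose Lam := C1 ^+ j.
have hdouble s : 0 <= s < 1 -> forall i, h s <= C1 ^+ i * h (1 - (1 - s) / 2 ^+ i).
  move=> /andP[s0 s1]; elim=> [|i IH]; first by rewrite expr0 mul1r divr1 subKr.
  apply: (le_trans IH).
  set t := 1 - (1 - s) / 2 ^+ i.
  have p2 : 0 < 2 ^+ i :> R by rewrite exprn_gt0.
  have t01 : 0 <= t < 1.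
    rewrite subr_ge0 gtrBl divr_gt0 ?subr_gt0// andbT ler_pdivrMr// mul1r.
    by rewrite (@le_trans _ _ 1)// ?gerBl// exprn_ege1// ler1n.
  have tt : 1 - (1 - s) / 2 ^+ i.+1 = (1 + t) / 2.
    by rewrite /t exprSr; field; rewrite gt_eqF.
  rewrite tt exprSr -mulrA ler_pM2l ?exprn_gt0//.
  have := H1 _ t01; case/andP: t01 => t0 t1.
  by rewrite !hE ?lee_fin// divr_ge0// addr_ge0.
have hL m : h (r m) <= Lam * h (r m.+1).
  have rm : 0 <= r m < 1 by rewrite r0 r1.
  apply: (le_trans (hdouble _ rm j)); rewrite ler_pM2l ?exprn_gt0//.
  apply: omega_hat_anti => //.
  have s0 : 0 <= 1 - layer_radius K m by rewrite subr_ge0 ltW// layer_radius_lt1.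
  rewrite /r layer_radiusS lerD2l lerN2 ler_wpM2l// lef_pV2 ?posrE ?exprn_gt0//.
  rewrite ltW// (lt_le_trans (archi_boundP (ltW K0)))// -natrX ler_nat.
  by apply: ltnW; exact: ltn_expl.
have Lam1 : 1 <= Lam by rewrite exprn_ege1.
have kap01 : 0 < C2^-1 < 1 by rewrite invr_gt0 C20 invf_lt1.
have hDn n m : (n <= m)%N -> h (r m) <= C2^-1 ^+ (m - n) * h (r n).
  move=> /subnK <-; rewrite addnK; elim: (m - n)%N => [|i IH].
    by rewrite mul1r add0n.
  rewrite addSn (le_trans (hD _))// exprS -mulrA ler_pM2l//; by case/andP: kap01.
have hLn n m : (m <= n)%N -> h (r m) <= Lam ^+ (n - m) * h (r n).
  move=> /subnK <-; rewrite addnK; elim: (n - m)%N => [|i IH].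
    by rewrite mul1r add0n.
  rewrite addSn (le_trans IH)// exprSr -mulrA ler_pM2l//.
  by rewrite exprn_gt0// (lt_le_trans _ Lam1).
have rn1 n : (0 < n)%N -> r 1%N <= r n by move=> n0; exact: layer_radius_mono.
have r10 : 0 < r 1%N by rewrite /r /layer_radius expr1 subr_gt0 invf_lt1.
(* For [n > 0] the factor [r 1] bounds the radius from below, and at least the fraction [1 - C2^-1]
   of the tail [h (r n)] lies in layer [n]. *)
pose c := (r 1%N * (1 - C2^-1))^-1.
have c0 : 0 < c by rewrite invr_gt0 mulr_gt0// subr_gt0; case/andP: kap01.
have up m : layer_mass omega K m <= k * h (r m).
  have [_ + _] := Hk _ _ (r0 m) (rS m) (r1 m.+1); move/le_trans; apply.
  by rewrite ler_pM2l// gerBl ltW// h0// r0 r1.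
have lo n : (0 < n)%N -> k * h (r n) <= c * layer_mass omega K n.
  move=> n0; have [_ _ L] := Hk _ _ (r0 n) (rS n) (r1 n.+1).
  rewrite ler_pdivlMl; last by rewrite -invr_gt0.
  apply: le_trans L; rewrite mulrCA -!mulrA ler_pM2l//.
  apply: ler_pM; rewrite ?rn1 ?(ltW r10)//.
    by rewrite mulr_ge0// ?subr_ge0 ?ltW// ?h0 ?r0 ?r1//; case/andP: kap01.
  by rewrite mulrBl mul1r lerD2l lerN2 hD.
exists K, C2^-1, Lam, c; split => //; split.
- by move=> m; have [] := Hk _ _ (r0 m) (rS m) (r1 m.+1).
- move=> n n0; rewrite -(pmulr_rgt0 _ c0) (lt_le_trans _ (lo _ n0))//.
  by rewrite mulr_gt0// h0// r0 r1.
- move=> n m n0 nm; rewrite (le_trans (up _))// -[leRHS]mulrA [leRHS]mulrCA.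
  apply: (@le_trans _ _ (C2^-1 ^+ (m - n) * (k * h (r n)))).
    by rewrite mulrCA ler_pM2l// hDn.
  by rewrite ler_pM2l ?lo// exprn_gt0//; case/andP: kap01.
- move=> n m n0 nm; rewrite (le_trans (up _))// -[leRHS]mulrA [leRHS]mulrCA.
  apply: (@le_trans _ _ (Lam ^+ (n - m) * (k * h (r n)))).
    by rewrite mulrCA ler_pM2l// hLn.
  by rewrite ler_pM2l ?lo// exprn_gt0// (lt_le_trans _ Lam1).
Qed.

End LayerWeights.

(** * Lattice points and local averages *)

Section RootsOfUnity.
Context {R : realType}.
Implicit Types (x z u : R[i]) (N j l : nat).

Lemma conjc_M x z : ((x * z)^*)%C = ((x^*)%C * (z^*)%C).
Proof. exact: (rmorphM (@conjc R)). Qed.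

Lemma conjc_X x n : ((x ^+ n)^*)%C = (x^*)%C ^+ n.
Proof. exact: (rmorphXn (@conjc R)). Qed.

Lemma conjc_sum (I : Type) (s : seq I) (F : I -> R[i]) :
  ((\sum_(i <- s) F i)^*)%C = \sum_(i <- s) ((F i)^*)%C.
Proof. exact: (rmorph_sum (@conjc R)). Qed.

Lemma geometric_unity_sum u N : u ^+ N = 1 -> u != 1 -> \sum_(j < N) u ^+ j = 0.
Proof.
move=> uN u1; have := subrX1 u N; rewrite uN subrr => /esym/eqP.
by rewrite mulf_eq0 subr_eq0 (negbTE u1) /= => /eqP.
Qed.

(** Parseval on the [N]-th roots of unity: after expanding the squares, every off-diagonal sum over
    [j] is a full geometric sum of a nontrivial root of unity and vanishes. *)
Lemma sum_norm_power_unity (z : R[i]) N (x : R[i]) : nc z = 1 -> z ^+ N = 1 ->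
  (forall l, (0 < l < N)%N -> z ^+ l != 1) ->
  \sum_(j < N) nc (\sum_(l < N) (z ^+ j * x) ^+ l) ^+ 2 = N%:R * \sum_(l < N) (nc x ^+ l) ^+ 2.
Proof.
move=> z1 zN zl.
have z0 : z != 0 by rewrite -nc_gt0 z1.
have zc : (z^*)%C = z^-1.
  by apply: (mulfI z0); rewrite divff// conj_nc z1 expr1n.
apply: (@complexI R); rewrite rmorph_sum rmorphM rmorph_sum rmorph_nat /=.
transitivity (\sum_(j < N) \sum_(l < N) \sum_(m < N)
   (x ^+ l * (x^*)%C ^+ m) * (z ^+ l / z ^+ m) ^+ j).
  apply: eq_bigr => j _; rewrite -conj_nc.
  transitivity ((\sum_(l < N) (z ^+ j * x) ^+ l) * \sum_(m < N) (((z ^+ j * x) ^+ m)^*)%C).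
    by congr (_ * _); exact: conjc_sum.
  rewrite big_distrlr /=.
  apply: eq_bigr => l _; apply: eq_bigr => m _.
  rewrite conjc_X conjc_M conjc_X zc !exprMn !exprVn -!exprM (mulnC l) (mulnC m); ring.
rewrite exchange_big /= mulr_sumr; apply: eq_bigr => l _.
rewrite exchange_big /= (bigD1 l)//= [X in _ + X]big1 ?addr0; last first.
  move=> m ml; rewrite -mulr_sumr geometric_unity_sum ?mulr0//.
    by rewrite exprMn exprVn -!exprM !(mulnC _ N) !exprM zN !expr1n divr1.
  apply/eqP => /(canRL (mulfVK (expf_neq0 _ z0))); rewrite mul1r => E.
  have [lm|lm|lm] := ltngtP l m.
  - have := zl (m - l)%N; rewrite subn_gt0 lm (leq_ltn_trans (leq_subr _ _) (ltn_ord m)).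
    move=> /(_ isT)/eqP; apply; apply: (mulIf (expf_neq0 l z0)).
    by rewrite -exprD subnK ?(ltnW lm)// -E mul1r.
  - have := zl (l - m)%N; rewrite subn_gt0 lm (leq_ltn_trans (leq_subr _ _) (ltn_ord l)).
    move=> /(_ isT)/eqP; apply; apply: (mulIf (expf_neq0 m z0)).
    by rewrite -exprD subnK ?(ltnW lm)// E mul1r.
  - by move/eqP: ml; apply; apply: val_inj.
under eq_bigr do rewrite divff ?expf_neq0// expr1n mulr1.
rewrite sumr_const card_ord -[LHS]mulr_natl -rmorphXn /= conj_nc ncX.
by [].
Qed.

(** Since [(z^j x)^N = x^N], the quotient [(1 - x^N) / (1 - z^j x)] is a geometric polynomial in
    [z^j x], and Parseval bounds the sum of the squares of these by [N^2]. *)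
Lemma sum_inv_kernel_unity (z : R[i]) N (x : R[i]) : nc z = 1 -> z ^+ N = 1 ->
  (forall l, (0 < l < N)%N -> z ^+ l != 1) -> (0 < N)%N -> nc x < 1 ->
  \sum_(j < N) (nc (1 - z ^+ j * x)) ^- 2 <= N%:R ^+ 2 / (1 - nc x ^+ N) ^+ 2.
Proof.
move=> z1 zN zl N0 x1.
have xN : 0 < 1 - nc x ^+ N.
  by rewrite subr_gt0 exprn_ilt1 ?nc_ge0// -lt0n.
have E j : 1 - z ^+ j * x != 0 ->
    nc (1 - z ^+ j * x) ^- 2 <= nc (\sum_(l < N) (z ^+ j * x) ^+ l) ^+ 2 / (1 - nc x ^+ N) ^+ 2.
  move=> y0; set y := z ^+ j * x in y0 *.
  have yN : y ^+ N = x ^+ N by rewrite exprMn -exprM mulnC exprM zN expr1n mul1r.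
  have ny : nc (1 - y) > 0 by rewrite nc_gt0.
  have : (1 - y) * \sum_(l < N) y ^+ l = 1 - x ^+ N.
    by rewrite -yN -opprB -[in RHS]opprB subrX1 mulNr.
  move/(congr1 nc); rewrite ncM => E.
  have L : 1 - nc x ^+ N <= nc (1 - y) * nc (\sum_(l < N) y ^+ l).
    by rewrite E -ncX; have := nc_dist_ge 1 (x ^+ N); rewrite nc1.
  rewrite -exprVn -expr_div_n lerXn2r ?nnegrE ?invr_ge0 ?divr_ge0 ?nc_ge0 ?(ltW xN)//.
  by rewrite ler_pdivlMr// mulrC ler_pdivrMr// mulrC.
have y0 j : 1 - z ^+ j * x != 0.
  rewrite subr_eq0; apply: contraTN x1 => /eqP/esym/(congr1 nc).
  by rewrite ncM ncX z1 expr1n mul1r nc1 => ->; rewrite ltxx.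
apply: (@le_trans _ _ (\sum_(j < N) nc (\sum_(l < N) (z ^+ j * x) ^+ l) ^+ 2 / (1 - nc x ^+ N) ^+ 2)).
  by apply: ler_sum => j _; apply: E.
rewrite -mulr_suml sum_norm_power_unity// ler_pM2r ?invr_gt0 ?exprn_gt0//.
rewrite expr2 ler_pM2l ?ltr0n//.
apply: (@le_trans _ _ (\sum_(l < N) (1 : R))); last by rewrite sumr_const card_ord.
apply: ler_sum => l _; rewrite exprn_ile1// ?exprn_ge0 ?nc_ge0// exprn_ile1 ?nc_ge0//.
exact: ltW.
Qed.

Lemma cis_lipschitz (s t : R) : nc (cis s - cis t) <= 2 * `|s - t|.
Proof.
wlog st : s t / t <= s.
  move=> H; have [/H//|/ltW/H] := leP t s.
  by rewrite nc_distC distrC.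
have [c1 _ E1] := @MVT_segment R cos (fun y => - sin y) t s st
  (fun y _ => is_derive_cos y) (continuous_subspaceT (@continuous_cos R)).
have [c2 _ E2] := @MVT_segment R sin cos t s st
  (fun y _ => is_derive_sin y) (continuous_subspaceT (@continuous_sin R)).
have -> : cis s - cis t = ((cos s - cos t) +i* (sin s - sin t))%C by [].
rewrite (le_trans (nc_le_ReIm _ _))// E1 E2 !normrM mulr2n mulrDl mul1r lerD//.
  by rewrite ler_piMl// normrN ler_norml sin_geN1 sin_le1.
by rewrite ler_piMl// ler_norml cos_geN1 cos_le1.
Qed.

Lemma unit_cis u : nc u = 1 -> exists2 t : R, 0 <= t <= pi *+ 2 & u = cis t.
Proof.
case: u => a b u1.
have ab : a ^+ 2 + b ^+ 2 = 1 by have := nc_sqr (a +i* b)%C; rewrite u1 expr1n.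
have a1 : -1 <= a <= 1.
  by rewrite -ler_norml -(@ler_pXn2r _ 2)// ?nnegrE// expr1n real_normK ?num_real// -ab lerDl sqr_ge0.
have ca : cos (acos a) = a by apply: acosK; rewrite in_itv.
have sa : sin (acos a) = Num.sqrt (b ^+ 2).
  by rewrite sin_acos// -ab addrAC subrr add0r.
have [b0|b0] := leP 0 b.
  exists (acos a); last by rewrite /cis ca sa sqrtr_sqr ger0_norm.
  rewrite acos_ge0//= (le_trans (acos_lepi _))// mulr2n lerDl pi_ge0//.
exists (pi *+ 2 - acos a).
  rewrite subr_ge0 gerBl acos_ge0// andbT (le_trans (acos_lepi _))// mulr2n lerDl pi_ge0//.
rewrite addrC /cis cosD2pi sinD2pi cosN sinN ca sa sqrtr_sqr ltr0_norm//.
by rewrite opprK.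
Qed.

Definition root_angle (N j : nat) : R := pi *+ 2 * (j%:R / N%:R).

Lemma cis_root_angle N j : cis (root_angle N j) = cis (root_angle N 1) ^+ j.
Proof.
elim: j => [|j IH]; first by rewrite /root_angle mul0r mulr0 cis0.
rewrite exprS -IH -cisD /root_angle -mulrDr -mulrDl.
by rewrite -natr1 addrC.
Qed.

(** The spacing [2 pi / N] of the angles times the Lipschitz constant 2 of [cis]. *)
Lemma unit_near_root u N : (0 < N)%N -> nc u = 1 ->
  exists2 j, (j < N)%N & nc (u - cis (root_angle N j)) <= 4 * pi / N%:R.
Proof.
move=> N0 u1; have [t /andP[t0 t1] ->] := unit_cis u1.
have p0 : 0 < pi *+ 2 :> R by exact: twopi_gt0.
have NR : 0 < N%:R :> R by rewrite ltr0n.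
pose q := t / (pi *+ 2) * N%:R.
have q0 : 0 <= q by apply: mulr_ge0; [apply: divr_ge0; [|exact: ltW]|exact: ltW].
have qN : q <= N%:R by rewrite ler_piMl ?(ltW NR)// ler_pdivrMr// mul1r.
have [j /andP[jq qj]] : exists j, (j%:R <= q < j.+1%:R).
  by exists (Num.truncn q); exact: truncn_itv.
have tE : t = pi *+ 2 * (q / N%:R) by rewrite /q mulfK ?gt_eqF// mulrCA divff ?mulr1 ?gt_eqF.
have d : nc (cis t - cis (root_angle N j)) <= 4 * pi / N%:R.
  rewrite (le_trans (cis_lipschitz _ _))// tE /root_angle -mulrBr -mulrBl.
  rewrite !normrM gtr0_norm// ger0_norm ?subr_ge0// gtr0_norm ?invr_gt0//.
  have -> : 4 * pi / N%:R = 2 * (pi *+ 2 * (1 / N%:R)) :> R by rewrite mulr2n; field; rewrite gt_eqF.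
  rewrite !ler_pM2l// ler_pM2r ?invr_gt0//.
  by move: qj; rewrite -natr1; lra.
have [jN|Nj] := ltnP j N; first by exists j.
(* The angle [2 pi] rounds down to [j = N], which names the same root as [j = 0]. *)
exists 0%N => //.
have jE : j = N by apply/eqP; rewrite eqn_leq Nj andbT -(ler_nat R) (le_trans jq).
move: d; rewrite jE /root_angle divff ?gt_eqF// mulr1 mul0r mulr0 cis0.
by rewrite -[pi *+ 2]add0r cisD2pi cis0.
Qed.

Lemma cos_lt1 (t : R) : 0 < t < pi *+ 2 -> cos t < 1.
Proof.
move=> /andP[t0 t2].
have [tpi|pit] := leP t pi.
  rewrite -cos0 ltr_cos// ?in_itv /= ?lexx ?pi_ge0 ?tpi ?andbT ?ltW//.
have -> : cos t = cos (pi *+ 2 - t) by rewrite addrC cosD2pi cosN.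
rewrite -cos0 ltr_cos// ?in_itv /= ?lexx ?pi_ge0 ?subr_gt0//.
by rewrite subr_ge0 (ltW t2) /= lerBlDr mulr2n lerD2l ltW.
Qed.

(** Stated for the inverse root because the lattice points enter the kernels through their
    conjugates. *)
Lemma cis_root_primitive N : (0 < N)%N -> let z := (cis (root_angle N 1) : R[i])^-1 in
  [/\ nc z = 1, z ^+ N = 1 & forall l, (0 < l < N)%N -> z ^+ l != 1].
Proof.
move=> N0 z; have NR : 0 < N%:R :> R by rewrite ltr0n.
split; first by rewrite ncV nc_cis invr1.
  rewrite exprVn -cis_root_angle /root_angle divff ?gt_eqF// mulr1.
  by rewrite -[pi *+ 2]add0r cisD2pi cis0 invr1.
move=> l /andP[l0 lN]; rewrite exprVn invr_eq1 -cis_root_angle.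
have := @cos_lt1 (root_angle N l).
have -> : 0 < root_angle N l < pi *+ 2.
  rewrite /root_angle mulr_gt0 ?twopi_gt0 ?divr_gt0 ?ltr0n//=.
  by rewrite gtr_pMr ?twopi_gt0// ltr_pdivrMr// mul1r ltr_nat.
move=> /(_ isT) c1; apply/eqP => /(congr1 (@complex.Re R)) /= E.
by move: c1; rewrite E ltxx.
Qed.

End RootsOfUnity.

(** * Measurability and continuity on the disc *)

Section MeasurabilityPlane.
Context {R : realType}.
Local Notation T := (measurableTypeR R).

(** An open set is the union of those boxes inside it that have rational centre and half-side
    [1 / (n + 1)], a countable family. *)
Lemma open_plane_measurable (U : set (R * R)) : open U -> measurable U.
Proof.
move=> oU.
pose box (a b : rat) (n : nat) : set (R * R) :=
  `](ratr a - n.+1%:R^-1)%R, (ratr a + n.+1%:R^-1)%R[%classic `*`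
  `](ratr b - n.+1%:R^-1)%R, (ratr b + n.+1%:R^-1)%R[%classic.
pose P a b n := if `[< box a b n `<=` U >] then box a b n else set0.
have -> : U = \bigcup_a \bigcup_b \bigcup_n P a b n.
  apply/seteqP; split => [[x y] Uxy|z [a _ [b _ [n _]]]]; last first.
    by rewrite /P; case: ifPn => [/asboolP H /H|].
  have /nbhs_ballP [e /= e0 He] : nbhs (x, y) U by exact: open_nbhs_nbhs.
  have key (d s t u : R) : 2 * d < e -> t - d < s -> s < t + d -> s - d < u ->
      u < s + d -> `|t - u| < e.
    by move=> *; rewrite ltr_norml; apply/andP; split; lra.
  have key2 (d s t : R) : t - d < s -> s < t + d -> s - d < t < s + d.
    by move=> *; apply/andP; split; lra.
  pose n := Num.bound (2 / e).
  have n0 : 0 < n.+1%:R^-1 :> R by rewrite invr_gt0 ltr0n.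
  have ne : 2 * n.+1%:R^-1 < e.
    rewrite ltr_pdivrMr ?ltr0n// mulrC -ltr_pdivrMr//.
    have := archi_boundP (ltW (divr_gt0 (ltr0Sn R 1) e0)).
    by move=> /lt_trans; apply; rewrite ltr_nat.
  have lt_pm (t : R) : t - n.+1%:R^-1 < t + n.+1%:R^-1 by rewrite ltrD2l gt0_cp.
  have [a Ha] := @rat_in_itvoo R (x - n.+1%:R^-1) (x + n.+1%:R^-1) (lt_pm _).
  have [b Hb] := @rat_in_itvoo R (y - n.+1%:R^-1) (y + n.+1%:R^-1) (lt_pm _).
  exists a => //; exists b => //; exists n => //.
  move: Ha Hb; rewrite !in_itv /= => /andP[a1 a2] /andP[b1 b2].
  have -> : P a b n = box a b n.
    rewrite /P asboolT// => -[x' y'] [/=]; rewrite !in_itv /= => /andP[? ?] /andP[? ?].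
    by apply: He; split; [exact: (key n.+1%:R^-1 (ratr a))|exact: (key n.+1%:R^-1 (ratr b))].
  by split; rewrite /= in_itv /=; apply: key2.
apply: bigcupT_measurable_rat => a; apply: bigcupT_measurable_rat => b.
apply: bigcupT_measurable => n; rewrite /P; case: ifP => // _.
by apply: measurableX; exact: measurable_itv.
Qed.

Lemma open_continuous_plane_measurable (D : set (R * R)) (g : R * R -> R) : open D ->
  (forall x, D x -> {for x, continuous g}) -> measurable_fun D g.
Proof.
move=> oD cg; have mD := open_plane_measurable oD.
apply: (measurability _ (RGenOInfty.measurableE R)) => _ [_ [a ->] <-].
apply: open_plane_measurable; rewrite openE => x [Dx gx].
have ag : a < g x by move: gx; rewrite /= in_itv /= andbT.
have [] : nbhs x D /\ (\forall y \near x, a < g y).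
  split; first exact: open_nbhs_nbhs.
  exact: (cvgr_gt (g x) (cg _ Dx)).
move=> nD; apply: filterS2 nD => y Dy ay; split => //=.
by rewrite in_itv /= ay.
Qed.

Lemma open_disc : open (@disc2 R).
Proof.
rewrite openE => x Dx.
have c1 : {for x, continuous (fun y : R * R => nc (y.1 +i* y.2)%C)}.
  apply: (@nc_comp_continuous R (R * R)%type fst snd x id).
  - exact: cvg_fst.
  - exact: cvg_snd.
  - exact: cdiff_ccont (cdiff_id _).
near=> y; rewrite /disc2 /cabs /toC /=; near: y.
by apply: (@cvgr_lt _ _ _ _ _ _ c1).
Unshelve. all: by end_near.
Qed.

Lemma measurable_disc : measurable (@disc2 R : set (R * R)).
Proof. exact: open_plane_measurable open_disc. Qed.

Lemma ccont_nc_measurable (F : R[i] -> R[i]) : (forall z, nc z < 1 -> ccont F z) ->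
  measurable_fun (@disc2 R : set (R * R)) (fun x : R * R => nc (F (x.1 +i* x.2)%C)).
Proof.
move=> cF; apply: open_continuous_plane_measurable; first exact: open_disc.
move=> x Dx; apply: (@nc_comp_continuous R (R * R)%type fst snd x F).
- exact: cvg_fst.
- exact: cvg_snd.
- exact: cF.
Qed.

Lemma ccont_nc_measurable_leb (F : R[i] -> R[i]) : (forall z, nc z < 1 -> ccont F z) ->
  measurable_fun (@disc2 R : set (T * T)) (fun x : T * T => nc (F (x.1 +i* x.2)%C) : T).
Proof. exact: ccont_nc_measurable. Qed.

Lemma ccont_comp (F G : R[i] -> R[i]) z : ccont G z -> ccont F (G z) ->
  ccont (fun x => F (G x)) z.
Proof.
move=> cG cF e e0; have [eta eta0 H] := cF _ e0.
have [d d0 K] := cG _ (divr_gt0 eta0 (ltr0Sn _ 1)); exists d => // h hd.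
rewrite -[G (z + h)](subrKC (G z)); apply: H.
by rewrite (le_lt_trans (K _ hd))// ltr_pdivrMr// ltr_pMr// ltr1n.
Qed.

Lemma ccontD (F G : R[i] -> R[i]) z : ccont F z -> ccont G z -> ccont (fun x => F x + G x) z.
Proof.
move=> cF cG e e0; have e2 := divr_gt0 e0 (ltr0Sn R 1).
have [a a0 Ha] := cF _ e2; have [b b0 Hb] := cG _ e2.
exists (Num.min a b); first by rewrite lt_min a0.
move=> h; rewrite lt_min => /andP[h1 h2]; rewrite opprD addrACA.
by rewrite (le_trans (ncD _ _))// [leRHS]splitr lerD// ?Ha ?Hb.
Qed.

(* The derivative of [f - f'(w)(x - w)], which is small near [w], is controlled by Cauchy's estimate. *)
Lemma derivative_ccont (f f' : R[i] -> R[i]) :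
  (forall z, nc z < 1 -> cdiff f z (f' z)) -> forall z, nc z < 1 -> ccont f' z.
Proof.
move=> fd w w1 e e0.
(* On the disc of radius [|h|] about [w + h] the remainder is at most [2 |h| e / 8]; Cauchy's
   estimate multiplies this by [4 / |h|], which gives [e]. *)
have e8 : 0 < e / 8 by rewrite divr_gt0.
have [eta eta0 H] := fd w w1 _ e8.
pose m := Num.min eta (1 - nc w).
have m0 : 0 < m by rewrite lt_min eta0 subr_gt0.
exists (m / 2); first by rewrite divr_gt0.
move=> h hm; have [->|h0] := eqVneq h 0; first by rewrite addr0 subrr nc0 ltW.
have nh : 0 < nc h by rewrite nc_gt0.
pose G x := f x + (- f w + (- f' w) * (- w + 1 * x)).
have Gd x : nc x < 1 -> cdiff G x (f' x + (0 + (- f' w) * (0 + 1 * 1))).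
  move=> x1; apply: cdiffD; first exact: fd.
  apply: cdiffD; first exact: cdiff_cst.
  apply: cdiffZ; apply: cdiffD; first exact: cdiff_cst.
  by apply: cdiffZ; exact: cdiff_id.
have near_w x : nc (x - (w + h)) < nc h -> nc (x - w) < 2 * nc h.
  move=> xh; have -> : x - w = (x - (w + h)) + h by ring.
  by rewrite (le_lt_trans (ncD _ _))// mulr2n mulrDl mul1r ltrD2r.
have in_disc x : nc (x - w) < 2 * nc h -> nc x < 1.
  move=> xw; rewrite -[x](subrK w) (le_lt_trans (ncD _ _))//.
  have : 2 * nc h < m by lra.
  have : m <= 1 - nc w by rewrite ge_min lexx orbT.
  lra.
have wh1 : nc (w + h) < 1.
  by apply: in_disc; rewrite addrC addKr; lra.
have := @derivative_le_of_bounded R G (w + h) _ (nc h) (2 * nc h * (e / 8)) nh _ (Gd _ wh1).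
rewrite (_ : f' (w + h) + _ = f' (w + h) - f' w); last by ring.
move=> K; apply: le_trans (K _ _) _.
- by move=> x /near_w/in_disc x1; eexists; exact: Gd.
- move=> x /near_w xw.
  have := H (x - w); have -> : w + (x - w) = x by ring.
  have -> : f x - f w - f' w * (x - w) = G x by rewrite /G; ring.
  have : 2 * nc h < m by lra.
  have : m <= eta by rewrite ge_min lexx.
  move=> m1 m2 /(_ (lt_le_trans (lt_trans xw m2) m1))/le_trans; apply.
  by rewrite mulrC ler_pM2r// ltW.
- by rewrite ler_pdivrMr//; lra.
Qed.

End MeasurabilityPlane.

(** The graph of [y^p] lies above its tangent at [l], here a case of Young's inequality. Being
    linear in [y], it yields Jensen's inequality for weights of total mass other than 1. *)
Lemma powR_tangent {R : realType} (p y l : R) : 1 < p -> 0 <= y -> 0 < l ->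
  p * l `^ (p - 1) * y <= y `^ p + (p - 1) * l `^ p.
Proof.
move=> p1 y0 l0; have p0 : 0 < p by exact: lt_trans p1.
have p10 : 0 < p - 1 by rewrite subr_gt0.
pose q := p / (p - 1).
have q0 : 0 < q by rewrite divr_gt0.
have pq : p^-1 + q^-1 = 1 by rewrite /q; field; rewrite !gt_eqF.
have := conjugate_powR y0 (powR_ge0 l (p - 1)) p0 q0 pq.
rewrite -powRrM (_ : (p - 1) * q = p); last by rewrite /q mulrCA divff ?mulr1 ?gt_eqF.
move=> H; have : p * (y * l `^ (p - 1)) <= p * (y `^ p / p + l `^ p / q) by rewrite ler_pM2l.
have -> : p * (y `^ p / p + l `^ p / q) = y `^ p + (p - 1) * l `^ p.
  by rewrite /q; field; rewrite !gt_eqF.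
by rewrite -mulrA [y * _]mulrC.
Qed.

(** * Bounds by [p]-means over a circle *)

Section CircleMeans.
Context {R : realType}.
Local Notation mu := (@lebesgue_measure R).
Implicit Types (u b w : R[i]).

Lemma ReM_real (x : R[i]) (a : R) : complex.Re (x * (a%:C)%C) = complex.Re x * a.
Proof. by rewrite ReM /= mulr0 subr0. Qed.

Lemma Re_cayley u : nc u < 1 ->
  complex.Re ((1 + u) * (1 + (- 1) * u)^-1) = (1 - nc u ^+ 2) / nc (1 - u) ^+ 2.
Proof.
move=> u1; rewrite mulN1r.
have u0 : 1 - u != 0.
  rewrite subr_eq0; apply: contraTN u1 => /eqP <-.
  by rewrite nc1 ltxx.
have n0 : nc (1 - u) ^+ 2 != 0 by rewrite expf_neq0// nc_eq0.
apply: (mulIf n0); rewrite divfK//.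
have E : (1 + u) / (1 - u) * (((nc (1 - u) ^+ 2)%:C)%C) = (1 + u) * ((1 - u)^*)%C.
  by rewrite -conj_nc mulrA mulfVK.
have := congr1 (@complex.Re R) E; rewrite ReM_real => ->.
rewrite nc_sqr; clear; case: u => x y /=; ring.
Qed.

Lemma one_minus_neq0 b x : nc b < 1 -> nc x < 1 -> 1 - b * x != 0.
Proof.
move=> b1 x1; rewrite subr_eq0; apply: contraTN b1 => /eqP/(congr1 (fun z => nc z)).
rewrite ncM nc1 => E; rewrite -leNgt.
have [b0|b0] := eqVneq (nc b) 0; first by move: E; rewrite b0 mul0r => /eqP; rewrite oner_eq0.
by rewrite leNgt; apply/negP => b1; have := mulr_ilt1 (nc_ge0 b) (nc_ge0 x) b1 x1; rewrite -E ltxx.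
Qed.

Lemma cdiff_kernel (b x : R[i]) : 1 - b * x != 0 -> exists d, cdiff (fun x => (1 - b * x)^-1) x d.
Proof.
move=> h; have E : 1 + (- b) * x != 0 by rewrite mulNr.
have := cdiff_affineV E; set d := (X in cdiff _ _ X) => H; exists d.
by rewrite (_ : (fun x => _) = (fun x => (1 + - b * x)^-1))//; apply/funext => y; rewrite mulNr.
Qed.

(** Mean value property of [(1 + b x) / (1 - b x)], which is 1 at the centre and whose real part is
    the Poisson kernel. *)
Lemma poisson_mean b r : nc b < 1 -> 0 <= r < 1 ->
  iseg (fun t => (1 - nc b ^+ 2 * r ^+ 2) / nc (1 - b * ((r%:C)%C * cis t)) ^+ 2) 0 (pi *+ 2)
  = pi *+ 2.
Proof.
move=> b1 r01; case/andP: (r01) => r0 r1.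
pose F (x : R[i]) := (1 + b * x) * (1 - b * x)^-1.
have dF z : nc z < 1 -> exists d, cdiff F z d.
  move=> z1; have [d Hd] := cdiff_kernel (one_minus_neq0 b1 z1).
  have H := cdiffM (cdiffD (cdiff_cst 1 z) (cdiffZ b (cdiff_id z))) Hd.
  by move: H; set d' := (X in cdiff _ _ X); exists d'.
have cF z : nc z < 1 -> ccont F z by move=> /dF [d /cdiff_ccont].
have := mean_value_property cF (fun z z1 (_ : z != 0) => dF z z1) r01.
have -> : F 0 = 1 by rewrite /F mulr0 addr0 subr0 invr1 mulr1.
rewrite mul1r => M; rewrite -[RHS]M; apply: eq_Rintegral => t _; rewrite /F.
have nx : nc ((r%:C)%C * cis t) = r by rewrite nc_polar ger0_norm.
have bx : nc (b * ((r%:C)%C * cis t)) < 1.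
  by rewrite ncM nx mulr_ilt1 ?nc_ge0.
have := Re_cayley bx; rewrite mulN1r => ->.
by rewrite ncM nx exprMn.
Qed.

(** [point_le_circle_mean] for [f] times [(del / (1 - b x))^2] bounds [|f w|] by a mean of [|f|]
    with the density [kap = del / |1 - b x|^2]. Since [del <= 1 - |b|^2 r^2], this density is below
    the Poisson kernel and has integral at most [2 pi], so Jensen's inequality passes to [p]-th
    powers. The unimodular [u] lets the parametrized circle start at any prescribed point. *)
Lemma circle_mean_pow (f : R[i] -> R[i]) (p : R) (b w u : R[i]) (r del s0 c1 : R) :
  (forall z, nc z < 1 -> exists d, cdiff f z d) -> 1 < p -> nc u = 1 ->
  0 < del -> nc b <= 1 - del -> 0 < s0 -> 0 < c1 ->
  nc w + c1 * del <= r -> r < 1 -> s0 * nc (1 - b * w) <= del ->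
  (((pi *+ 2) * nc (f w) `^ p)%R%:E <= ((2 / (s0 ^+ 2 * c1)) `^ p)%R%:E *
   \int[mu]_(t in `[0%R, (pi *+ 2)%R])
     (nc (f (u * ((r%:C)%C * cis t))) `^ p *
       (del / nc (1 - b * (u * ((r%:C)%C * cis t))) ^+ 2))%R%:E)%E.
Proof.
move=> hf p1 u1 del0 bdel s00 c10 wr r1 sw.
have p0 : 0 < p by exact: lt_trans p1.
have b1 : nc b < 1 by rewrite (le_lt_trans bdel)// gtrBl.
have w_r : nc w < r by rewrite (lt_le_trans _ wr)// ltrDl mulr_gt0.
have r0 : 0 < r by rewrite (le_lt_trans _ w_r)// nc_ge0.
have w1 : nc w < 1 by exact: lt_trans r1.
have uu : u != 0 by rewrite -nc_gt0 u1.
pose X t := u * ((r%:C)%C * cis t).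
have nX t : nc (X t) = r by rewrite /X ncM u1 mul1r nc_polar gtr0_norm.
pose y t := nc (f (X t)).
pose kap t := del / nc (1 - b * X t) ^+ 2.
have D0 t : 0 < nc (1 - b * X t) by rewrite nc_gt0 one_minus_neq0// nX.
have kap0 t : 0 < kap t by rewrite divr_gt0// exprn_gt0.
(* The summand [0 +] brings the argument into the affine form expected by [cdiff_comp_affine]. *)
pose h x := f (0 + u * x) * ((del%:C)%C * (1 - b * u * x)^-1) ^+ 2.
have bu : nc (b * u) < 1 by rewrite ncM u1 mulr1.
have dh z : nc z < 1 -> exists d, cdiff h z d.
  move=> z1; have uz : nc (0 + u * z) < 1 by rewrite add0r ncM u1 mul1r.
  have [d1 H1] := hf _ uz; have [d2 H2] := cdiff_kernel (one_minus_neq0 bu z1).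
  have := cdiffM (cdiff_comp_affine H1) (cdiffX 2 (cdiffZ (del%:C)%C H2)).
  by set d := (X in cdiff _ _ X); exists d.
pose w' := u^-1 * w.
have uw' : u * w' = w by rewrite /w' mulrA divff// mul1r.
have nw' : nc w' = nc w by rewrite /w' ncM ncV u1 invr1 mul1r.
have w'r : nc w' < r by rewrite nw'.
have hX t : nc (h ((r%:C)%C * cis t)) = del * (kap t * y t).
  rewrite /h add0r -mulrA -/(X t) ncM ncX ncM nc_real gtr0_norm// ncV /kap /y; field.
  by rewrite gt_eqF.
have cont_h t : {for t, continuous (fun t : R => nc (h ((r%:C)%C * cis t)))}.
  apply: (polar_comp_continuous _).2.
  by have [|d /cdiff_ccont//] := dh ((r%:C)%C * cis t); rewrite nc_polar gtr0_norm.
pose I1 := iseg (fun t => kap t * y t) 0 (pi *+ 2).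
have cont_ky t : {for t, continuous (fun t : R => kap t * y t)}.
  rewrite (_ : (fun t : R => _) = (fun t : R => del^-1 * nc (h ((r%:C)%C * cis t)))).
    by apply: cvgM; [exact: cvg_cst|exact: cont_h].
  by apply/funext => s; rewrite hX mulKf ?gt_eqF.
have I1E : iseg (fun t => nc (h ((r%:C)%C * cis t))) 0 (pi *+ 2) = del * I1.
  rewrite -RintegralZl//; last exact: segment_integrable.
  by apply: eq_Rintegral => t _; rewrite hX.
(* The lower bound that the weighted mean of [|f|] satisfies; the tangent to [y^p] is taken at this
   point, and so [(|f w| / l)^p] is the constant of the lemma. *)
pose l := nc (f w) * s0 ^+ 2 * c1 / 2.
have L1 : (pi *+ 2) * l <= I1.
  have := point_le_circle_mean dh w'r r1; rewrite I1E nw' => H.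
  have hw : nc (f w) * s0 ^+ 2 <= nc (h w').
    rewrite /h add0r -mulrA uw' ncM ler_wpM2l ?nc_ge0// ncX lerXn2r ?nnegrE ?nc_ge0 ?(ltW s00)//.
    rewrite ncM nc_real gtr0_norm// ncV ler_pdivlMr// nc_gt0 one_minus_neq0//.
  have I10 : 0 <= I1.
    by apply: Rintegral_ge0 => t _; rewrite mulr_ge0 ?nc_ge0// ltW.
  have pi0 := pi_gt0 R.
  have H2 : nc (f w) * s0 ^+ 2 * pi <= (c1 * del)^-1 * (del * I1).
    apply: le_trans (le_trans (_ : _ <= nc (h w') * pi) H) _; first by rewrite ler_pM2r.
    rewrite ler_wpM2r ?mulr_ge0 ?(ltW del0)//.
    have cd : 0 < c1 * del by rewrite mulr_gt0.
    have rw : c1 * del <= r - nc w by rewrite lerBrDl.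
    rewrite -[leRHS]mul1r ler_pM ?invr_ge0 ?(ltW r0) ?(ltW r1) ?subr_ge0 ?(ltW w_r)//.
    by rewrite lef_pV2 ?posrE// subr_gt0.
  have -> : (pi *+ 2) * l = c1 * (nc (f w) * s0 ^+ 2 * pi) by rewrite /l mulr2n; field.
  rewrite -ler_pdivlMl//; apply: (le_trans H2).
  by rewrite invfM -mulrA mulKf ?gt_eqF.
have l0 : 0 <= l by rewrite !mulr_ge0 ?nc_ge0 ?exprn_ge0 ?ltW// invr_gt0.
have fwE : nc (f w) = 2 / (s0 ^+ 2 * c1) * l.
  by rewrite /l; field; rewrite !gt_eqF.
rewrite fwE powRM//; last by rewrite divr_ge0// mulr_ge0 ?exprn_ge0 ?ltW.
rewrite mulrCA EFinM lee_wpmul2l ?lee_fin ?powR_ge0//.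
change (((pi *+ 2 * l `^ p)%R%:E <= \int[mu]_(t in `[0%R, (pi *+ 2)%R]) (y t `^ p * kap t)%R%:E)%E).
have cont_d t : {for t, continuous (fun t : R => nc (1 - b * X t))}.
  pose G x := 1 - b * (0 + u * x).
  have := @polar_comp_continuous R G r t.
  rewrite (_ : (fun t : R => nc (G _)) = (fun t : R => nc (1 - b * X t))).
    case=> //; have : cdiff G ((r%:C)%C * cis t) (0 + - b * (u * 1)).
      rewrite (_ : G = (fun x => 1 + - b * (0 + u * x))).
        apply: cdiffD; first exact: cdiff_cst.
        apply: cdiffZ; exact: (cdiff_comp_affine (f := id) (cdiff_id _)).
      by apply/funext => x; rewrite /G mulNr.
    exact: cdiff_ccont.
  by apply/funext => s; rewrite /G add0r.
have cont_kap t : {for t, continuous kap}.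
  apply: cvgM; first exact: cvg_cst.
  apply: cvgV; first by rewrite gt_eqF// exprn_gt0.
  rewrite /= expr2; under eq_fun do rewrite expr2.
  by apply: cvgM; exact: cont_d.
have [l00|l_gt0] := eqVneq l 0.
  rewrite l00 powR0 ?gt_eqF// mulr0; apply: integral_ge0 => t _.
  by rewrite lee_fin mulr_ge0 ?powR_ge0// ltW.
have {l_gt0} l_gt0 : 0 < l by rewrite lt_def l_gt0.
have mky : measurable_fun (`[0, pi *+ 2]%classic : set (measurableTypeR R)) (fun t => kap t * y t).
  apply: measurable_funTS; apply: continuous_measurable_fun => t; exact: cont_ky.
have mkap : measurable_fun [set: measurableTypeR R] (kap : measurableTypeR R -> measurableTypeR R).
  by apply: continuous_measurable_fun => t; exact: cont_kap.
have my : measurable_fun [set: measurableTypeR R] (y : measurableTypeR R -> measurableTypeR R).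
  rewrite (_ : y = (fun t => (kap t * y t) * (nc (1 - b * X t) ^+ 2 / del))).
    apply: measurable_funM.
      by apply: continuous_measurable_fun => t; exact: cont_ky.
    apply: measurable_funM => //; apply: measurable_funX.
    by apply: continuous_measurable_fun => t; exact: cont_d.
  apply/funext => t; rewrite /kap; field.
  by rewrite !gt_eqF//=.
have kap_mean : iseg kap 0 (pi *+ 2) <= pi *+ 2.
  have := poisson_mean bu (_ : 0 <= r < 1); rewrite (ltW r0) r1 => /(_ isT) PM.
  rewrite -[leRHS]PM; apply: iseg_le => [t _|t _|t _]; first exact: cont_kap.
    apply: cvgM; first exact: cvg_cst.
    rewrite (_ : (fun t : R => _) = (fun t : R => (nc (1 - b * X t) ^+ 2)^-1)).
      apply: cvgV; first by rewrite -mulrA -/(X t) gt_eqF// exprn_gt0.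
      rewrite -mulrA -/(X t) /= expr2; under eq_fun do rewrite expr2.
      by apply: cvgM; exact: cont_d.
    by apply/funext => s; rewrite -mulrA.
  rewrite -mulrA -/(X t) ler_wpM2r ?invr_ge0 ?exprn_ge0 ?nc_ge0//.
  have br : nc b * r <= nc b by rewrite ler_piMr ?nc_ge0// ltW.
  have br2 : (nc b * r) ^+ 2 <= nc b * r.
    by rewrite expr2 ler_piMr ?mulr_ge0 ?nc_ge0 ?(ltW r0)// (le_trans br)// ltW.
  rewrite ncM u1 mulr1 -exprMn; move: br br2 bdel; lra.
have Ekap : (\int[mu]_(t in `[0%R, (pi *+ 2)%R]) (kap t)%:E = (iseg kap 0 (pi *+ 2))%R%:E)%E.
  rewrite fineK//; apply: integrable_fin_num => //; apply: segment_integrable.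
  by move=> t _; exact: cont_kap.
have Eky : (\int[mu]_(t in `[0%R, (pi *+ 2)%R]) (kap t * y t)%R%:E = I1%:E)%E.
  by rewrite fineK//; apply: integrable_fin_num => //; apply: segment_integrable.
have pl0 : 0 <= p * l `^ (p - 1) by rewrite mulr_ge0 ?powR_ge0// ltW.
have ql0 : 0 <= (p - 1) * l `^ p by rewrite mulr_ge0 ?powR_ge0// subr_ge0 ltW.
have mypk : measurable_fun (`[0, pi *+ 2]%classic : set (measurableTypeR R)) (fun t => (y t `^ p * kap t)%R%:E).
  apply: measurable_funTS; apply/measurable_EFinP; apply: measurable_funM => //.
  exact: (measurableT_comp (measurable_powR p) my).
have key : (((p * l `^ (p - 1)) * I1)%R%:E <= \int[mu]_(t in `[0%R, (pi *+ 2)%R]) (y t `^ p * kap t)%R%:E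
     + (((p - 1) * l `^ p) * (pi *+ 2))%R%:E)%E.
  rewrite EFinM -Eky -ge0_integralZl_EFin//; last 2 first.
  - by move=> t _; rewrite lee_fin mulr_ge0 ?nc_ge0// ltW.
  - by apply/measurable_EFinP.
  apply: (@le_trans _ _ (\int[mu]_(t in `[0%R, (pi *+ 2)%R]) ((y t `^ p * kap t)%R%:E +
    ((p - 1) * l `^ p)%R%:E * (kap t)%:E))%E).
    apply: ge0_le_integral => //.
    - by move=> t _; rewrite mule_ge0 ?lee_fin// mulr_ge0 ?nc_ge0// ltW.
    - by apply: measurable_funeM; apply/measurable_EFinP.
    - apply: emeasurable_funD => //; apply: measurable_funeM; apply/measurable_EFinP.
      exact: measurable_funTS.
    - move=> t _; rewrite -!EFinM -EFinD lee_fin.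
      have := powR_tangent p1 (nc_ge0 (f (X t))) l_gt0; rewrite -/(y t) => H.
      by rewrite mulrCA -mulrDl [leRHS]mulrC ler_pM2l.
  rewrite ge0_integralD//; last 3 first.
  - by move=> t _; rewrite lee_fin mulr_ge0 ?powR_ge0// ltW.
  - by move=> t _; rewrite mule_ge0 ?lee_fin// ltW.
  - by apply: measurable_funeM; apply/measurable_EFinP; exact: measurable_funTS.
  rewrite leeD2l// ge0_integralZl_EFin//; last 2 first.
  - by move=> t _; rewrite lee_fin ltW.
  - by apply/measurable_EFinP; exact: measurable_funTS.
  by rewrite Ekap -EFinM lee_fin ler_wpM2l.
move: key; case: (\int[mu]_(t in _) _)%E => [v||].
- rewrite -EFinD !lee_fin => key.
  have lp : l `^ p = l `^ (p - 1) * l.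
    have := @powRD R l (p - 1) 1; rewrite subrK powRr1//; apply.
    by apply/implyP => _; apply: lt0r_neq0.
  have : p * l `^ (p - 1) * ((pi *+ 2) * l) <= p * l `^ (p - 1) * I1 by rewrite ler_wpM2l.
  by move: key; rewrite lp; lra.
- by move=> _; rewrite leey.
- by rewrite addNye leeNy_eq.
Qed.

End CircleMeans.

(** * From circles to annuli *)

Section AnnulusMeans.
Context {R : realType}.
Local Notation mu := (@lebesgue_measure R).
Local Notation T := (measurableTypeR R).
Definition cplx (x : T * T) : R[i] := (x.1 +i* x.2)%C.

Lemma leb2_sigma_finite : sigma_finite setT (mu \x mu)%E.
Proof.
have /sigma_finiteP[F [TF ndF Foo]] := sigma_finiteT mu.
exists (fun n => F n `*` F n).
  rewrite -setXTT {1 2}TF predeqE => -[x y]; split.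
    move=> [/= [n _ Fnx] [k _ Gky]]; exists (maxn n k) => //; split.
    - by move: x Fnx; exact/subsetPset/ndF/leq_maxl.
    - by move: y Gky; exact/subsetPset/ndF/leq_maxr.
  by move=> [n _ []/= ? ?]; split; exists n.
move=> k; have [? ?] := Foo k.
split; first exact: measurableX.
by rewrite product_measure1E// lte_mul_pinfty// ge0_fin_numE.
Qed.

(** Bundles the planar measure so that Tonelli applies to the product of the plane and the angle. *)
Definition leb2_sf : {sigma_finite_measure set (T * T)%type -> \bar R} :=
  HB.pack (mu \x mu)%E (Measure_isSigmaFinite.Build _ _ _ (mu \x mu)%E leb2_sigma_finite).

Lemma cplx_rotate (t : R) (x : T * T) :
  cplx (rotate (cos t) (sin t) x) = cplx x * cis t.
Proof. by apply/eqP; rewrite eq_complex ReM ImM /=; apply/andP; split; apply/eqP; ring. Qed.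

Lemma measurable_rotation_pair :
  measurable_fun [set: (T * T) * T]
    (fun y : (T * T) * T => rotate (cos y.2) (sin y.2) y.1 : T * T).
Proof.
have mc : measurable_fun [set: (T * T) * T] (fun y : (T * T) * T => cos y.2 : T).
  apply: (measurableT_comp (f := (@cos R : T -> T))) => //.
  by apply: continuous_measurable_fun; exact: continuous_cos.
have ms : measurable_fun [set: (T * T) * T] (fun y : (T * T) * T => sin y.2 : T).
  apply: (measurableT_comp (f := (@sin R : T -> T))) => //.
  by apply: continuous_measurable_fun; exact: continuous_sin.
have m1 : measurable_fun [set: (T * T) * T] (fun y : (T * T) * T => y.1.1 : T).
  exact: (measurableT_comp (f := (fst : T * T -> T))).
have m2 : measurable_fun [set: (T * T) * T] (fun y : (T * T) * T => y.1.2 : T).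
  exact: (measurableT_comp (f := (snd : T * T -> T))).
apply: measurable_fun_pair => /=.
  by apply: measurable_funB; apply: measurable_funM.
by apply: measurable_funD; apply: measurable_funM.
Qed.

(** Tonelli exchanges point and angle; for a fixed angle the integral over the plane is rotation
    invariant. *)
Lemma integral_rotation_average (g : T * T -> \bar R) :
  measurable_fun setT g -> (forall x, (0 <= g x)%E) ->
  (\int[mu \x mu]_z \int[mu]_(t in `[0%R, (pi *+ 2)%R]) g (rotate (cos t) (sin t) z) =
   (pi *+ 2)%R%:E * \int[mu \x mu]_z g z)%E.
Proof.
move=> mg g0.
pose D : set T := `[0, pi *+ 2]%classic.
have mD : measurable D by exact: measurable_itv.
pose h (y : (T * T) * T) : \bar R :=
  ((\1_D y.2)%:E * g (rotate (cos y.2) (sin y.2) y.1))%E.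
have h0 y : (0 <= h y)%E by rewrite mule_ge0// lee_fin.
have mh : measurable_fun setT h.
  apply: emeasurable_funM.
    apply/measurable_EFinP; apply: (measurableT_comp (f := (\1_D : T -> R))) => //.
  exact: (measurableT_comp mg measurable_rotation_pair).
transitivity (\int[mu \x mu]_z \int[mu]_t h (z, t))%E.
  apply: eq_integral => z _; rewrite integral_mkcond; apply: eq_integral => t _.
  by rewrite /h /patch indicE /=; case: (t \in D); rewrite ?mul1e ?mul0e.
apply: (etrans (@fubini_tonelli _ _ _ _ R leb2_sf mu h mh h0)).
transitivity (\int[mu]_t ((\1_D t)%:E * \int[mu \x mu]_z g z))%E.
  apply: eq_integral => t _; rewrite /h /= ge0_integralZl_EFin//.
    by rewrite integral_rotate// cos2Dsin2.
  apply: (measurableT_comp mg); exact: measurable_rotate.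
rewrite ge0_integralZr//; last 2 first.
- exact/measurable_EFinP.
- exact: integral_ge0.
congr (_ * _)%E; rewrite integral_indic// setIT.
have := lebesgue_measure_itv `[0, (pi *+ 2 : R)]%R; rewrite /= lte_fin twopi_gt0 sube0.
exact.
Qed.

Definition annulus_moment (omega : R -> R) (a b : R) (Phi : R[i] -> R) : \bar R :=
  (\int[mu \x mu]_(x in annulus a b) (Phi (cplx x) * weight0 omega (nrm2 x))%:E)%E.

(** Each [z] of the annulus is the starting point, [u = z / |z|], of the circle estimate on its own
    circle. Integrating in [z] against the weight and averaging rotations turns the circle integrals
    into one area integral; the factor [2 pi] cancels. *)
Lemma point_le_annulus_mean (omega : R -> R) (f : R[i] -> R[i]) (p : R) (b w : R[i])
    (al be del s0 c1 : R) :
  radial_weight omega ->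
  (forall z, nc z < 1 -> exists d, cdiff f z d) -> 1 < p ->
  0 < del -> nc b <= 1 - del -> 0 < s0 -> 0 < c1 ->
  nc w + c1 * del <= al -> be <= 1 -> s0 * nc (1 - b * w) <= del ->
  ((nc (f w) `^ p)%R%:E * annulus_mass omega al be <= ((2 / (s0 ^+ 2 * c1)) `^ p)%R%:E *
   annulus_moment omega al be (fun x => nc (f x) `^ p * (del / nc (1 - b * x) ^+ 2))%R)%E.
Proof.
move=> ow hf p1 del0 bdel s00 c10 wal be1 sw.
set C := (2 / _) `^ p; pose Phi (x : R[i]) := nc (f x) `^ p * (del / nc (1 - b * x) ^+ 2).
have Phi0 x : 0 <= Phi x.
  by rewrite mulr_ge0 ?powR_ge0// divr_ge0 ?exprn_ge0 ?nc_ge0// ltW.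
have al0 : 0 < al by rewrite (lt_le_trans _ wal)// ltr_wpDl ?nc_ge0// mulr_gt0.
have w0 t := weight0_ge0 t ow.
pose A : set (T * T) := annulus al be.
have mA : measurable A by exact: measurable_annulus.
have A_disc : A `<=` @disc2 R.
  by move=> x /andP[_ xb]; rewrite /disc2 /= (lt_le_trans xb).
have b1 : nc b < 1 by rewrite (le_lt_trans bdel)// gtrBl.
have mPhi : measurable_fun (@disc2 R : set (T * T)) (fun x : T * T => Phi (cplx x) : T).
  apply: measurable_funM.
    apply: (measurableT_comp (measurable_powR p)); apply: ccont_nc_measurable_leb => z z1.
    by have [d /cdiff_ccont] := hf _ z1.
  rewrite (_ : (fun x : T * T => _) = (fun x : T * T => del * nc (((1 - b * cplx x)^-1) ^+ 2))); last first.
    by apply/funext => x; rewrite ncX ncV exprVn.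
  apply: measurable_funM => //.
  apply: (@ccont_nc_measurable_leb _ (fun x => ((1 - b * x)^-1) ^+ 2)) => z z1.
  have [d Hd] := cdiff_kernel (one_minus_neq0 b1 z1).
  exact: cdiff_ccont (cdiffX 2 Hd).
have mw : measurable_fun [set: T * T] (fun x : T * T => weight0 omega (nrm2 x) : T).
  apply: (measurableT_comp (f := (weight0 omega : T -> T))).
    exact: measurable_weight0.
  exact: measurable_nrm2.
pose g0 (x : T * T) : \bar R := (Phi (cplx x) * weight0 omega (nrm2 x))%:E.
have mg0 : measurable_fun A g0.
  apply/measurable_EFinP; apply: measurable_funM; last exact: measurable_funTS.
  by apply: measurable_funS mPhi => //; exact: measurable_disc.
pose g := g0 \_ A.
have mg : measurable_fun setT g := (measurable_restrictT _ mA).1 mg0.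
have g0' x : (0 <= g x)%E.
  by rewrite /g /patch; case: ifP => // _; rewrite /g0 lee_fin; exact: mulr_ge0.
have tp0 := twopi_gt0 (R := R).
have C0 : 0 <= C by exact: powR_ge0.
have nrot (t : R) (x : T * T) : nrm2 (rotate (cos t) (sin t) x) = nrm2 x.
  change (nc (cplx (rotate (cos t) (sin t) x)) = nc (cplx x)).
  by rewrite cplx_rotate ncM nc_cis mulr1.
have arot (t : R) (x : T * T) : A x -> A (rotate (cos t) (sin t) x) by rewrite /A /annulus /= nrot.
have pt z : A z -> (((pi *+ 2) * nc (f w) `^ p)%R%:E * (weight0 omega (nrm2 z))%:E <=
   C%:E * \int[mu]_(t in `[0%R, (pi *+ 2)%R]) g (rotate (cos t) (sin t) z))%E.
  move=> Az; have /andP[az zb] := Az.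
  have r0 : 0 < nrm2 z by exact: lt_le_trans az.
  pose u : R[i] := cplx z / ((nrm2 z)%:C)%C.
  have rC : ((nrm2 z)%:C)%C != 0 :> R[i] by rewrite -nc_gt0 nc_real normr_gt0 gt_eqF.
  have u1 : nc u = 1.
    by rewrite /u ncM ncV nc_real gtr0_norm// divff// gt_eqF.
  have zE t : u * ((((nrm2 z)%:C)%C) * cis t) = cplx (rotate (cos t) (sin t) z).
    by rewrite cplx_rotate /u mulrA divfK.
  have := circle_mean_pow hf p1 u1 del0 bdel s00 c10 (le_trans wal az) (lt_le_trans zb be1) sw.
  rewrite -/C => H.
  have wz : (0 <= (weight0 omega (nrm2 z))%:E)%E by rewrite lee_fin.
  apply: (le_trans (lee_wpmul2r wz H)); rewrite -muleA lee_wpmul2l ?lee_fin//.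
  rewrite -ge0_integralZr//; last 2 first.
  - rewrite (_ : (fun t => _) = (fun t => (Phi (cplx (rotate (cos t) (sin t) z)))%:E)); last first.
      by apply/funext => t; rewrite zE.
    apply/measurable_EFinP; apply: measurable_funTS.
    apply: (measurable_comp (F := @disc2 R) _ _ mPhi) => //.
    + exact: measurable_disc.
    + by move=> _ [t _ <-]; apply: A_disc; exact: arot.
    + exact: (measurable_fun_pair2 z measurable_rotation_pair).
  - by move=> t _; rewrite zE lee_fin Phi0.
  rewrite le_eqVlt; apply/orP; left; apply/eqP; apply: eq_integral => t _.
  rewrite zE /g /patch mem_set ?nrot; last exact: arot.
  by rewrite /g0 nrot EFinM.
have : ((((pi *+ 2) * nc (f w) `^ p)%R%:E * annulus_mass omega al be <=
   C%:E * ((pi *+ 2)%R%:E * \int[mu \x mu]_z g z)))%E.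
  rewrite -integral_rotation_average// /annulus_mass.
  have mrot : measurable_fun setT (fun z : T * T =>
      (\int[mu]_(t in `[0%R, (pi *+ 2)%R]) g (rotate (cos t) (sin t) z))%E).
    pose D : set T := `[0, pi *+ 2]%classic.
    have mD : measurable D by exact: measurable_itv.
    pose h (y : (T * T) * T) : \bar R :=
      ((\1_D y.2)%:E * g (rotate (cos y.2) (sin y.2) y.1))%E.
    have h0 y : (0 <= h y)%E by rewrite mule_ge0// lee_fin.
    have mh : measurable_fun setT h.
      apply: emeasurable_funM.
        apply/measurable_EFinP; apply: (measurableT_comp (f := (\1_D : T -> R))) => //.
      exact: (measurableT_comp mg measurable_rotation_pair).
    have := @measurable_fun_fubini_tonelli_F _ _ _ _ R mu h mh h0.
    rewrite (_ : fubini_F _ _ = (fun z : T * T =>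
      (\int[mu]_(t in `[0%R, (pi *+ 2)%R]) g (rotate (cos t) (sin t) z))%E))//.
    apply/funext => z; rewrite /fubini_F [RHS]integral_mkcond; apply: eq_integral => t _.
    by rewrite /h /patch indicE /=; case: (t \in D); rewrite ?mul1e ?mul0e.
  have int0 z : (0 <= \int[mu]_(t in `[0%R, (pi *+ 2)%R]) g (rotate (cos t) (sin t) z))%E.
    by apply: integral_ge0 => t _.
  rewrite -ge0_integralZl_EFin//; last 3 first.
  - by move=> x _; rewrite lee_fin.
  - by apply/measurable_EFinP; exact: measurable_funTS.
  - by rewrite mulr_ge0 ?powR_ge0// ltW.
  rewrite -ge0_integralZl_EFin//.
  apply: (@le_trans _ _ (\int[mu \x mu]_(z in A) (C%:E *
     \int[mu]_(t in `[0%R, (pi *+ 2)%R]) g (rotate (cos t) (sin t) z)))%E).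
    apply: ge0_le_integral => //.
    - by move=> z _; rewrite -EFinM lee_fin mulr_ge0// mulr_ge0 ?powR_ge0// ltW.
    - by apply: measurable_funeM; apply/measurable_EFinP; exact: measurable_funTS.
    - by apply: measurable_funeM; exact: measurable_funTS.
  apply: ge0_subset_integral => //.
  - by apply: measurable_funeM.
  - by move=> z _; rewrite mule_ge0 ?lee_fin.
rewrite EFinM muleCA -muleA lee_pmul2l ?lte_fin//.
by rewrite /annulus_moment [in X in _ -> X]integral_mkcond.
Qed.

End AnnulusMeans.

(** Sum the tangent inequality at [l = V / S]. An upper bound on the total weight is enough, since
    that total enters with the sign of [-(p - 1) l^p]. *)
Lemma weighted_powR_jensen {R : realType} (I : Type) (s : seq I) (W v : I -> R) (p S : R) :
  1 < p -> 0 < S -> (forall i, 0 <= W i) -> (forall i, 0 <= v i) -> \sum_(i <- s) W i <= S ->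
  (\sum_(i <- s) W i * v i) `^ p <= S `^ (p - 1) * \sum_(i <- s) W i * v i `^ p.
Proof.
move=> p1 S0 W0 v0 WS; have p0 : 0 < p by exact: lt_trans p1.
set V := \sum_(i <- s) W i * v i.
have V0 : 0 <= V by apply: sumr_ge0 => i _; rewrite mulr_ge0.
have [->|Vn0] := eqVneq V 0.
  rewrite powR0 ?gt_eqF// mulr_ge0 ?powR_ge0//.
  by apply: sumr_ge0 => i _; rewrite mulr_ge0 ?powR_ge0.
have V1 : 0 < V by rewrite lt_def Vn0.
pose l := V / S.
have l0 : 0 < l by rewrite divr_gt0.
have H : \sum_(i <- s) (W i * (p * l `^ (p - 1) * v i - (p - 1) * l `^ p)) <=
   \sum_(i <- s) W i * v i `^ p.
  apply: ler_sum => i _; rewrite ler_wpM2l// lerBlDr.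
  exact: powR_tangent.
have E : \sum_(i <- s) (W i * (p * l `^ (p - 1) * v i - (p - 1) * l `^ p)) =
   p * l `^ (p - 1) * V - (p - 1) * l `^ p * \sum_(i <- s) W i.
  rewrite /V !mulr_sumr -sumrB; apply: eq_bigr => i _; ring.
have lp : l `^ p = l `^ (p - 1) * l.
  have := @powRD R l (p - 1) 1; rewrite subrK powRr1 ?(ltW l0)//; apply.
  by apply/implyP => _; apply: lt0r_neq0.
have VE : V = S * l by rewrite /l mulrCA divff ?mulr1 ?gt_eqF.
have Sp : S `^ p = S `^ (p - 1) * S.
  have := @powRD R S (p - 1) 1; rewrite subrK powRr1 ?(ltW S0)//; apply.
  by apply/implyP => _; apply: lt0r_neq0.
rewrite {1}VE powRM ?(ltW S0) ?(ltW l0)// Sp -mulrA ler_wpM2l ?powR_ge0//.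
apply: le_trans H; rewrite E {1}VE.
have q0 : 0 <= (p - 1) * l `^ p by rewrite mulr_ge0 ?powR_ge0// subr_ge0 ltW.
have := ler_wpM2l q0 WS; rewrite lp; lra.
Qed.

(** * The lattice and its kernels *)

Section Lattice.
Context {R : realType}.
Variable K : R.
Hypothesis K1 : 1 < K.
Implicit Types (n j : nat) (x w : R[i]).

(** The distance to the unit circle both of the lattice points of level [n] and of the outer edge of
    layer [n]. *)
Definition mesh n : R := K^-1 ^+ n.+1.
Definition mesh_count n : nat := (Num.truncn (mesh n)^-1).+1.
(** The conjugate of the lattice point [a], the form in which it occurs in [1 - conj(a) x]; this is
    why the roots of unity are inverted. *)
Definition lattice_conj n j : R[i] :=
  ((1 - mesh n)%:C)%C * (cis (root_angle (mesh_count n) 1))^-1 ^+ j.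
Definition kernel n j x : R := mesh n / nc (1 - lattice_conj n j * x).

Let K0 : 0 < K. Proof. exact: lt_trans K1. Qed.
Let Ki0 : 0 < K^-1. Proof. by rewrite invr_gt0. Qed.
Let Ki1 : K^-1 < 1. Proof. by rewrite invf_lt1. Qed.

Lemma mesh_gt0 n : 0 < mesh n.
Proof. by rewrite exprn_gt0. Qed.

Lemma mesh_lt1 n : mesh n < 1.
Proof. by rewrite exprn_ilt1// ltW. Qed.

Lemma mesh_layer_pred n : 1 - layer_radius K n = K * mesh n.
Proof. by rewrite /layer_radius subKr /mesh exprS mulVKf ?gt_eqF. Qed.

Lemma mesh_layer_succ n :
  layer_radius K n.+2 = layer_radius K n.+1 + (1 - K^-1) * mesh n.
Proof. by rewrite /layer_radius /mesh [K^-1 ^+ n.+2]exprS; ring. Qed.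

Lemma mesh_count_gt0 n : (0 < mesh_count n)%N. Proof. by []. Qed.

Lemma mesh_count_bounds n : 1 <= (mesh_count n)%:R * mesh n <= 2.
Proof.
have m0 := mesh_gt0 n; have mi : 1 <= (mesh n)^-1.
  by rewrite invf_ge1// ltW// mesh_lt1.
have /truncn_itv : 0 <= (mesh n)^-1 by rewrite (le_trans _ mi).
rewrite -/(mesh_count n) => /andP[h1 h2]; apply/andP; split.
  by rewrite -ler_pdivrMr// div1r ltW.
rewrite -ler_pdivlMr// /mesh_count -natr1; lra.
Qed.

(** Bernoulli gives [(1 + mesh)^N >= 1 + N mesh >= 2], while [(1 - mesh) (1 + mesh) <= 1]. *)
Lemma rho_pow_count n : (1 - mesh n) ^+ mesh_count n <= 2^-1.
Proof.
have m0 := mesh_gt0 n; have m1 := mesh_lt1 n; have /andP[c1 c2] := mesh_count_bounds n.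
have B : forall k, 1 + k%:R * mesh n <= (1 + mesh n) ^+ k.
  elim=> [|k IH]; first by rewrite mul0r addr0.
  rewrite exprS; apply: (@le_trans _ _ ((1 + mesh n) * (1 + k%:R * mesh n))).
    have -> : (1 + mesh n) * (1 + k%:R * mesh n) =
       (1 + k.+1%:R * mesh n) + k%:R * (mesh n * mesh n) by rewrite -natr1; ring.
    by rewrite lerDl !mulr_ge0// ltW.
  by rewrite ler_pM2l// addr_gt0.
have H : ((1 - mesh n) * (1 + mesh n)) ^+ mesh_count n <= 1.
  rewrite exprn_ile1//; first by rewrite mulr_ge0 ?subr_ge0 ?ltW// addr_gt0.
  have -> : (1 - mesh n) * (1 + mesh n) = 1 - mesh n ^+ 2 by ring.
  by rewrite gerBl sqr_ge0.
rewrite -[leRHS]mul1r ler_pdivlMr//; apply: le_trans H.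
rewrite exprMn ler_wpM2l ?exprn_ge0 ?subr_ge0 ?(ltW m1)//.
by apply: (le_trans _ (B _)); move: c1; lra.
Qed.

Let prim n := @cis_root_primitive R (mesh_count n) (mesh_count_gt0 n).

Lemma nc_lattice n j : nc (lattice_conj n j) = 1 - mesh n.
Proof.
have [z1 _ _] := prim n.
rewrite /lattice_conj ncM ncX z1 expr1n mulr1 nc_real ger0_norm//.
by rewrite subr_ge0 ltW// mesh_lt1.
Qed.

Lemma nc_lattice_lt1 n j : nc (lattice_conj n j) < 1.
Proof. by rewrite nc_lattice gtrBl mesh_gt0. Qed.

Lemma kernel_ge0 n j x : 0 <= kernel n j x.
Proof. by rewrite divr_ge0 ?nc_ge0// ltW// mesh_gt0. Qed.

Lemma kernel_denominator_ge n j x : nc x <= 1 -> mesh n <= nc (1 - lattice_conj n j * x).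
Proof.
move=> x1; have := nc_dist_ge 1 (lattice_conj n j * x); rewrite nc1 ncM nc_lattice.
apply: le_trans; rewrite lerBrDl -lerBrDr ler_piMr//.
by rewrite subr_ge0 ltW// mesh_lt1.
Qed.

Lemma kernel_le1 n j x : nc x <= 1 -> kernel n j x <= 1.
Proof.
move=> x1; have d := kernel_denominator_ge n j x1.
by rewrite ler_pdivrMr ?mul1r// (lt_le_trans (mesh_gt0 n)).
Qed.

Lemma kernel_le_dist n j x : nc x < 1 -> kernel n j x <= mesh n / (1 - nc x).
Proof.
move=> x1; rewrite ler_pM2l ?mesh_gt0// lef_pV2 ?posrE ?subr_gt0//.
  have := nc_dist_ge 1 (lattice_conj n j * x); rewrite nc1 ncM; apply: le_trans.
  by rewrite lerD2l lerN2 ler_piMl ?nc_ge0// ltW// nc_lattice_lt1.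
exact: lt_le_trans (mesh_gt0 n) (kernel_denominator_ge n j (ltW x1)).
Qed.

(** The Parseval bound reads [(N mesh)^2 / (1 - |y|^N)^2] with [N mesh <= 2] and [|y|^N <= 1/2],
    whence [(2 / (1/2))^2 = 16]. *)
Lemma sum_kernel2_le n x : nc x < 1 ->
  \sum_(j < mesh_count n) kernel n j x ^+ 2 <= 16.
Proof.
move=> x1; have [z1 zN zl] := prim n.
have m0 := mesh_gt0 n; have m1 := mesh_lt1 n; have /andP[c1 c2] := mesh_count_bounds n.
pose y : R[i] := ((1 - mesh n)%:C)%C * x.
have ny : nc y = (1 - mesh n) * nc x.
  by rewrite ncM nc_real ger0_norm// subr_ge0 ltW.
have yr : nc y <= 1 - mesh n.
  by rewrite ny ler_piMr ?(ltW x1)// subr_ge0 ltW.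
have y1 : nc y < 1 by rewrite (le_lt_trans yr)// gtrBl.
have := sum_inv_kernel_unity z1 zN zl (mesh_count_gt0 n) y1.
set Z := (cis _)^-1; move=> H.
have -> : \sum_(j < mesh_count n) kernel n j x ^+ 2 =
    mesh n ^+ 2 * \sum_(j < mesh_count n) nc (1 - Z ^+ j * y) ^- 2.
  rewrite mulr_sumr; apply: eq_bigr => j _; rewrite /kernel expr_div_n /lattice_conj -/Z.
  by rewrite /y mulrA [Z ^+ j * _]mulrC.
apply: (@le_trans _ _ (mesh n ^+ 2 * ((mesh_count n)%:R ^+ 2 / (1 - nc y ^+ mesh_count n) ^+ 2))).
  by rewrite ler_pM2l ?exprn_gt0.
have yN : 2^-1 <= 1 - nc y ^+ mesh_count n.
  have : nc y ^+ mesh_count n <= 2^-1.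
    apply: le_trans (rho_pow_count n); rewrite lerXn2r ?nnegrE ?nc_ge0//.
    by rewrite subr_ge0 ltW.
  lra.
have d0 : 0 < 1 - nc y ^+ mesh_count n by rewrite (lt_le_trans _ yN).
rewrite mulrA -exprMn -expr_div_n.
have -> : 16 = 4 ^+ 2 :> R by rewrite -natrX.
rewrite lerXn2r ?nnegrE ?divr_ge0 ?mulr_ge0 ?(ltW m0) ?(ltW d0)//.
rewrite ler_pdivrMr// mulrC; move: c2 yN; lra.
Qed.

(** The constant adds a radial error, [1 - (1 - mesh) |w| <= (1 + K) mesh], and an angular one,
    [4 pi / N <= 4 pi mesh]. *)
Lemma lattice_cover w : nc w < 1 -> exists n j, [/\ (j < mesh_count n)%N,
  layer_radius K n <= nc w, nc w < layer_radius K n.+1 & nc (1 - lattice_conj n j * w) <= (1 + K + 4 * pi) * mesh n].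
Proof.
move=> w1.
have [n [n1 n2]] : exists n, layer_radius K n <= nc w /\ nc w < layer_radius K n.+1.
  have ex : exists n, nc w < layer_radius K n.+1.
    have d0 : 0 < 1 - nc w by rewrite subr_gt0.
    have [n Hn] : exists n, K^-1 ^+ n.+1 < 1 - nc w.
      have := @cvg_expr R K^-1; rewrite gtr0_norm// => /(_ Ki1)/cvgrPdist_lt/(_ _ d0)[n _ Hn].
      exists n; have := Hn n.+1 (leqnSn n); rewrite sub0r normrN gtr0_norm ?exprn_gt0//.
    by exists n; rewrite /layer_radius ltrBrDl -ltrBrDr.
  case: (ex_minnP ex) => n Hn min; exists n; split => //.
  case: n Hn min => [|n] Hn min; first by rewrite /layer_radius expr0 subrr nc_ge0.
  by rewrite leNgt; apply/negP => /min; rewrite ltnn.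
have m0 := mesh_gt0 n; have m1 := mesh_lt1 n; have /andP[c1 c2] := mesh_count_bounds n.
have dw : 1 - nc w <= K * mesh n by rewrite -mesh_layer_pred lerD2l lerN2.
pose u : R[i] := if w == 0 then 1 else w / ((nc w)%:C)%C.
have wu : w = ((nc w)%:C)%C * u.
  rewrite /u; case: eqP => [->|/eqP w0]; first by rewrite nc0 mul0r.
  by rewrite mulrC divfK// -nc_gt0 nc_real normr_gt0 nc_eq0.
have u1 : nc u = 1.
  rewrite /u; case: eqP => [_|/eqP w0]; first exact: nc1.
  by rewrite ncM ncV nc_real ger0_norm ?nc_ge0// divff// nc_eq0.
have [j jN Hj] := unit_near_root (mesh_count_gt0 n) u1.
exists n, j; split => //.
pose c : R[i] := cis (root_angle (mesh_count n) j).
have cn : nc c = 1 by exact: nc_cis.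
have c0 : c != 0 by rewrite -nc_gt0 cn.
have E : lattice_conj n j = ((1 - mesh n)%:C)%C / c.
  by rewrite /lattice_conj exprVn -cis_root_angle.
pose s := (1 - mesh n) * nc w.
have s0 : 0 <= s by rewrite mulr_ge0 ?nc_ge0// subr_ge0 ltW.
have s1 : s <= 1 by rewrite mulr_ile1 ?nc_ge0 ?subr_ge0 ?(ltW m1) ?gerBl ?(ltW m0) ?(ltW w1).
have E2 : 1 - lattice_conj n j * w = ((1 - s)%:C)%C - ((s%:C)%C / c) * (u - c).
  by rewrite E {1}wu /s !rmorphB !rmorphM rmorphB rmorph1 /=; field.
rewrite E2 (le_trans (ncB _ _))// nc_real ger0_norm ?subr_ge0// !ncM ncV cn invr1 mulr1.
rewrite nc_real ger0_norm// mulrDl lerD//.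
  by rewrite /s; have := nc_ge0 w; nra.
apply: (@le_trans _ _ (1 * (4 * pi / (mesh_count n)%:R))).
  by rewrite ler_pM ?nc_ge0.
rewrite mul1r ler_pM2l ?mulr_gt0 ?pi_gt0//.
by rewrite -[leLHS]mul1r ler_pdivrMr ?ltr0n// mulrC.
Qed.

End Lattice.

(** * Weighted moments over an annulus *)

Section Moments.
Context {R : realType}.
Local Notation mu := (@lebesgue_measure R).
Local Notation T := (measurableTypeR R).
Implicit Types (Phi Psi : R[i] -> R).

Definition disc_measurable Phi :=
  measurable_fun (@disc2 R : set (T * T)) (fun x : T * T => Phi (cplx x) : T).

Lemma disc_measurable_cst (c : R) : disc_measurable (fun _ => c).
Proof. exact: measurable_cst. Qed.

Lemma disc_measurableM Phi Psi : disc_measurable Phi -> disc_measurable Psi ->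
  disc_measurable (fun x => Phi x * Psi x).
Proof. exact: measurable_funM. Qed.

Lemma disc_measurable_sum (I : Type) (s : seq I) (Phi : I -> R[i] -> R) :
  (forall i, disc_measurable (Phi i)) -> disc_measurable (fun x => \sum_(i <- s) Phi i x).
Proof. by move=> H; apply: measurable_sum. Qed.

Lemma disc_measurable_powR Phi p : disc_measurable Phi -> disc_measurable (fun x => Phi x `^ p).
Proof. by move=> H; exact: (measurableT_comp (measurable_powR p) H). Qed.

Lemma disc_measurableX Phi n : disc_measurable Phi -> disc_measurable (fun x => Phi x ^+ n).
Proof. by move=> H; apply: measurable_funX. Qed.

Lemma disc_measurable_nc (f : R[i] -> R[i]) : (forall z, nc z < 1 -> ccont f z) ->
  disc_measurable (fun x => nc (f x)).
Proof. exact: ccont_nc_measurable_leb. Qed.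

Variable omega : R -> R.
Hypothesis ow : radial_weight omega.

Variables a b : R.
Hypothesis b1 : b <= 1.

Lemma annulus_sub_disc : annulus a b `<=` (@disc2 R : set (T * T)).
Proof. by move=> x /andP[_ xb]; rewrite /disc2 /= (lt_le_trans xb). Qed.

Let mA := @measurable_annulus R a b.

Lemma measurable_moment_integrand (A : set (T * T)) Phi : measurable A ->
  A `<=` (@disc2 R : set (T * T)) -> disc_measurable Phi ->
  measurable_fun A (fun x : T * T => (Phi (cplx x) * weight0 omega (nrm2 x))%:E).
Proof.
move=> mB AD mPhi; apply/measurable_EFinP; apply: measurable_funM.
  by apply: measurable_funS mPhi => //; exact: measurable_disc.
apply: measurable_funTS; apply: (measurableT_comp (f := (weight0 omega : T -> T))).
  exact: measurable_weight0.
exact: measurable_nrm2.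
Qed.

Let mint Phi (H : disc_measurable Phi) := measurable_moment_integrand mA annulus_sub_disc H.

Lemma moment_ge0 Phi : (forall x, nc x < 1 -> 0 <= Phi x) -> (0 <= annulus_moment omega a b Phi)%E.
Proof.
move=> P0; apply: integral_ge0 => x Ax; rewrite lee_fin mulr_ge0 ?weight0_ge0// P0//.
exact: annulus_sub_disc.
Qed.

Lemma moment_le Phi Psi : disc_measurable Phi -> disc_measurable Psi ->
  (forall x, 0 <= Phi x) ->
  (forall x, a <= nc x < b -> Phi x <= Psi x) ->
  (annulus_moment omega a b Phi <= annulus_moment omega a b Psi)%E.
Proof.
move=> mP mQ P0 PQ; apply: ge0_le_integral => //.
- by move=> x _; rewrite lee_fin mulr_ge0 ?weight0_ge0.
- exact: (mint mP).
- exact: (mint mQ).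
- by move=> x Ax; rewrite lee_fin ler_wpM2r ?weight0_ge0// PQ.
Qed.

Lemma momentZ Phi (c : R) : disc_measurable Phi -> (forall x, 0 <= Phi x) -> 0 <= c ->
  annulus_moment omega a b (fun x => c * Phi x) = (c%:E * annulus_moment omega a b Phi)%E.
Proof.
move=> mP P0 c0; rewrite /annulus_moment -ge0_integralZl_EFin//; last 2 first.
- by move=> x _; rewrite lee_fin mulr_ge0 ?weight0_ge0.
- exact: (mint mP).
by apply: eq_integral => x _; rewrite -EFinM mulrA.
Qed.

Lemma moment_sum (I : Type) (s : seq I) (Phi : I -> R[i] -> R) :
  (forall i, disc_measurable (Phi i)) -> (forall i x, 0 <= Phi i x) ->
  annulus_moment omega a b (fun x => \sum_(i <- s) Phi i x) =
  (\sum_(i <- s) annulus_moment omega a b (Phi i))%E.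
Proof.
move=> mP P0; rewrite /annulus_moment -ge0_integral_sum//; last 2 first.
- by move=> i; exact: (mint (mP i)).
- by move=> i x _; rewrite lee_fin mulr_ge0 ?weight0_ge0.
by apply: eq_integral => x _; rewrite sumEFin mulr_suml.
Qed.

Lemma moment_cst (c : R) : 0 <= c ->
  annulus_moment omega a b (fun _ => c) = (c%:E * annulus_mass omega a b)%E.
Proof.
move=> c0; rewrite /annulus_moment /annulus_mass -ge0_integralZl_EFin//; last 2 first.
- by move=> x _; rewrite lee_fin weight0_ge0.
- have := mint (disc_measurable_cst 1); rewrite (_ : (fun x => _) = (fun x => (weight0 omega (nrm2 x))%:E))//.
  by apply/funext => x; rewrite mul1r.
Qed.

Lemma moment_rotate Phi (u : R[i]) : nc u = 1 -> disc_measurable Phi -> (forall x, 0 <= Phi x) ->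
  annulus_moment omega a b (fun x => Phi (u * x)) = annulus_moment omega a b Phi.
Proof.
move=> u1 mP P0.
pose g0 (x : T * T) : \bar R := (Phi (cplx x) * weight0 omega (nrm2 x))%:E.
have mg : measurable_fun setT (g0 \_ (annulus a b)) := (measurable_restrictT _ mA).1 (mint mP).
have uu : complex.Re u ^+ 2 + complex.Im u ^+ 2 = 1 by rewrite -nc_sqr u1 expr1n.
have rE (x : T * T) : cplx (rotate (complex.Re u) (complex.Im u) x) = u * cplx x.
  by case: (u) => a' b'; apply/eqP; rewrite eq_complex ReM ImM /= eqxx [_ + b' * _]addrC eqxx.
have nE (x : T * T) : nrm2 (rotate (complex.Re u) (complex.Im u) x) = nrm2 x.
  change (nc (cplx (rotate (complex.Re u) (complex.Im u) x)) = nc (cplx x)).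
  by rewrite rE ncM u1 mul1r.
rewrite /annulus_moment [RHS]integral_mkcond -(integral_rotate uu mg); last first.
  by move=> x; rewrite /patch; case: ifP => // _; rewrite lee_fin mulr_ge0 ?weight0_ge0.
rewrite integral_mkcond; apply: eq_integral => x _; rewrite /patch.
have -> : (rotate (complex.Re u) (complex.Im u) x \in annulus a b) = (x \in annulus a b).
  by apply/idP/idP; rewrite !inE /annulus /= nE.
by case: ifP => // _; rewrite /g0 rE nE.
Qed.

End Moments.

(** * Atomic synthesis *)

Section Sampling.
Context {R : realType}.
Variables (K p : R) (omega : R -> R).
Hypotheses (K1 : 1 < K) (p1 : 1 < p) (ow : radial_weight omega).
Local Notation r := (layer_radius K).
Local Notation W := (layer_mass omega K).
Local Notation layer_moment m := (annulus_moment omega (r m) (r m.+1)).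
Hypothesis Wfin : forall m, annulus_mass omega (r m) (r m.+1) \is a fin_num.
Hypothesis W_gt0 : forall n, (0 < n)%N -> 0 < W n.

Let p0 : 0 < p. Proof. exact: lt_trans p1. Qed.
Let r_lt1 m : r m <= 1. Proof. by rewrite ltW// layer_radius_lt1. Qed.

Lemma kernel_measurable n j : disc_measurable (fun x => kernel K n j x).
Proof.
apply: disc_measurableM; first exact: disc_measurable_cst.
rewrite (_ : (fun x => _) = (fun x => nc ((1 - lattice_conj K n j * x)^-1))); last first.
  by apply/funext => x; rewrite ncV.
apply: disc_measurable_nc => z z1.
have [d Hd] := cdiff_kernel (one_minus_neq0 (nc_lattice_lt1 K1 n j) z1).
exact: cdiff_ccont Hd.
Qed.

Lemma powR_le_root (x e : R) : 0 <= x -> x `^ p <= e -> x <= e `^ p^-1.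
Proof.
move=> x0 xe; have -> : x = (x `^ p) `^ p^-1 by rewrite -powRrM divff ?gt_eqF// powRr1.
by apply: ge0_ler_powR; rewrite ?nnegrE ?invr_ge0 ?(ltW p0)// ?powR_ge0// (le_trans _ xe)// powR_ge0.
Qed.

Lemma kernelE n j (x : R[i]) : mesh K n / nc (1 - lattice_conj K n j * x) ^+ 2 =
  (mesh K n)^-1 * kernel K n j x ^+ 2.
Proof.
have m0 := mesh_gt0 K1 n.
by rewrite /kernel expr_div_n [mesh K n ^+ 2]expr2 !mulrA mulVf ?gt_eqF// mul1r.
Qed.

(** Up to constants [c n j] is the [p]-mean of [f] over layer [n + 2] against the squared kernel of
    the point. Layer [n + 1] is left free: half of its width holds a disc about [w] for Cauchy's
    estimate, the other half is the distance to the averaging layer. Summing over [j] uses that the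
    squared kernels have a bounded sum. *)
Lemma lattice_samples : exists2 C : R, 0 < C & forall f : R[i] -> R[i],
  (forall z, nc z < 1 -> exists d, cdiff f z d) ->
  (forall m, layer_moment m (fun x => nc (f x) `^ p) \is a fin_num) ->
  exists c : nat -> nat -> R, [/\ forall n j, 0 <= c n j,
    forall n, mesh K n * (\sum_(j < mesh_count K n) c n j `^ p) * W n.+2 <=
       C * fine (layer_moment n.+2 (fun x => nc (f x) `^ p)) &
    forall n j w, nc w < r n.+1 -> nc (1 - lattice_conj K n j * w) <= (1 + K + 4 * pi) * mesh K n ->
      nc (f w) <= c n j /\ forall d, cdiff f w d -> nc d * mesh K n <= c n j].
Proof.
have K0 : 0 < K by exact: lt_trans K1.
have Ki1 : K^-1 < 1 by rewrite invf_lt1.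
have Ki0 : 0 < K^-1 by rewrite invr_gt0.
have pi0 : 0 < pi :> R by exact: pi_gt0.
(* Half of the width of layer [n + 1], in units of [mesh K n]. *)
pose c1 : R := (1 - K^-1) / 2.
have c10 : 0 < c1 by rewrite /c1 divr_gt0 ?subr_gt0.
have c11 : c1 <= 1 by rewrite /c1; lra.
have c1E : (1 - K^-1) = c1 + c1 by rewrite /c1; lra.
(* One unit more than [1 + K + 4 pi]: it pays for replacing [w] by a point at distance less than
   [mesh]. *)
have [s0 [s00 s0E]] : exists s0 : R, 0 < s0 /\ s0 * (2 + K + 4 * pi) = 1.
  have h : 0 < 2 + K + 4 * pi by rewrite !addr_gt0// mulr_gt0.
  by exists (2 + K + 4 * pi)^-1; rewrite invr_gt0 mulVf ?gt_eqF.
pose Ce := (2 / (s0 ^+ 2 * c1)) `^ p.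
have Ce0 : 0 < Ce by rewrite powR_gt0 // divr_gt0// mulr_gt0// exprn_gt0.
have h4 : 0 < 4 / c1 by rewrite divr_gt0.
have h41 : 1 <= 4 / c1 by rewrite ler_pdivlMr// mul1r (le_trans c11)// ler1n.
(* [4 / c1] is the loss in Cauchy's estimate on radius [c1 mesh], [Ce] that of the mean over the
   annulus, and 16 bounds the sum of the squared kernels. *)
exists ((4 / c1) `^ p * (Ce * 16)); first by rewrite !mulr_gt0// powR_gt0.
move=> f hf Ef.
have fm : disc_measurable (fun x => nc (f x) `^ p).
  apply: disc_measurable_powR; apply: disc_measurable_nc => z z1.
  by have [d /cdiff_ccont] := hf _ z1.
have fp0 x : 0 <= nc (f x) `^ p by exact: powR_ge0.
pose Phi n j x := nc (f x) `^ p * ((mesh K n)^-1 * kernel K n j x ^+ 2).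
have Phi0 n j x : 0 <= Phi n j x.
  by rewrite mulr_ge0// mulr_ge0 ?exprn_ge0 ?kernel_ge0// invr_ge0 ltW// mesh_gt0.
have Phim n j : disc_measurable (Phi n j).
  apply: disc_measurableM => //; apply: disc_measurableM; first exact: disc_measurable_cst.
  by apply: disc_measurableX; exact: kernel_measurable.
pose mom n j := layer_moment n.+2 (Phi n j).
have mom0 n j : (0 <= mom n j)%E by apply: moment_ge0.
have momfin n j : mom n j \is a fin_num.
  have ub : (mom n j <= (mesh K n)^-1%:E * layer_moment n.+2 (fun x => (nc (f x) `^ p)%R))%E.
    rewrite -momentZ//; last by rewrite invr_ge0 ltW// mesh_gt0.
    apply: moment_le => //; first by apply: disc_measurableM => //; exact: disc_measurable_cst.
    move=> x /andP[_ xr]; rewrite /Phi mulrCA ler_wpM2l ?invr_ge0 ?(ltW (mesh_gt0 K1 n))//.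
    rewrite ler_piMr// exprn_ile1 ?kernel_ge0//.
    by apply: kernel_le1 => //; rewrite ltW// (lt_le_trans xr).
  by rewrite ge0_fin_numE// (le_lt_trans ub)// -(fineK (Ef n.+2)) -EFinM ltry.
pose e n j := Ce * fine (mom n j) / W n.+2.
have e0 n j : 0 <= e n j by rewrite /e divr_ge0 ?(ltW (W_gt0 _))// mulr_ge0 ?(ltW Ce0)// fine_ge0.
have big n j w : nc w + c1 * mesh K n <= r n.+2 ->
    s0 * nc (1 - lattice_conj K n j * w) <= mesh K n -> nc (f w) <= e n j `^ p^-1.
  move=> wr ws; apply: powR_le_root; first exact: nc_ge0.
  have blat : nc (lattice_conj K n j) <= 1 - mesh K n by rewrite nc_lattice.
  have := point_le_annulus_mean ow hf p1 (mesh_gt0 K1 n) blat s00 c10 wr (r_lt1 n.+3) ws.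
  have -> : (fun x => nc (f x) `^ p * (mesh K n / nc (1 - lattice_conj K n j * x) ^+ 2)) = Phi n j.
    by apply/funext => x; rewrite kernelE.
  rewrite -/(mom n j) -(fineK (Wfin n.+2)) -(fineK (momfin n j)) -!EFinM lee_fin -/(W n.+2).
  by rewrite -/Ce ler_pdivlMr//; exact: W_gt0.
exists (fun n j => 4 / c1 * e n j `^ p^-1); split.
- by move=> n j; rewrite mulr_ge0 ?powR_ge0 ?(ltW h4).
- move=> n; have W0 := W_gt0 (ltn0Sn n.+1); have m0 := mesh_gt0 K1 n.
  have -> : \sum_(j < mesh_count K n) (4 / c1 * e n j `^ p^-1) `^ p =
      (4 / c1) `^ p * (Ce * (\sum_(j < mesh_count K n) fine (mom n j)) / W n.+2).
    rewrite mulr_sumr mulr_suml mulr_sumr; apply: eq_bigr => j _.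
    by rewrite powRM ?powR_ge0 ?(ltW h4)// -powRrM mulVf ?gt_eqF// powRr1.
  rewrite -!mulrA [mesh K n * _]mulrCA ler_pM2l ?powR_gt0// mulrCA ler_pM2l//.
  rewrite mulVf ?gt_eqF// mulr1.
  have -> : \sum_(j < mesh_count K n) fine (mom n j) =
      fine (layer_moment n.+2 (fun x => \sum_(j < mesh_count K n) Phi n j x)).
    by rewrite moment_sum// sum_fine.
  rewrite -lee_fin EFinM EFinM fineK; last first.
    rewrite moment_sum//; by apply/sum_fin_numP => j _ _; exact: momfin.
  rewrite fineK// -momentZ//; last 3 first.
  + by apply: disc_measurable_sum => j; exact: Phim.
  + by move=> x; apply: sumr_ge0.
  + exact: ltW.
  rewrite -momentZ//; apply: moment_le => //.
  + apply: disc_measurableM; first exact: disc_measurable_cst.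
    by apply: disc_measurable_sum => j; exact: Phim.
  + by apply: disc_measurableM => //; exact: disc_measurable_cst.
  + by move=> x; rewrite mulr_ge0 ?(ltW m0)//; apply: sumr_ge0.
  move=> x /andP[_ xr]; rewrite /Phi -mulr_sumr -mulr_sumr mulrCA mulVKf ?gt_eqF//.
  rewrite [16 * _]mulrC ler_wpM2l//; apply: sum_kernel2_le => //.
  exact: lt_le_trans xr _.
- move=> n j w wr wk; have m0 := mesh_gt0 K1 n.
  have rE : r n.+2 = r n.+1 + (c1 + c1) * mesh K n by rewrite mesh_layer_succ c1E.
  have disc x : nc (x - w) < c1 * mesh K n -> nc (f x) <= e n j `^ p^-1 /\ nc x < 1.
    move=> xw.
    have xw' : nc x <= nc w + c1 * mesh K n.
      have := ncD (x - w) w; rewrite subrK => /le_trans; apply.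
      by rewrite addrC lerD2l ltW.
    have xr : nc x + c1 * mesh K n <= r n.+2.
      by rewrite rE mulrDl addrA lerD2r (le_trans xw')// lerD2r ltW.
    split; last first.
      rewrite (lt_le_trans _ (r_lt1 n.+2))// (lt_le_trans _ xr)//.
      by rewrite ltrDl mulr_gt0.
    apply: big => //.
    have -> : 1 - lattice_conj K n j * x =
       (1 - lattice_conj K n j * w) - lattice_conj K n j * (x - w) by ring.
    apply: (@le_trans _ _ (s0 * ((2 + K + 4 * pi) * mesh K n))); last by rewrite mulrA s0E mul1r.
    rewrite ler_pM2l// (le_trans (ncB _ _))//.
    have -> : 2 + K + 4 * pi = (1 + K + 4 * pi) + 1 by ring.
    rewrite mulrDl lerD// mul1r ncM.
    have := ltW (nc_lattice_lt1 K1 n j) => l1.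
    apply: (@le_trans _ _ (1 * (1 * mesh K n))); last by rewrite !mul1r.
    rewrite ler_pM ?nc_ge0// (le_trans (ltW xw))// ler_pM2r//.
  have cm0 : 0 < c1 * mesh K n by rewrite mulr_gt0.
  have er0 := powR_ge0 (e n j) p^-1.
  split.
    have [] := disc w; first by rewrite subrr nc0.
    move=> h _; apply: (le_trans h); exact: ler_peMl.
  move=> d dw.
  have H : nc d <= 4 * e n j `^ p^-1 / (c1 * mesh K n).
    apply: (@derivative_le_of_bounded _ f w d) => //.
      by move=> x /disc[_ x1]; exact: hf.
    by move=> x /disc[].
  rewrite -ler_pdivlMr//; apply: (le_trans H).
  by rewrite invfM le_eqVlt; apply/orP; left; apply/eqP; ring.
Qed.

End Sampling.

(** * Kernels and masses across layers *)

Section Synthesis.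
Context {R : realType}.

(** The exponent is [|m - n|] in truncated subtraction. Multiplication by [1 - eta] telescopes; the
    intermediate bound [H] keeps the boundary terms in order to be inductive in [L]. *)
Lemma sum_geometric_dist (eta : R) (L m : nat) : 0 <= eta -> eta < 1 ->
  \sum_(n < L) eta ^+ ((m - n) + (n - m)) <= 2 / (1 - eta).
Proof.
move=> e0 e1; rewrite ler_pdivlMr ?subr_gt0//.
have H : (\sum_(n < L) eta ^+ ((m - n) + (n - m))) * (1 - eta) <=
   eta ^+ (m.+1 - L) + 1 - eta ^+ (L - m).
  elim: L => [|L IH].
    by rewrite big_ord0 mul0r sub0n expr0 addrK exprn_ge0.
  rewrite big_ord_recr /= mulrDl; have [Lm|mL] := leqP L m.
    have E1 : (L - m = 0)%N by apply/eqP; rewrite subn_eq0.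
    rewrite E1 addn0 subSS (le_trans (lerD IH (lexx _)))// E1 expr0 addrK subSn// exprS.
    have : eta ^+ (L.+1 - m) <= 1 by rewrite exprn_ile1// ltW.
    by lra.
  have E1 : (m - L = 0)%N by apply/eqP; rewrite subn_eq0 ltnW.
  have E2 : (m.+1 - L = 0)%N by apply/eqP; rewrite subn_eq0.
  rewrite E1 add0n (le_trans (lerD IH (lexx _)))// E2 subSS E1 expr0 subSn ?exprS; last exact: ltnW.
  by rewrite le_eqVlt; apply/orP; left; apply/eqP; ring.
apply: (le_trans H).
have h1 : eta ^+ (m.+1 - L) <= 1 by rewrite exprn_ile1// ltW.
have h2 : 0 <= eta ^+ (L - m) by rewrite exprn_ge0.
by move: h1 h2; lra.
Qed.

Lemma exprn_powR (x p : R) k : 0 <= x -> (x ^+ k) `^ p = (x `^ p) ^+ k.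
Proof.
move=> x0; elim: k => [|k IH]; first by rewrite !expr0 powR1.
by rewrite !exprS powRM ?exprn_ge0// IH.
Qed.

Variables (K p : R) (omega : R -> R).
Hypotheses (K1 : 1 < K) (p1 : 1 < p) (ow : radial_weight omega).
Local Notation r := (layer_radius K).
Local Notation W := (layer_mass omega K).
Local Notation layer_moment m := (annulus_moment omega (r m) (r m.+1)).
Hypothesis Wfin : forall m, annulus_mass omega (r m) (r m.+1) \is a fin_num.

Let p0 : 0 < p. Proof. exact: lt_trans p1. Qed.
Let r_lt1 m : r m <= 1. Proof. by rewrite ltW// layer_radius_lt1. Qed.
Let K0 : 0 < K. Proof. exact: lt_trans K1. Qed.

Lemma layer_mass_ge0 m : 0 <= W m.
Proof. by rewrite fine_ge0//; apply: integral_ge0 => x _; rewrite lee_fin weight0_ge0. Qed.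

(** By rotation invariance the moment is the same for all [j], hence it is the [1/N]-th part of the
    moment of the sum, which is at most 16 times the mass; finally [1 / N <= mesh]. *)
Lemma kernel2_moment n j m :
  layer_moment m (fun x => kernel K n j x ^+ 2) \is a fin_num /\
  fine (layer_moment m (fun x => kernel K n j x ^+ 2)) <= 16 * mesh K n * W m.
Proof.
have km j' : disc_measurable (fun x => kernel K n j' x ^+ 2).
  by apply: disc_measurableX; exact: kernel_measurable.
have k0 j' x : 0 <= kernel K n j' x ^+ 2 by rewrite sqr_ge0.
have fin i : layer_moment m (fun x => kernel K n i x ^+ 2) \is a fin_num.
  rewrite ge0_fin_numE; last exact: moment_ge0.
  apply: (@le_lt_trans _ _ (annulus_mass omega (r m) (r m.+1))); last by rewrite -ge0_fin_numE ?Wfin// -(fineK (Wfin m)) lee_fin layer_mass_ge0.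
  rewrite -[leRHS]mul1e -moment_cst//; apply: moment_le => //; first exact: disc_measurable_cst.
  move=> x /andP[_ xr]; rewrite exprn_ile1 ?kernel_ge0//.
  by apply: kernel_le1 => //; rewrite ltW// (lt_le_trans xr).
split => //.
have E i : layer_moment m (fun x => kernel K n i x ^+ 2) = layer_moment m (fun x => kernel K n 0 x ^+ 2).
  have [z1 _ _] := @cis_root_primitive R (mesh_count K n) (mesh_count_gt0 K n).
  rewrite -[RHS](@moment_rotate _ _ ow _ _ (r_lt1 _) _ ((cis (root_angle (mesh_count K n) 1))^-1 ^+ i))//.
    by congr annulus_moment; apply/funext => x; rewrite /kernel /lattice_conj expr0 mulr1 mulrA.
  by rewrite ncX z1 expr1n.
have H : (mesh_count K n)%:R * fine (layer_moment m (fun x => kernel K n j x ^+ 2)) <= 16 * W m.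
  have -> : (mesh_count K n)%:R * fine (layer_moment m (fun x => kernel K n j x ^+ 2)) =
     \sum_(i < mesh_count K n) fine (layer_moment m (fun x => kernel K n i x ^+ 2)).
    rewrite E mulr_natl -[X in _ *+ X]card_ord -sumr_const.
    by apply: eq_bigr => i _; rewrite E.
  rewrite -lee_fin EFinM (fineK (Wfin m)) -moment_cst//.
  rewrite (_ : (\sum_(i < mesh_count K n) _)%:E =
     layer_moment m (fun x => \sum_(i < mesh_count K n) kernel K n i x ^+ 2)); last first.
    rewrite moment_sum// -sumEFin; apply: eq_bigr => i _.
    by rewrite fineK.
  apply: moment_le => //.
  - exact: disc_measurable_sum.
  - exact: disc_measurable_cst.
  - by move=> x; apply: sumr_ge0.
  - by move=> x /andP[_ xr]; apply: sum_kernel2_le => //; exact: lt_le_trans xr _.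
have m0 := mesh_gt0 K1 n; have /andP[c1 _] := mesh_count_bounds K1 n.
have f0 : 0 <= fine (layer_moment m (fun x => kernel K n j x ^+ 2)).
  by rewrite fine_ge0//; apply: moment_ge0.
apply: (@le_trans _ _ (((mesh_count K n)%:R * mesh K n) * fine (layer_moment m (fun x => kernel K n j x ^+ 2)))).
  by rewrite ler_peMl.
by rewrite mulrAC [X in _ <= X]mulrAC ler_pM2r.
Qed.

Lemma kernel_le_layer n j m x : (m < n)%N -> nc x < r m.+1 ->
  kernel K n j x <= K^-1 ^+ (n - m).
Proof.
move=> mn xr; have x1 : nc x < 1 by rewrite (lt_le_trans xr).
apply: (le_trans (kernel_le_dist K1 n j x1)).
have xr' : K^-1 ^+ m.+1 <= 1 - nc x.
  by rewrite lerBrDr addrC -lerBrDr ltW.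
rewrite ler_pdivrMr ?subr_gt0// /mesh.
have -> : (n.+1 = (n - m) + m.+1)%N by rewrite addnS subnK// ltnW.
by rewrite exprD ler_pM2l// exprn_gt0// invr_gt0.
Qed.

Definition lattice L : seq (nat * nat) :=
  [seq (n, j) | n <- iota 0 L, j <- iota 0 (mesh_count K n)].

Lemma sum_lattice {V : nmodType} L (F : nat -> nat -> V) :
  \sum_(i <- lattice L) F i.1 i.2 = \sum_(n < L) \sum_(j < mesh_count K n) F n j.
Proof.
have io N : iota 0 N = index_iota 0 N by rewrite /index_iota subn0.
rewrite big_allpairs_dep io big_mkord.
by apply: eq_bigr => n _; rewrite io big_mkord.
Qed.

(** The price of comparing with the mass of layer [n + 2] instead of [n]: [Lam^2] on the growth side
    and [kap^-2] on the decay side. The shift also makes the reference index positive. *)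
Definition shifted_cst (cW kap Lam : R) := cW * (Lam ^+ 2 * kap ^- 2).

Variables (kap Lam cW : R).
Local Notation cW' := (shifted_cst cW kap Lam).
Hypotheses (kap0 : 0 < kap) (kap1 : kap < 1) (Lam1 : 1 <= Lam) (cW0 : 0 < cW).
Hypothesis W_gt0 : forall n, (0 < n)%N -> 0 < W n.
Hypothesis W_decay : forall n m, (0 < n)%N -> (n <= m)%N -> W m <= cW * kap ^+ (m - n) * W n.
Hypothesis W_growth : forall n m, (0 < n)%N -> (m <= n)%N -> W m <= cW * Lam ^+ (n - m) * W n.

Lemma layer_mass_decay n m : (n <= m)%N -> W m <= cW' * kap ^+ (m - n) * W n.+2.
Proof.
move=> nm; have W0 := W_gt0 (ltn0Sn n.+1).
have L2 : 1 <= Lam ^+ 2 by rewrite exprn_ege1.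
have k2 : 0 < kap ^+ 2 by rewrite exprn_gt0.
have [h|h] := leqP n.+2 m.
  apply: (le_trans (W_decay _ h)) => //; rewrite ler_pM2r// /shifted_cst -mulrA ler_pM2l// -mulrA.
  have -> : (m - n = (m - n.+2) + 2)%N.
    by rewrite -(addn2 n) subnDA subnK// leq_subRL ?addn2// ltnW// ltnW.
  rewrite exprD (_ : _ * _ = Lam ^+ 2 * kap ^+ (m - n.+2)).
    by rewrite ler_peMl// exprn_ge0// ltW.
  by field; rewrite gt_eqF.
apply: (le_trans (W_growth (ltn0Sn n.+1) (ltnW h))); rewrite ler_pM2r// /shifted_cst -mulrA ler_pM2l// -mulrA.
apply: (@le_trans _ _ (Lam ^+ 2)).
  by rewrite ler_weXn2l// leq_subLR addn2 !ltnS.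
rewrite ler_peMr//; first by rewrite (le_trans _ L2).
by rewrite mulrC ler_pdivlMr// mul1r ler_wiXn2l ?(ltW kap0) ?(ltW kap1)// leq_subLR addn2 ltnW.
Qed.

Lemma layer_mass_growth n m : (m <= n)%N -> W m <= cW' * Lam ^+ (n - m) * W n.+2.
Proof.
move=> mn; have W0 := W_gt0 (ltn0Sn n.+1).
apply: (le_trans (W_growth (ltn0Sn n.+1) (leqW (leqW mn)))); rewrite ler_pM2r// /shifted_cst -mulrA ler_pM2l// -mulrA.
rewrite !subSn// ?leqW// exprS exprS mulrA -expr2 ler_pM2l ?exprn_gt0 ?(lt_le_trans _ Lam1)//.
rewrite ler_peMl ?exprn_ge0 ?(le_trans _ Lam1)//.
by rewrite invf_ge1 ?exprn_gt0// exprn_ile1 ?ltW.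
Qed.

End Synthesis.

(** * The norm of a sum of kernels *)

Section LatticeSynthesis.
Context {R : realType}.
Variables (K p : R) (omega : R -> R).
Hypotheses (K1 : 1 < K) (p1 : 1 < p) (ow : radial_weight omega).
Local Notation r := (layer_radius K).
Local Notation W := (layer_mass omega K).
Local Notation layer_moment m := (annulus_moment omega (r m) (r m.+1)).
Hypothesis Wfin : forall m, annulus_mass omega (r m) (r m.+1) \is a fin_num.

Let p0 : 0 < p. Proof. exact: lt_trans p1. Qed.
Let r_lt1 m : r m <= 1. Proof. by rewrite ltW// layer_radius_lt1. Qed.
Let K0 : 0 < K. Proof. exact: lt_trans K1. Qed.

Variables (kap Lam cW : R).
Local Notation cW' := (shifted_cst cW kap Lam).
Hypotheses (kap0 : 0 < kap) (kap1 : kap < 1) (Lam1 : 1 <= Lam) (cW0 : 0 < cW).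
Hypothesis W_gt0 : forall n, (0 < n)%N -> 0 < W n.
Hypothesis W_decay : forall n m, (0 < n)%N -> (n <= m)%N -> W m <= cW * kap ^+ (m - n) * W n.
Hypothesis W_growth : forall n m, (0 < n)%N -> (m <= n)%N -> W m <= cW * Lam ^+ (n - m) * W n.

(** A Schur test between layers. On layer [m] Jensen's inequality is applied with weights
    [tau beta kernel^2], whose sum is bounded because [tau beta <= eta^|m - n|]. For [n > m] the
    decay comes from the surplus powers of the kernel and also beats the growth [Lam^(n - m)] of the
    masses. For [n <= m] the kernels give none: [beta] inserts it artificially, and the decay of the
    masses repays the cost [beta^-p]. *)
Lemma lattice_synthesis : exists M : nat, exists2 C : R, 0 < C &
  forall (c : nat -> nat -> R) (E : nat -> R), (forall n j, 0 <= c n j) ->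
  (forall n, mesh K n * (\sum_(j < mesh_count K n) c n j `^ p) * W n.+2 <= E n) ->
  forall L k, (\sum_(m < k) layer_moment m (fun x =>
    ((\sum_(i <- lattice K L) c i.1 i.2 * kernel K i.1 i.2 x ^+ M) `^ p)%R) <=
    (C * \sum_(n < L) E n)%R%:E)%E.
Proof.
(* [eta^p >= kap] lets the decay of the masses pay for [beta^-p]; [eta >= 1/2] dominates
   [nu Lam]. *)
pose eta := Num.max 2^-1 (kap `^ p^-1).
have eta0 : 0 < eta by rewrite lt_max invr_gt0 ltr0n.
have eta2 : 2^-1 <= eta by rewrite le_max lexx.
have eta1 : eta < 1.
  have e1 : 1 = 1 `^ p^-1 :> R by rewrite powR1.
  rewrite gt_max invf_lt1// ltr1n /= [X in _ < X]e1.
  by apply: gt0_ltr_powR; rewrite ?invr_gt0 ?nnegrE ?ler01 ?(ltW kap0).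
have kape : kap <= eta `^ p.
  have -> : kap = (kap `^ p^-1) `^ p by rewrite -powRrM mulVf ?gt_eqF// powRr1 ?(ltW kap0).
  apply: ge0_ler_powR; rewrite ?nnegrE ?(ltW p0) ?powR_ge0 ?(ltW eta0)//.
  by rewrite le_max lexx orbT.
(* The surplus exponent must outweigh the possible growth of the masses towards the centre. *)
have [M1 HM] : exists M1, K^-1 ^+ M1 * Lam <= 2^-1.
  have d0 : 0 < 2^-1 / Lam by rewrite divr_gt0 ?(lt_le_trans _ Lam1).
  have Ki1 : K^-1 < 1 by rewrite invf_lt1.
  have := @cvg_expr R K^-1; rewrite gtr0_norm ?invr_gt0// => /(_ Ki1)/cvgrPdist_lt/(_ _ d0)[n _ Hn].
  exists n; have := Hn n (leqnn n); rewrite sub0r normrN gtr0_norm ?exprn_gt0 ?invr_gt0//.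
  by rewrite ltr_pdivlMr ?(lt_le_trans _ Lam1)// => /ltW.
pose nu := K^-1 ^+ M1.
have nu0 : 0 < nu by rewrite exprn_gt0// invr_gt0.
have nuL : nu * Lam <= eta by rewrite (le_trans HM).
have nue : nu <= eta by apply: le_trans nuL; rewrite ler_peMr// ltW.
pose S := 16 * (2 / (1 - eta)).
have S0 : 0 < S by rewrite mulr_gt0// divr_gt0// subr_gt0.
have cW'0 : 0 < cW' by rewrite /shifted_cst mulr_gt0// divr_gt0 ?exprn_gt0 ?(lt_le_trans _ Lam1).
(* Two powers are reserved for the bound on the sum of squared kernels. *)
exists (M1.+2); exists (S `^ (p - 1) * (16 * cW') * (2 / (1 - eta))).
  rewrite mulr_gt0//; last by rewrite divr_gt0// subr_gt0.
  by rewrite mulr_gt0 ?powR_gt0// mulr_gt0.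
move=> c E c0 cE L k.
(* [tau] bounds the surplus power of the kernels of level [n] on layer [m]; [beta] is the auxiliary
   Schur weight. *)
pose tau n m := if (n <= m)%N then 1 else nu ^+ (n - m).
pose beta n m : R := if (n <= m)%N then eta ^+ (m - n) else 1.
pose d n m := ((m - n) + (n - m))%N.
have tau0 n m : 0 < tau n m by rewrite /tau; case: ifP => // _; rewrite exprn_gt0.
have beta0 n m : 0 < beta n m by rewrite /beta; case: ifP => // _; rewrite exprn_gt0.
have taubeta n m : tau n m * beta n m <= eta ^+ d n m.
  rewrite /tau /beta /d; case: leqP => h.
    by rewrite mul1r (eqP h) addn0.
  have -> : (m - n = 0)%N by apply/eqP; rewrite subn_eq0 ltnW.
  by rewrite mulr1 add0n lerXn2r ?nnegrE ?(ltW nu0) ?(ltW eta0).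
have tauW n m : tau n m * beta n m * ((beta n m)^-1 `^ p) * W m <= cW' * eta ^+ d n m * W n.+2.
  have W0 := W_gt0 (ltn0Sn n.+1).
  rewrite /tau /beta /d; case: leqP => h.
    have -> : (n - m = 0)%N by apply/eqP.
    rewrite addn0 mul1r; set b := eta ^+ (m - n).
    have b0 : 0 < b by rewrite exprn_gt0.
    have bp : b^-1 `^ p * b `^ p = 1.
      by rewrite -powRM ?invr_ge0 ?(ltW b0)// mulVf ?powR1// gt_eqF.
    have kb : kap ^+ (m - n) <= b `^ p.
      have -> : b `^ p = (eta `^ p) ^+ (m - n).
        by rewrite exprn_powR// ltW.
      by rewrite lerXn2r ?nnegrE ?powR_ge0 ?(ltW kap0).
    have H : W m <= cW' * b `^ p * W n.+2.
      have H0 := layer_mass_decay kap0 kap1 Lam1 cW0 W_gt0 W_decay W_growth h.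
      by rewrite (le_trans H0)// ler_pM2r// ler_pM2l.
    apply: (@le_trans _ _ (b * b^-1 `^ p * (cW' * b `^ p * W n.+2))).
      by rewrite ler_wpM2l// mulr_ge0 ?powR_ge0 ?(ltW b0).
    have -> : b * b^-1 `^ p * (cW' * b `^ p * W n.+2) = cW' * b * W n.+2 * (b^-1 `^ p * b `^ p) by ring.
    by rewrite bp mulr1.
  have -> : (m - n = 0)%N by apply/eqP; rewrite subn_eq0 ltnW.
  rewrite add0n invr1 powR1 !mulr1.
  have H := layer_mass_growth kap0 kap1 Lam1 cW0 W_gt0 W_growth (ltnW h).
  apply: (@le_trans _ _ (nu ^+ (n - m) * (cW' * Lam ^+ (n - m) * W n.+2))).
    by rewrite ler_wpM2l// exprn_ge0// ltW.
  have -> : nu ^+ (n - m) * (cW' * Lam ^+ (n - m) * W n.+2) = cW' * (nu * Lam) ^+ (n - m) * W n.+2.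
    by rewrite exprMn; ring.
  by rewrite ler_pM2r// ler_pM2l// lerXn2r ?nnegrE ?mulr_ge0 ?(ltW nu0) ?(ltW eta0)// (le_trans _ Lam1).
pose a m n j := S `^ (p - 1) * (tau n m * beta n m * ((beta n m)^-1 `^ p) * c n j `^ p).
have a0 m n j : 0 <= a m n j.
  by rewrite !mulr_ge0 ?powR_ge0 ?ltW.
have k0 n j x : 0 <= kernel K n j x by exact: kernel_ge0.
have pt m x : r m <= nc x < r m.+1 ->
    (\sum_(i <- lattice K L) c i.1 i.2 * kernel K i.1 i.2 x ^+ M1.+2) `^ p <=
    \sum_(i <- lattice K L) a m i.1 i.2 * kernel K i.1 i.2 x ^+ 2.
  move=> /andP[_ xr]; have x1 : nc x < 1 by rewrite (lt_le_trans xr).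
  pose V (i : nat * nat) := tau i.1 m * beta i.1 m * kernel K i.1 i.2 x ^+ 2.
  pose v (i : nat * nat) := c i.1 i.2 / beta i.1 m.
  have V0 i : 0 <= V i.
    by apply: mulr_ge0; [exact: mulr_ge0 (ltW _) (ltW _)|exact: exprn_ge0].
  have v0 i : 0 <= v i by apply: divr_ge0 => //; exact: ltW.
  apply: (@le_trans _ _ ((\sum_(i <- lattice K L) V i * v i) `^ p)).
    apply: ge0_ler_powR; rewrite ?nnegrE ?(ltW p0)//.
    - by apply: sumr_ge0 => i _; rewrite mulr_ge0 ?exprn_ge0.
    - by apply: sumr_ge0 => i _; rewrite mulr_ge0.
    apply: ler_sum => -[n j] _ /=; rewrite /V /v /=.
    have -> : tau n m * beta n m * kernel K n j x ^+ 2 * (c n j / beta n m) =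
       c n j * (tau n m * kernel K n j x ^+ 2) by field; rewrite gt_eqF.
    rewrite ler_wpM2l// -addn2 exprD ler_wpM2r ?exprn_ge0// /tau; case: leqP => h.
      by rewrite exprn_ile1//; apply: kernel_le1 => //; exact: ltW.
    rewrite /nu exprAC lerXn2r ?nnegrE ?exprn_ge0 ?invr_ge0 ?(ltW K0)//.
    exact: kernel_le_layer.
  have VS : \sum_(i <- lattice K L) V i <= S.
    rewrite (sum_lattice _ _ (fun n j => V (n, j))) /V /=.
    apply: (@le_trans _ _ (\sum_(n < L) 16 * eta ^+ d n m)).
      apply: ler_sum => n _; rewrite -mulr_sumr mulrC ler_pM ?sumr_ge0//.
      - by move=> j _; rewrite exprn_ge0.
      - by rewrite mulr_ge0 ?ltW.
      - exact: sum_kernel2_le.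
    rewrite -mulr_sumr ler_pM2l// (le_trans _ (sum_geometric_dist L m (ltW eta0) eta1))//.
  have := weighted_powR_jensen (p := p) p1 S0 V0 v0 VS.
  move=> /le_trans; apply; rewrite mulr_sumr; apply: ler_sum => -[n j] _.
  rewrite /a /V /v /= powRM ?invr_ge0 ?(ltW (beta0 _ _))//.
  by rewrite le_eqVlt; apply/orP; left; apply/eqP; ring.
have km n j : disc_measurable (fun x => kernel K n j x) by exact: kernel_measurable.
have mom m : (layer_moment m (fun x =>
    ((\sum_(i <- lattice K L) c i.1 i.2 * kernel K i.1 i.2 x ^+ M1.+2) `^ p)%R) <=
    (S `^ (p - 1) * (16 * cW') * \sum_(n < L) eta ^+ d n m * E n)%R%:E)%E.
  apply: (@le_trans _ _ (layer_moment m (fun x =>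
      \sum_(i <- lattice K L) a m i.1 i.2 * kernel K i.1 i.2 x ^+ 2))).
    apply: moment_le => //.
    - apply: disc_measurable_powR; apply: disc_measurable_sum => i.
      apply: disc_measurableM; first exact: disc_measurable_cst.
      exact: disc_measurableX.
    - apply: disc_measurable_sum => i; apply: disc_measurableM; first exact: disc_measurable_cst.
      exact: disc_measurableX.
    - by move=> x; exact: powR_ge0.
    - exact: pt.
  rewrite moment_sum//; last 2 first.
  - move=> i; apply: disc_measurableM; first exact: disc_measurable_cst.
    exact: disc_measurableX.
  - by move=> i x; rewrite mulr_ge0 ?exprn_ge0.
  apply: (@le_trans _ _ (\sum_(i <- lattice K L) (a m i.1 i.2 * (16 * mesh K i.1 * W m))%:E)%E).
    apply: lee_sum => -[n j] _ /=.
    have [kf kb] := kernel2_moment K1 ow Wfin n j m.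
    rewrite momentZ//; last by move=> x; rewrite exprn_ge0.
      by rewrite -(fineK kf) -EFinM lee_fin ler_wpM2l.
    exact: disc_measurableX.
  rewrite sumEFin lee_fin (sum_lattice _ _ (fun n j => a m n j * (16 * mesh K n * W m))).
  rewrite mulr_sumr; apply: ler_sum => n _.
  rewrite (_ : \sum_(j < _) _ = S `^ (p - 1) * 16 *
     ((tau n m * beta n m * ((beta n m)^-1 `^ p) * W m) *
      (mesh K n * \sum_(j < mesh_count K n) c n j `^ p))); last first.
    rewrite !mulr_sumr; apply: eq_bigr => j _; rewrite /a; ring.
  set P := mesh K n * \sum_(j < mesh_count K n) c n j `^ p.
  have P0 : 0 <= P.
    by rewrite mulr_ge0 ?(ltW (mesh_gt0 K1 n))// sumr_ge0// => j _; exact: powR_ge0.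
  have Sp0 : 0 < S `^ (p - 1) by exact: powR_gt0.
  apply: (@le_trans _ _ (S `^ (p - 1) * 16 * (cW' * eta ^+ d n m * W n.+2 * P))).
    apply: ler_wpM2l; first by rewrite mulr_ge0// ltW.
    by apply: ler_wpM2r => //; exact: tauW.
  have -> : S `^ (p - 1) * 16 * (cW' * eta ^+ d n m * W n.+2 * P) =
     S `^ (p - 1) * (16 * cW') * (eta ^+ d n m * (P * W n.+2)) by ring.
  apply: ler_wpM2l; first by rewrite mulr_ge0 ?(ltW Sp0)// mulr_ge0// ltW.
  by apply: ler_wpM2l; [exact/exprn_ge0/ltW|exact: cE].
apply: (@le_trans _ _ (\sum_(m < k) (S `^ (p - 1) * (16 * cW') * \sum_(n < L) eta ^+ d n m * E n)%:E)%E).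
  by apply: lee_sum => m _; exact: mom.
have E0 n : 0 <= E n.
  apply: le_trans (cE n); rewrite !mulr_ge0 ?(ltW (mesh_gt0 K1 n)) ?(ltW (W_gt0 _))//.
  by rewrite sumr_ge0// => j _; exact: powR_ge0.
rewrite sumEFin lee_fin -mulr_sumr -mulrA ler_pM2l; last first.
  by rewrite mulr_gt0 ?powR_gt0// mulr_gt0.
(* The other half of the Schur test: for a fixed level the factors [eta^|m - n|] are summable over
   the layers. *)
rewrite exchange_big /= mulr_sumr; apply: ler_sum => n _; rewrite -mulr_suml ler_wpM2r//.
apply: le_trans (sum_geometric_dist k n (ltW eta0) eta1).
by apply: ler_sum => m _; rewrite /d addnC.
Qed.

End LatticeSynthesis.

(** * Moments over the disc as sums over the layers *)

Section DiscMoments.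
Context {R : realType}.
Local Notation mu := (@lebesgue_measure R).
Local Notation T := (measurableTypeR R).
Variables (K : R) (omega : R -> R).
Hypotheses (K1 : 1 < K) (ow : radial_weight omega).
Local Notation r := (layer_radius K).
Local Notation layer_moment m := (annulus_moment omega (r m) (r m.+1)).
Implicit Types Phi : R[i] -> R.

Definition disc_moment (w : R -> R) Phi : \bar R :=
  (\int[mu \x mu]_(x in @disc2 R) (Phi (cplx x) * w (nc (cplx x)))%:E)%E.

Lemma disc_momentE Phi : disc_measurable Phi -> (forall x, 0 <= Phi x) ->
  disc_moment omega Phi = (\sum_(m <oo) layer_moment m Phi)%E.
Proof.
move=> mP P0.
pose A m : set (T * T) := annulus (r m) (r m.+1).
have mA m : measurable (A m) by exact: measurable_annulus.
have DA : (@disc2 R : set (T * T)) = \bigcup_m A m.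
  apply/seteqP; split => [x x1|x [m _ /andP[_ xr]]]; last first.
    by rewrite /disc2 /= (lt_trans xr)// layer_radius_lt1.
  have [n [j [_ h1 h2 _]]] := lattice_cover K1 x1.
  by exists n => //; rewrite /A /annulus /= h1.
have tA : trivIset setT A.
  apply/trivIsetP => m n _ _.
  wlog mn : m n / (m < n)%N.
    move=> H; rewrite neq_ltn => /orP[h|h]; first by apply: H => //; rewrite ltn_eqF.
    by rewrite setIC; apply: H => //; rewrite ltn_eqF.
  move=> _; apply/seteqP; split => // x [/andP[_ h1] /andP[h2 _]].
  by have := le_lt_trans h2 (lt_le_trans h1 (layer_radius_mono K1 mn)); rewrite ltxx.
pose g (x : T * T) := (Phi (cplx x) * weight0 omega (nrm2 x))%:E.
transitivity (\int[mu \x mu]_(x in @disc2 R) g x)%E.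
  apply: eq_integral => x /[!inE] x1; rewrite /g /weight0.
  by rewrite -[nrm2 x]/(nc (cplx x)) nc_ge0 [nc _ < 1]x1.
rewrite DA ge0_integral_bigcup//.
  rewrite -DA; apply: measurable_moment_integrand => //; exact: measurable_disc.
by move=> x _; rewrite lee_fin mulr_ge0 ?weight0_ge0.
Qed.

Lemma sum_layers_le_disc Phi k : disc_measurable Phi -> (forall x, 0 <= Phi x) ->
  (\sum_(m < k) layer_moment m Phi <= disc_moment omega Phi)%E.
Proof.
move=> mP P0; rewrite disc_momentE// -(big_mkord xpredT (fun m => layer_moment m Phi)).
by apply: nneseries_lim_ge => n _ _; apply: moment_ge0 => //; rewrite ltW// layer_radius_lt1.
Qed.

Lemma disc_le_sum_layers Phi B : disc_measurable Phi -> (forall x, 0 <= Phi x) ->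
  (forall k, \sum_(m < k) layer_moment m Phi <= B)%E -> (disc_moment omega Phi <= B)%E.
Proof.
move=> mP P0 H; rewrite disc_momentE//; apply: lime_le.
  apply: is_cvg_nneseries => n _ _; apply: moment_ge0 => //; first by rewrite ltW// layer_radius_lt1.
by apply: nearW => k; rewrite big_mkord.
Qed.

End DiscMoments.

(** * Sampling and synthesis combined *)

Section Atoms.
Context {R : realType}.
Variables (p : R) (omega : R -> R).
Hypotheses (p1 : 1 < p) (cD : classD omega).

Lemma atomic_samples : exists K : R, exists M : nat, exists2 C : R, 1 < K /\ 0 < C &
  forall f : R[i] -> R[i],
  (forall z, nc z < 1 -> exists d, cdiff f z d) ->
  disc_moment omega (fun x => nc (f x) `^ p) \is a fin_num ->
  exists c : nat -> nat -> R, [/\ forall n j, 0 <= c n j,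
    forall n j w, nc w < layer_radius K n.+1 ->
      nc (1 - lattice_conj K n j * w) <= (1 + K + 4 * pi) * mesh K n ->
      nc (f w) <= c n j /\ forall d, cdiff f w d -> nc d * mesh K n <= c n j &
    forall L, (disc_moment omega (fun x =>
      ((\sum_(i <- lattice K L) c i.1 i.2 * kernel K i.1 i.2 x ^+ M) `^ p)%R) <=
      C%:E * disc_moment omega (fun x => (nc (f x) `^ p)%R))%E].
Proof.
have ow : radial_weight omega by case: cD => -[].
have [K [kap [Lam [cW [K1 /andP[kap0 kap1] Lam1 cW0 [Wfin W0 Wd Wg]]]]]] := layer_mass_bounds cD.
have [C1 C10 HC1] := lattice_samples K1 p1 ow Wfin W0.
have [M [C2 C20 HC2]] := lattice_synthesis K1 p1 ow Wfin kap0 kap1 Lam1 cW0 W0 Wd Wg.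
exists K, M, (C2 * C1); first by rewrite mulr_gt0.
move=> f hf fin.
have fm : disc_measurable (fun x => nc (f x) `^ p).
  apply: disc_measurable_powR; apply: disc_measurable_nc => z z1.
  by have [d /cdiff_ccont] := hf _ z1.
have fp0 x : 0 <= nc (f x) `^ p by exact: powR_ge0.
have r_le1 m : layer_radius K m <= 1 by rewrite ltW// layer_radius_lt1.
pose Em m := annulus_moment omega (layer_radius K m) (layer_radius K m.+1) (fun x => nc (f x) `^ p).
have Em0 m : (0 <= Em m)%E by apply: moment_ge0.
have Esum k : (\sum_(m < k) Em m <= disc_moment omega (fun x => (nc (f x) `^ p)%R))%E.
  exact: sum_layers_le_disc.
have Efin m : Em m \is a fin_num.
  have le : (Em m <= disc_moment omega (fun x => (nc (f x) `^ p)%R))%E.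
    apply: le_trans (Esum m.+1); rewrite big_ord_recr /=.
    by rewrite leeDr// sume_ge0.
  by rewrite ge0_fin_numE// (le_lt_trans le)// -(fineK fin) ltry.
have [c [c0 cE cw]] := HC1 f hf Efin.
exists c; split => // L; apply: (disc_le_sum_layers K1 ow).
- apply: disc_measurable_powR; apply: disc_measurable_sum => i.
  apply: disc_measurableM; first exact: disc_measurable_cst.
  by apply: disc_measurableX; exact: kernel_measurable.
- by move=> x; exact: powR_ge0.
move=> k; apply: (le_trans (HC2 c _ c0 cE L k)).
rewrite EFinM EFinM -muleA lee_pmul2l// -mulr_sumr EFinM lee_pmul2l//.
(* Layers 0 and 1 are dropped from the sum, since the samples of level [n] are taken on layer
   [n + 2]. *)
apply: le_trans (Esum L.+2); rewrite big_ord_recl big_ord_recl /= -[X in (X <= _)%E]add0e leeD//.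
rewrite -[X in (X <= _)%E]add0e leeD// -sumEFin; apply: lee_sum => n _.
by rewrite -/(Em n.+2) (fineK (Efin _)) /bump !add1n.
Qed.

End Atoms.

(** * Averages over signs *)

Section Signs.
Context {R : realType} {I : Type}.
Implicit Types (X Y : I -> R[i]) (s : seq I) (y : R[i]) (q : R).

(** [true] stands for minus; a sign list shorter than [s] is padded with plus signs. *)
Fixpoint signed_sum (e : seq bool) X s : R[i] :=
  if s is i :: s' then (-1) ^+ head false e * X i + signed_sum (behead e) X s' else 0.

(** The mean of [|y + signed_sum e X s|^q] over all choices of signs, unfolded one sign at a
    time. *)
Fixpoint sign_mean q X s y : R :=
  if s is i :: s' then (sign_mean q X s' (y + X i) + sign_mean q X s' (y - X i)) / 2
  else nc y `^ q.

Lemma nc_sign (b : bool) y : nc ((-1) ^+ b * y) = nc y.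
Proof. by case: b; rewrite ?expr1 ?expr0 ?mulN1r ?mul1r ?ncN. Qed.

Lemma nc_signed_sum e X s : nc (signed_sum e X s) <= \sum_(i <- s) nc (X i).
Proof.
elim: s e => [|i s IH] e; first by rewrite big_nil nc0.
by rewrite big_cons /= (le_trans (ncD _ _))// nc_sign lerD2l.
Qed.

Lemma signed_sumD e X Y s :
  signed_sum e (fun i => X i + Y i) s = signed_sum e X s + signed_sum e Y s.
Proof.
elim: s e => [|i s IH] e /=; first by rewrite addr0.
by rewrite IH mulrDr addrACA.
Qed.

Lemma signed_sumZ e (a : R[i]) X s : signed_sum e (fun i => a * X i) s = a * signed_sum e X s.
Proof.
elim: s e => [|i s IH] e /=; first by rewrite mulr0.
by rewrite IH mulrDr mulrCA.
Qed.

Lemma cdiff_signed_sum e (F : I -> R[i] -> R[i]) X s z : (forall i, cdiff (F i) z (X i)) ->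
  cdiff (fun x => signed_sum e (fun i => F i x) s) z (signed_sum e X s).
Proof.
move=> FX; elim: s e => [|i s IH] e /=; first exact: cdiff_cst.
by apply: cdiffD => //; exact: cdiffZ.
Qed.

Lemma sign_mean_ge0 q X s y : 0 <= sign_mean q X s y.
Proof.
by elim: s y => [|i s IH] y /=; rewrite ?powR_ge0// divr_ge0 ?addr_ge0.
Qed.

Lemma sign_meanN q X s y : sign_mean q X s (- y) = sign_mean q X s y.
Proof.
elim: s y => [|i s IH] y /=; first by rewrite ncN.
have := IH (y + X i); have := IH (y - X i); rewrite !opprD !opprK => -> ->.
by rewrite addrC.
Qed.

Lemma powR_midpoint q (x h : R[i]) : 1 < q ->
  nc x `^ q <= (nc (x + h) `^ q + nc (x - h) `^ q) / 2.
Proof.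
move=> q1; have q0 : 0 < q by exact: lt_trans q1.
have N : nc x <= 2^-1 * nc (x + h) + 2^-1 * nc (x - h).
  have := ncD (x + h) (x - h); have -> : x + h + (x - h) = 2%:R * x by ring.
  rewrite ncM nc_nat.
  by move: (nc x) (nc (x + h)) (nc (x - h)) => a b c; lra.
have := @weighted_powR_jensen R bool [:: true; false] (fun=> 2^-1)
   (fun b => if b then nc (x + h) else nc (x - h)) q 1 q1 ltr01.
rewrite powR1 mul1r !big_cons !big_nil /= !addr0 => H.
apply: (@le_trans _ _ ((2^-1 * nc (x + h) + 2^-1 * nc (x - h)) `^ q)).
  by apply: ge0_ler_powR; rewrite ?nnegrE ?(ltW q0)// ?addr_ge0 ?mulr_ge0 ?nc_ge0.
rewrite mulrDl [_ / 2]mulrC [X in _ <= _ + X]mulrC; apply: H => //.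
- by move=> b; case: b; rewrite nc_ge0.
- by lra.
Qed.

Lemma sign_mean_ge_start q X s y : 1 < q -> nc y `^ q <= sign_mean q X s y.
Proof.
move=> q1; elim: s y => [|i s IH] y //=.
by apply: le_trans (powR_midpoint y (X i) q1) _; rewrite ler_pM2r// lerD.
Qed.

End Signs.

Section SignMeans.
Context {R : realType} {I : eqType}.

(** The symmetry of the mean in [y] exchanges the roles of [y] and [X i] when the sign of [i] is
    averaged: [X i] becomes the centre, and convexity discards [y] along with the later signs. The
    bound holds for all [i] at once, so [i] may depend on the point of integration. *)
Lemma sign_mean_ge_term (q : R) (X : I -> R[i]) s y i : 1 < q -> i \in s ->
  nc (X i) `^ q <= sign_mean q X s y.
Proof.
move=> q1; elim: s y => [//|j s IH] y; rewrite in_cons => /orP[/eqP->|/IH is_].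
  rewrite /= -[sign_mean q X s (y - X j)]sign_meanN opprB [y + _]addrC.
  by apply: le_trans (powR_midpoint (X j) y q1) _; rewrite ler_pM2r// lerD// sign_mean_ge_start.
rewrite /= ler_pdivlMr//; have := is_ (y + X j); have := is_ (y - X j).
by rewrite mulr_natr mulr2n => h1 h2; exact: lerD.
Qed.

Lemma measurable_sign_mean (q : R) (F : I -> R[i] -> R[i]) (Y : R[i] -> R[i]) s :
  (forall i z, nc z < 1 -> ccont (F i) z) -> (forall z, nc z < 1 -> ccont Y z) ->
  measurable_fun (@disc2 R : set (R * R)) (fun x : R * R =>
    let z := (x.1 +i* x.2)%C in sign_mean q (fun i => F i z) s (Y z)).
Proof.
move=> cF; elim: s Y => [|i s IH] Y cY.
  exact: (measurableT_comp (measurable_powR q) (ccont_nc_measurable cY)).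
apply: measurable_funM; last exact: measurable_cst.
apply: measurable_funD.
  by apply: (IH (fun z => Y z + F i z)) => z z1; apply: ccontD; [exact: cY|exact: cF].
apply: (IH (fun z => Y z - F i z)) => z z1; apply: ccontD; first exact: cY.
have := ccontM (cdiff_ccont (cdiff_cst (-1) z)) (cF i _ z1).
by rewrite (_ : (fun x => -1 * F i x) = (fun x => - F i x))//; apply/funext => x; rewrite mulN1r.
Qed.

Variable ups : {measure set (R * R)%type -> \bar R}.

(** An average of integrals that are each at most [B]. The induction moves one sign after the other
    into the starting function [Y], which is why [Y] is general. *)
Lemma integral_sign_mean (q B : R) (F : I -> R[i] -> R[i]) (Y : R[i] -> R[i]) s :
  (forall i z, nc z < 1 -> ccont (F i) z) -> (forall z, nc z < 1 -> ccont Y z) ->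
  (forall e, \int[ups]_(x in @disc2 R)
     ((let z := (x.1 +i* x.2)%C in nc (Y z + signed_sum e (fun i => F i z) s) `^ q)%R)%:E <= B%:E)%E ->
  (\int[ups]_(x in @disc2 R)
    ((let z := (x.1 +i* x.2)%C in sign_mean q (fun i => F i z) s (Y z))%R)%:E <= B%:E)%E.
Proof.
move=> cF; elim: s Y => [|i s IH] Y cY H.
  apply: le_trans (H [::]); rewrite le_eqVlt; apply/orP; left; apply/eqP.
  by apply: eq_integral => x _ /=; rewrite addr0.
have cN : forall z, nc z < 1 -> ccont (fun x => - F i x) z.
  move=> z z1; have := ccontM (cdiff_ccont (cdiff_cst (-1) z)) (cF i _ z1).
  by rewrite (_ : (fun x => -1 * F i x) = (fun x => - F i x))//; apply/funext => x; rewrite mulN1r.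
have c1 z : nc z < 1 -> ccont (fun z => Y z + F i z) z by move=> z1; apply: ccontD; [exact: cY|exact: cF].
have c2 z : nc z < 1 -> ccont (fun z => Y z - F i z) z by move=> z1; apply: ccontD; [exact: cY|exact: cN].
have := IH _ c1; have := IH _ c2.
set I1 := integral _ _ _; set I2 := integral _ _ _ => H2 H1.
have h2 : (I1 <= B%:E)%E.
  apply: H2 => e; apply: le_trans (H (true :: e)).
  by rewrite le_eqVlt; apply/orP; left; apply/eqP; apply: eq_integral => x _ /=; rewrite expr1 mulN1r addrA.
have h1 : (I2 <= B%:E)%E.
  apply: H1 => e; apply: le_trans (H (false :: e)).
  by rewrite le_eqVlt; apply/orP; left; apply/eqP; apply: eq_integral => x _ /=; rewrite expr0 mul1r addrA.
pose G Z (x : R * R) := ((let z := (x.1 +i* x.2)%C in sign_mean q (fun i => F i z) s (Z z))%R)%:E.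
have G0 Z x : (0 <= G Z x)%E by rewrite lee_fin sign_mean_ge0.
have mG Z : (forall z, nc z < 1 -> ccont Z z) -> measurable_fun (@disc2 R) (G Z).
  by move=> cZ; apply/measurable_EFinP; exact: measurable_sign_mean.
rewrite (_ : integral _ _ _ = (2^-1)%:E * (I2 + I1))%E.
  rewrite (_ : B%:E = (2^-1)%:E * (B%:E + B%:E))%E; last by rewrite -EFinD -EFinM; congr EFin; lra.
  by rewrite lee_pmul2l// leeD.
have mD := @measurable_disc R.
rewrite -[I2]/(integral ups _ (G (fun z => Y z + F i z))).
rewrite -[I1]/(integral ups _ (G (fun z => Y z - F i z))).
rewrite -ge0_integralD//; last 4 first.
- by move=> x _; rewrite lee_fin; exact: sign_mean_ge0.
- exact: (mG _ c1).
- by move=> x _; rewrite lee_fin; exact: sign_mean_ge0.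
- exact: (mG _ c2).
rewrite -ge0_integralZl_EFin//.
- apply: eq_integral => x _; rewrite /G -EFinD -EFinM /=; congr EFin; exact: mulrC.
- by move=> x _; rewrite adde_ge0// lee_fin; exact: sign_mean_ge0.
- by apply: emeasurable_funD; [exact: (mG _ c1)|exact: (mG _ c2)].
Qed.

End SignMeans.

(** * Separation of the two operators *)

Section Separation.
Context {R : realType}.
Implicit Types (U V s t b x : R[i]) (M n : nat).

(** The sum of the two operators on the atom of exponent [M + i], at a point: [s] and [t] are the
    values of the atom at the images under [phi] and [psi], the factors common to all [i] are
    absorbed in [U] and [V], and [M + i] comes from differentiating the power. *)
Definition mixed M U V s t (i : nat) : R[i] := U * s ^+ i + (M + i)%:R * V * t ^+ i.

Lemma nc_natM n x : nc (n%:R * x) = n%:R * nc x.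
Proof. by rewrite ncM nc_nat. Qed.

(* The three exponents [i = 0, 1, 2] allow the elimination of either term of
   [U s ^ i + (M + i) V t ^ i] with coefficients bounded uniformly in [s] and [t]. *)
Lemma separation M U V s t : nc s <= 1 -> nc t <= 1 ->
  let D := 2 * (M.+2)%:R ^+ 2 in
  nc U * nc s ^+ 2 <= D * \sum_(i < 3) nc (mixed M U V s t i) /\
  nc V * nc t ^+ 2 <= D * \sum_(i < 3) nc (mixed M U V s t i).
Proof.
move=> s1 t1 /=; rewrite !big_ord_recl big_ord0 addr0 /=.
set X := mixed M U V s t.
have E0 : X 0%N = U + M%:R * V by rewrite /X /mixed !expr0 !mulr1 addn0.
have E1 : X 1%N = U * s + M.+1%:R * V * t by rewrite /X /mixed !expr1 addn1.
have E2 : X 2%N = U * s ^+ 2 + M.+2%:R * V * t ^+ 2 by rewrite /X /mixed addn2.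
have I1 : U * s ^+ 2 = M.+2%:R * (s * (M.+1%:R * (t * X 0%N))) - M.+2%:R * (M%:R * (s * X 1%N)) -
   (M.+1%:R * (M.+2%:R * (t * X 1%N)) - M.+1%:R * (M.+1%:R * X 2%N)).
  rewrite E0 E1 E2 -[M.+2%:R]natr1 -[M.+1%:R]natr1; ring.
have I2 : V * t ^+ 2 = M%:R * (s * X 1%N) - M%:R * X 2%N -
   (M.+1%:R * (t * (s * X 0%N)) - M.+1%:R * (t * X 1%N)).
  rewrite E0 E1 E2 -[M.+2%:R]natr1 -[M.+1%:R]natr1; ring.
rewrite -[bump 0 0]/1%N -[bump 0 (bump 0 0)]/2%N -/(X 0%N) -/(X 1%N) -/(X 2%N).
have sx x : nc (s * x) <= nc x by rewrite ncM ler_piMl ?nc_ge0.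
have tx x : nc (t * x) <= nc x by rewrite ncM ler_piMl ?nc_ge0.
pose m : R := M%:R.
have m0 : 0 <= m by [].
have m1 : M.+1%:R = m + 1 :> R by rewrite -natr1.
have m2 : M.+2%:R = m + 2 :> R by rewrite -natr1 m1 -addrA.
have N0 := nc_ge0 (X 0%N); have N1 := nc_ge0 (X 1%N); have N2 := nc_ge0 (X 2%N).
have st0 : nc (s * (M.+1%:R * (t * X 0%N))) <= (m + 1) * nc (X 0%N).
  by apply: (le_trans (sx _)); rewrite nc_natM m1 ler_wpM2l// addr_ge0.
have ts0 : nc (t * (s * X 0%N)) <= nc (X 0%N) by apply: (le_trans (tx _)).
rewrite -ncX -ncM -ncX -ncM I1 I2 m2.
split.
- apply: (le_trans (ncB _ _)).
  apply: (@le_trans _ _ ((m + 2) * ((m + 1) * nc (X 0%N)) + (m + 2) * (m * nc (X 1%N)) +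
     ((m + 1) * ((m + 2) * nc (X 1%N)) + (m + 1) * ((m + 1) * nc (X 2%N))))).
    apply: lerD; apply: (le_trans (ncB _ _)); apply: lerD.
    + by rewrite nc_natM m2 ler_wpM2l// addr_ge0.
    + by rewrite !nc_natM m2 ler_wpM2l ?addr_ge0// ler_wpM2l.
    + by rewrite !nc_natM m1 m2 ler_wpM2l ?addr_ge0// ler_wpM2l// addr_ge0.
    + by rewrite !nc_natM m1.
  move: (nc (X 0%N)) (nc (X 1%N)) (nc (X 2%N)) N0 N1 N2 => a b c a0 b0 c0.
  have mm := mulr_ge0 m0 m0.
  rewrite -subr_ge0.
  (* The slack in the constant [2 (m + 2)^2] is a polynomial with nonnegative coefficients. *)
  rewrite (_ : _ - _ = (m * m + 5 * m + 6) * a + (3 * m + 6) * b + (m * m + 6 * m + 7) * c); last by ring.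
  by rewrite !addr_ge0// mulr_ge0// !addr_ge0// mulr_ge0.
- apply: (le_trans (ncB _ _)).
  apply: (@le_trans _ _ (m * nc (X 1%N) + m * nc (X 2%N) +
     ((m + 1) * nc (X 0%N) + (m + 1) * nc (X 1%N)))).
    apply: lerD; apply: (le_trans (ncB _ _)); apply: lerD.
    + by rewrite nc_natM ler_wpM2l.
    + by rewrite nc_natM.
    + by rewrite nc_natM m1 ler_wpM2l// addr_ge0.
    + by rewrite nc_natM m1 ler_wpM2l// addr_ge0.
  move: (nc (X 0%N)) (nc (X 1%N)) (nc (X 2%N)) N0 N1 N2 => a b c a0 b0 c0.
  have mm := mulr_ge0 m0 m0.
  rewrite -subr_ge0.
  rewrite (_ : _ - _ = (2 * (m * m) + 7 * m + 7) * a + (2 * (m * m) + 6 * m + 7) * b +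
     (2 * (m * m) + 7 * m + 8) * c); last by ring.
  by rewrite !addr_ge0// mulr_ge0// !addr_ge0// mulr_ge0.
Qed.

Variable K : R.
Hypothesis K1 : 1 < K.

Definition atom n j x : R[i] := ((mesh K n)%:C)%C / (1 - lattice_conj K n j * x).

Lemma nc_atom n j x : nc (atom n j x) = kernel K n j x.
Proof. by rewrite ncM ncV nc_real gtr0_norm// mesh_gt0. Qed.

(** The derivative of an atom is this constant times the square of the atom, so differentiation maps
    powers of an atom to multiples of the next power. *)
Definition atom_slope n j : R[i] := lattice_conj K n j / ((mesh K n)%:C)%C.

Lemma cdiff_atom n j k x : nc x < 1 ->
  cdiff (fun x => atom n j x ^+ k) x (k%:R * atom_slope n j * atom n j x ^+ k.+1).
Proof.
move=> x1; set b := lattice_conj K n j; set d : R[i] := ((mesh K n)%:C)%C.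
have d0 : d != 0 by rewrite -nc_gt0 nc_real normr_gt0 gt_eqF// mesh_gt0.
have h : 1 + - b * x != 0 by rewrite mulNr; apply: one_minus_neq0 => //; exact: nc_lattice_lt1.
have h' : 1 - b * x != 0 by rewrite -mulNr.
have A : cdiff (atom n j) x (d * (- - b * (1 + - b * x) ^- 2)).
  have := cdiffZ d (cdiff_affineV h).
  by rewrite (_ : (fun x => _) = atom n j)//; apply/funext => y; rewrite /atom mulNr.
have := cdiffX k A; case: k => [|k]; first by rewrite !mul0r.
set D := (X in cdiff _ _ X -> _) => H.
rewrite (_ : k.+1%:R * _ * _ = D)// /D /= /atom_slope /atom -/b -/d opprK mulNr.
rewrite exprS exprS; set y := (d / _) ^+ k.
by field; rewrite d0 h'.
Qed.

End Separation.

(** * Norms as moments, and exhaustion of the disc *)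

Section Norms.
Context {R : realType}.
Local Notation mu := (@lebesgue_measure R).
Local Notation T := (measurableTypeR R).

Lemma root_poweR_le (I : \bar R) (q B : R) : 0 < q -> (0 <= I)%E -> 0 <= B ->
  (poweR I q^-1 <= B%:E)%E = (I <= (B `^ q)%:E)%E.
Proof.
move=> q0 I0 B0; have qi : q^-1 != 0 by rewrite invr_eq0 gt_eqF.
have qi0 : 0 <= q^-1 by rewrite invr_ge0 ltW.
case: I I0 => [x|_|//]; last by rewrite poweRyr// !leye_eq.
rewrite lee_fin => x0; rewrite poweR_EFin !lee_fin; apply/idP/idP => H.
- have -> : x = (x `^ q^-1) `^ q by rewrite -powRrM mulVf ?gt_eqF// powRr1.
  by apply: ge0_ler_powR; rewrite ?nnegrE ?powR_ge0 ?(ltW q0).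
- have -> : B = (B `^ q) `^ q^-1 by rewrite -powRrM mulfV ?gt_eqF// powRr1.
  by apply: ge0_ler_powR; rewrite ?nnegrE ?powR_ge0.
Qed.

Lemma disc_moment_ge0 (omega : R -> R) (Phi : R[i] -> R) : radial_weight omega ->
  (forall x, 0 <= Phi x) -> (0 <= disc_moment omega Phi)%E.
Proof.
case=> _ o0 _ _ P0; apply: integral_ge0 => x x1.
by rewrite lee_fin mulr_ge0// o0// nc_ge0 ltW.
Qed.

Lemma normA_le1 (p : R) (omega : R -> R) (f : Cx R -> Cx R) : 0 < p -> radial_weight omega ->
  (normA p omega f <= 1)%E = (disc_moment omega (fun x => (nc (f x) `^ p)%R) <= pi%:E)%E.
Proof.
move=> p0 ow.
have D0 : (0 <= disc_moment omega (fun x => (nc (f x) `^ p)%R))%E.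
  by apply: disc_moment_ge0 => // x; exact: powR_ge0.
have -> : normA p omega f =
    poweR ((pi^-1)%:E * disc_moment omega (fun x => (nc (f x) `^ p)%R))%E p^-1 by [].
have pi0 : 0 < pi :> R by exact: pi_gt0.
rewrite root_poweR_le// ?powR1; last by rewrite mule_ge0// lee_fin invr_ge0 ltW.
by rewrite lee_pdivrMl// mule1.
Qed.

Variable ups : {measure set (R * R)%type -> \bar R}.

Lemma normL_le (q B : R) (g : Cx R -> Cx R) : 0 < q -> 0 <= B ->
  (normL q ups g <= B%:E)%E =
  (\int[ups]_(x in @disc2 R) ((nc (g (x.1 +i* x.2)%C) `^ q)%R)%:E <= (B `^ q)%R%:E)%E.
Proof.
move=> q0 B0; rewrite -root_poweR_le//.
by apply: integral_ge0 => x _; rewrite lee_fin powR_ge0.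
Qed.

(** A finite sum of atoms up to level [L] controls the points whose image lies in
    [|x| < layer_radius K L]; monotone convergence removes this restriction. *)
Lemma integral_disc_exhaustion (phi : R[i] -> R[i]) (h : R[i] -> R) (K : R) (B : \bar R) :
  1 < K -> (forall z, nc z < 1 -> ccont phi z) -> (forall z, nc z < 1 -> nc (phi z) < 1) ->
  measurable_fun (@disc2 R : set (R * R)) (fun x : R * R => h (x.1 +i* x.2)%C) ->
  (forall z, 0 <= h z) ->
  (forall L, \int[ups]_(x in [set x | disc2 x /\ (nc (phi (x.1 +i* x.2)%C) < layer_radius K L)%R])
     (h (x.1 +i* x.2)%C)%:E <= B)%E ->
  (\int[ups]_(x in @disc2 R) (h (x.1 +i* x.2)%C)%:E <= B)%E.
Proof.
move=> K1 cphi phi1 mh h0 H.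
pose F L : set (R * R) := [set x | disc2 x /\ nc (phi (x.1 +i* x.2)%C) < layer_radius K L].
have DF : (@disc2 R : set (R * R)) = \bigcup_L F L.
  apply/seteqP; split => [x x1|x [L _ []//]].
  have [n [j [_ _ h2 _]]] := lattice_cover K1 (phi1 _ x1).
  by exists n.+1.
have mF L : measurable (F L).
  have := @ccont_nc_measurable R phi cphi measurable_disc `]-oo, (layer_radius K L)[%classic (measurable_itv _).
  by congr measurable; apply/seteqP; split => x; rewrite /F /= in_itv.
have mf : measurable_fun (@disc2 R : set (R * R)) (fun x : R * R => (h (x.1 +i* x.2)%C)%:E).
  exact/measurable_EFinP.
have nF : nondecreasing_seq F.
  move=> m n mn; apply/subsetPset => x [x1 xm]; split => //.
  by rewrite (lt_le_trans xm)// layer_radius_mono.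
have mfF L : measurable_fun (F L) (fun x : R * R => (h (x.1 +i* x.2)%C)%:E).
  by apply: measurable_funS mf; [exact: measurable_disc|move=> x []].
have := @ge0_nondecreasing_set_cvg_integral _ _ R F _ ups nF mF mfF (fun _ _ _ => h0 _).
rewrite -DF => cv.
rewrite -(cvg_lim _ cv)//; apply: lime_le; first by apply/cvg_ex; eexists; exact: cv.
exact: nearW.
Qed.

End Norms.

(** * The pointwise lower estimate *)

Section LowerEstimate.
Context {R : realType}.

(** On the cell the kernel is at least [1 / (1 + K + 4 pi)], which undoes the powers left by the
    separation. For [b] one also divides by the slope, of modulus
    [(1 - mesh) / mesh >= (1 - K^-1) / mesh]; the resulting factor [mesh] matches the scaling of the
    bound on [f'] by the samples. *)
Lemma atom_point_bound (K : R) (M n j : nat) (a b w v : R[i]) :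
  1 < K -> nc w < 1 -> nc v < 1 ->
  let m := mixed M (a * atom K n j w ^+ M) (b * atom_slope K n j * atom K n j v ^+ M.+1)
    (atom K n j w) (atom K n j v) in
  let cst := (1 + K + 4 * pi) ^+ M.+3 * (1 - K^-1)^-1 * (2 * (M.+2)%:R ^+ 2) in
  (nc (1 - lattice_conj K n j * w) <= (1 + K + 4 * pi) * mesh K n ->
     nc a <= cst * \sum_(i < 3) nc (m i)) /\
  (nc (1 - lattice_conj K n j * v) <= (1 + K + 4 * pi) * mesh K n ->
     nc b <= mesh K n * (cst * \sum_(i < 3) nc (m i))).
Proof.
move=> K1 w1 v1; have K0 : 0 < K by exact: lt_trans K1.
have s1 : nc (atom K n j w) <= 1 by rewrite nc_atom// kernel_le1// ltW.
have t1 : nc (atom K n j v) <= 1 by rewrite nc_atom// kernel_le1// ltW.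
have := separation M (a * atom K n j w ^+ M) (b * atom_slope K n j * atom K n j v ^+ M.+1) s1 t1.
move=> /= [H1 H2]; set m := mixed _ _ _ _ _ in H1 H2 *.
set S := \sum_(i < 3) nc (m i) in H1 H2 *; set D := 2 * _ in H1 H2 *.
set vs := 1 + K + 4 * pi.
have m0 := mesh_gt0 K1 n.
have vs1 : 1 <= vs.
  by rewrite /vs -addrA lerDl addr_ge0 ?(ltW K0)// mulr_ge0// pi_ge0.
have vs0 : 0 < vs by exact: lt_le_trans vs1.
have Ki : 0 < 1 - K^-1 by rewrite subr_gt0 invf_lt1.
have th1 : 1 <= (1 - K^-1)^-1 by rewrite invf_ge1// gerBl invr_ge0 ltW.
have S0 : 0 <= S by apply: sumr_ge0 => i _; exact: nc_ge0.
have D0 : 0 <= D by rewrite mulr_ge0// exprn_ge0.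
have ker x : nc x < 1 -> nc (1 - lattice_conj K n j * x) <= vs * mesh K n -> 1 <= vs * kernel K n j x.
  move=> x1 H; rewrite /kernel mulrA ler_pdivlMr ?mul1r//.
  exact: lt_le_trans m0 (kernel_denominator_ge K1 n j (ltW x1)).
split=> [/(ker _ w1)|/(ker _ v1)] Hk.
- have E : nc (a * atom K n j w ^+ M) * nc (atom K n j w) ^+ 2 = nc a * kernel K n j w ^+ M.+2.
    by rewrite ncM ncX nc_atom// -mulrA -exprD addn2.
  rewrite E in H1.
  apply: (@le_trans _ _ (nc a * (vs * kernel K n j w) ^+ M.+2)).
    by rewrite ler_peMr ?nc_ge0// exprn_ege1.
  rewrite exprMn mulrCA; apply: (@le_trans _ _ (vs ^+ M.+2 * (D * S))).
    by rewrite ler_wpM2l// exprn_ge0// ltW.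
  rewrite mulrA ler_wpM2r// ler_wpM2r//.
  rewrite -[leLHS]mulr1 ler_pM ?exprn_ge0// ?(ltW vs0)//.
  by rewrite ler_weXn2l.
- have E : nc (b * atom_slope K n j * atom K n j v ^+ M.+1) * nc (atom K n j v) ^+ 2 =
      nc b * nc (atom_slope K n j) * kernel K n j v ^+ M.+3.
    by rewrite ncM ncX nc_atom// -mulrA -exprD addn2 ncM.
  rewrite E in H2.
  have sl : 1 <= (1 - K^-1)^-1 * mesh K n * nc (atom_slope K n j).
    rewrite /atom_slope ncM ncV nc_real (gtr0_norm m0) nc_lattice//.
    rewrite mulrA mulrAC -[(_ * mesh K n) / _]mulrA divff ?gt_eqF// mulr1 mulrC ler_pdivlMr// mul1r.
    rewrite lerD2l lerN2 /mesh exprS ler_piMr ?invr_ge0 ?(ltW K0)//.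
    by rewrite exprn_ile1 ?invr_ge0 ?(ltW K0)// invf_le1// ltW.
  apply: (@le_trans _ _ (nc b * (((1 - K^-1)^-1 * mesh K n * nc (atom_slope K n j)) *
      (vs * kernel K n j v) ^+ M.+3))).
    by rewrite ler_peMr ?nc_ge0// mulr_ege1// exprn_ege1.
  rewrite exprMn (_ : nc b * _ = mesh K n * (vs ^+ M.+3 * (1 - K^-1)^-1) *
     (nc b * nc (atom_slope K n j) * kernel K n j v ^+ M.+3)); last by ring.
  have -> : mesh K n * (vs ^+ M.+3 * (1 - K^-1)^-1 * D * S) =
     mesh K n * (vs ^+ M.+3 * (1 - K^-1)^-1) * (D * S) by ring.
  apply: ler_wpM2l => //.
  by rewrite mulr_ge0 ?(ltW m0)// mulr_ge0 ?exprn_ge0 ?(ltW vs0)// invr_ge0 ltW.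
Qed.

Lemma disc_moment_leZ (omega : R -> R) (Phi Psi : R[i] -> R) (a : R) : radial_weight omega ->
  disc_measurable Phi -> disc_measurable Psi -> (forall x, 0 <= Phi x) -> (forall x, 0 <= Psi x) ->
  0 <= a -> (forall x, nc x < 1 -> Phi x <= a * Psi x) ->
  (disc_moment omega Phi <= a%:E * disc_moment omega Psi)%E.
Proof.
move=> ow mP mQ P0 Q0 a0 PQ.
have wE Ph : disc_moment omega Ph =
   (\int[(@lebesgue_measure R \x @lebesgue_measure R)%E]_(x in @disc2 R) (Ph (cplx x) * weight0 omega (nrm2 x))%:E)%E.
  apply: eq_integral => x /[!inE] x1; rewrite /weight0.
  by rewrite -[nrm2 x]/(nc (cplx x)) nc_ge0 [nc _ < 1]x1.
rewrite !wE.
have mD : measurable (@disc2 R : set (measurableTypeR R * measurableTypeR R)) by exact: measurable_disc.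
have mi Ph (H : disc_measurable Ph) := measurable_moment_integrand ow mD (@subset_refl _ _) H.
rewrite -ge0_integralZl_EFin//.
- apply: ge0_le_integral => //.
  + by move=> x _; rewrite lee_fin mulr_ge0 ?weight0_ge0.
  + exact: mi.
  + by apply: measurable_funeM; exact: mi.
  + by move=> x x1; rewrite -EFinM lee_fin mulrA ler_wpM2r ?weight0_ge0// PQ.
- by move=> x _; rewrite lee_fin mulr_ge0 ?weight0_ge0.
- exact: mi.
Qed.

End LowerEstimate.

(** * Bounding each summand by the sum *)

Section Summands.
Context {R : realType}.
Variables (p q : R) (omega : R -> R).
Hypotheses (p1 : 1 < p) (q1 : 1 < q) (cD : classD omega).

Let p0 : 0 < p. Proof. exact: lt_trans p1. Qed.
Let q0 : 0 < q. Proof. exact: lt_trans q1. Qed.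

Lemma holoD_cdiff (f : Cx R -> Cx R) z : holoD f -> nc z < 1 -> cdiff f z (derive1 f z).
Proof. by move=> hf z1; apply: derivable_cdiff; exact: hf. Qed.

Lemma holoD_ccont (f : Cx R -> Cx R) z : holoD f -> nc z < 1 -> ccont f z.
Proof. by move=> hf z1; exact: cdiff_ccont (holoD_cdiff hf z1). Qed.

Lemma powR_sum3 (x : 'I_3 -> R) : (forall i, 0 <= x i) ->
  (\sum_(i < 3) x i) `^ q <= 3 `^ (q - 1) * \sum_(i < 3) x i `^ q.
Proof.
move=> x0.
have E (y : 'I_3 -> R) : \sum_(i < 3) y i = \sum_(i < 3) 1 * y i.
  by apply: eq_bigr => i _; rewrite mul1r.
rewrite E [X in _ <= _ * X]E.
apply: (@weighted_powR_jensen R 'I_3 (index_enum 'I_3) (fun=> 1) x q 3 q1 (ltr0Sn R 2)) => //.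
by rewrite sumr_const card_ord.
Qed.

(** The samples of [f] are divided by [lam] so that every signed sum of atoms lies in the unit ball.
    The bound for the sum of the operators holds for each sign pattern, hence for the sign means; at
    a point [z] these dominate the atom in whose cell [phi z], respectively [psi z], lies. *)
Lemma summands_bound : exists2 A : R, 0 < A &
  forall (ups : {measure set (R * R)%type -> \bar R}) (phi psi u0 u1 : Cx R -> Cx R) (B : R),
  selfmapD phi -> selfmapD psi -> holoD u0 -> holoD u1 -> 0 <= B ->
  (forall F, holoD F -> (normA p omega F <= 1)%E ->
     (normL q ups (wsum u0 phi u1 psi F) <= B%:E)%E) ->
  forall f, holoD f -> (normA p omega f <= 1)%E ->
    (normL q ups (wcomp u0 phi f) <= (A * B)%:E)%E /\
    (normL q ups (wdiff u1 psi f) <= (A * B)%:E)%E.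
Proof.
have ow : radial_weight omega by case: cD => -[].
have [K [M [C [K1 C0] HC]]] := atomic_samples p1 cD.
pose cst := (1 + K + 4 * pi) ^+ M.+3 * (1 - K^-1)^-1 * (2 * (M.+2)%:R ^+ 2) : R.
have cst0 : 0 < cst.
  have K0 : 0 < K by exact: lt_trans K1.
  have v0 : 0 < 1 + K + 4 * pi by rewrite !addr_gt0// mulr_gt0// pi_gt0.
  apply: mulr_gt0; last by rewrite mulr_gt0// exprn_gt0.
  by apply: mulr_gt0; [exact: exprn_gt0|rewrite invr_gt0 subr_gt0 invf_lt1].
(* The synthesis constant [C] concerns [p]-th powers; its [p]-th root scales the coefficients. *)
pose lam := C `^ p^-1.
have lam0 : 0 < lam by exact: powR_gt0.
have lamp : lam `^ p = C by rewrite -powRrM mulVf ?gt_eqF// powRr1// ltW.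
(* The factor 3 accounts for the three exponents: [3^(q - 1)] from Jensen and 3 from adding three
   integrals. *)
exists (3 * (cst * lam)); first by rewrite mulr_gt0// mulr_gt0.
move=> ups phi psi u0 u1 B [hphi phi1] [hpsi psi1] hu0 hu1 B0 HB f hf fA.
have fD := fA; rewrite (@normA_le1 R p omega f p0 ow) in fD.
have ffin : disc_moment omega (fun x => nc (f x) `^ p) \is a fin_num.
  rewrite ge0_fin_numE; first exact: le_lt_trans fD (ltry _).
  by apply: disc_moment_ge0 => // x; exact: powR_ge0.
have [c [c0 cw cL]] := HC f (fun z z1 => ex_intro _ _ (holoD_cdiff hf z1)) ffin.
pose a (k : nat * nat) : R := lam^-1 * c k.1 k.2.
have a0 k : 0 <= a k by rewrite mulr_ge0// invr_ge0 ltW.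
pose at_ (k : nat * nat) := atom K k.1 k.2.
pose sl (k : nat * nat) := atom_slope K k.1 k.2.
(* The value at [z] of the sum of the operators on the weighted atom [k] with exponent [M + i]. *)
pose XX (i : 'I_3) (k : nat * nat) (z : R[i]) : R[i] :=
  ((a k)%:C)%C * (u0 z * at_ k (phi z) ^+ (M + i) +
     ((M + i)%:R * sl k) * (u1 z * at_ k (psi z) ^+ (M + i).+1)).
have cat k n z : nc z < 1 -> ccont (fun x => at_ k x ^+ n) z.
  by move=> z1; exact: (cdiff_ccont (cdiff_atom K1 k.1 k.2 n z1)).
have cXX i k z : nc z < 1 -> ccont (XX i k) z.
  move=> z1; apply: ccontM; first exact: (cdiff_ccont (cdiff_cst _ z)).
  apply: ccontD.
    apply: ccontM; first exact: holoD_ccont.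
    apply: (@ccont_comp _ (fun x => at_ k x ^+ (M + i))); first exact: holoD_ccont.
    by apply: cat; exact: phi1.
  apply: ccontM; first exact: (cdiff_ccont (cdiff_cst _ z)).
  apply: ccontM; first exact: holoD_ccont.
  apply: (@ccont_comp _ (fun x => at_ k x ^+ (M + i).+1)); first exact: holoD_ccont.
  by apply: cat; exact: psi1.
have testF L i e : (\int[ups]_(x in @disc2 R)
    ((let z := (x.1 +i* x.2)%C in nc (0 + signed_sum e (fun k => XX i k z) (lattice K L)) `^ q)%R)%:E
    <= (B `^ q)%:E)%E.
  pose F (x : R[i]) := signed_sum e (fun k => ((a k)%:C)%C * at_ k x ^+ (M + i)) (lattice K L).
  have FE x : nc x < 1 -> cdiff F x (signed_sum e (fun k => ((a k)%:C)%C *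
      ((M + i)%:R * sl k * at_ k x ^+ (M + i).+1)) (lattice K L)).
    move=> x1; apply: (cdiff_signed_sum e (F := fun k x => ((a k)%:C)%C * at_ k x ^+ (M + i))) => k.
    by apply: cdiffZ; exact: cdiff_atom.
  have hF : holoD F by move=> z z1; have [] := cdiff_derivable (FE _ z1).
  have FA : (normA p omega F <= 1)%E.
    rewrite (@normA_le1 R p omega F p0 ow).
    pose G x := \sum_(k <- lattice K L) c k.1 k.2 * kernel K k.1 k.2 x ^+ M.
    have G0 x : 0 <= G x by apply: sumr_ge0 => k _; rewrite mulr_ge0 ?exprn_ge0 ?kernel_ge0.
    apply: (@le_trans _ _ ((C^-1)%:E * disc_moment omega (fun x => (G x `^ p)%R))%E).
      apply: disc_moment_leZ => //.
      - apply: disc_measurable_powR; apply: disc_measurable_nc => z z1.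
        exact: cdiff_ccont (FE _ z1).
      - apply: disc_measurable_powR; apply: disc_measurable_sum => k.
        apply: disc_measurableM; first exact: disc_measurable_cst.
        by apply: disc_measurableX; exact: kernel_measurable.
      - by move=> x; exact: powR_ge0.
      - by move=> x; exact: powR_ge0.
      - by rewrite invr_ge0 ltW.
      move=> x x1.
      have -> : C^-1 = (lam^-1) `^ p.
        apply: (@mulfI _ C); first by rewrite gt_eqF.
        by rewrite divff ?gt_eqF// -{1}lamp -powRM ?invr_ge0 ?(ltW lam0)// divff ?powR1// gt_eqF.
      rewrite -powRM ?invr_ge0 ?(ltW lam0)//.
      apply: ge0_ler_powR; rewrite ?nnegrE ?nc_ge0 ?(ltW p0) ?mulr_ge0 ?invr_ge0 ?(ltW lam0)//.
      apply: (le_trans (nc_signed_sum _ _ _)); rewrite /G mulr_sumr; apply: ler_sum => k _.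
      rewrite ncM nc_real ger0_norm// ncX nc_atom// mulrA ler_wpM2l//.
      (* The extra factor [kernel^i] is at most 1, so the synthesis bound for the exponent [M]
         serves all three exponents. *)
      by rewrite exprD ler_piMr ?exprn_ge0 ?kernel_ge0// exprn_ile1 ?kernel_ge0// kernel_le1// ltW.
    apply: le_trans fD; rewrite -[leRHS]mul1e.
    have -> : (1 = (C^-1)%:E * C%:E)%E by rewrite -EFinM mulVf ?gt_eqF.
    by rewrite -muleA lee_pmul2l ?lte_fin ?invr_gt0//; exact: cL.
  have := HB F hF FA; rewrite (@normL_le R ups q B _ q0 B0); apply: le_trans.
  rewrite le_eqVlt; apply/orP; left; apply/eqP; apply: eq_integral => x /[!inE] x1.
  set z := (x.1 +i* x.2)%C; rewrite /= add0r /wsum /wcomp /wdiff.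
  have [_ ->] := cdiff_derivable (FE _ (psi1 z x1)).
  congr (_ `^ q)%:E; congr nc.
  rewrite /F -!signed_sumZ -signed_sumD; congr signed_sum; apply/funext => k.
  by rewrite /XX; ring.
have mXX L i := measurable_sign_mean q (lattice K L) (fun k z => @cXX i k z)
  (fun z _ => cdiff_ccont (cdiff_cst 0 z)).
have SB L i := integral_sign_mean (fun k z => @cXX i k z)
  (fun z _ => cdiff_ccont (cdiff_cst 0 z)) (testF L i).
have XXE i k z : nc (XX i k z) = a k * nc (mixed M (u0 z * at_ k (phi z) ^+ M)
    (u1 z * sl k * at_ k (psi z) ^+ M.+1) (at_ k (phi z)) (at_ k (psi z)) i).
  rewrite ncM nc_real ger0_norm//; congr (_ * nc _).
  by rewrite /mixed -addSn !exprD; ring.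
have inL w L : nc w < 1 -> nc w < layer_radius K L -> exists2 k, k \in lattice K L &
    nc w < layer_radius K k.1.+1 /\
    nc (1 - lattice_conj K k.1 k.2 * w) <= (1 + K + 4 * pi) * mesh K k.1.
  move=> w1 wL; have [n [j [jN h1 h2 h3]]] := lattice_cover K1 w1.
  exists (n, j) => //; apply/allpairsPdep; exists n, j; split => //.
    rewrite mem_iota /= add0n ltnNge; apply/negP => Ln.
    by have := le_lt_trans (le_trans (layer_radius_mono K1 Ln) h1) wL; rewrite ltxx.
  by rewrite mem_iota.
(* Shared by both summands: [chi] is [phi] or [psi], and [h] is the image of [f]. It suffices to
   bound [h] at each point by the terms of one lattice index, whichever it is. *)
have key (h : R[i] -> R[i]) (chi : R[i] -> R[i]) :
    (forall z, nc z < 1 -> ccont chi z) -> (forall z, nc z < 1 -> nc (chi z) < 1) ->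
    (forall z, nc z < 1 -> ccont h z) ->
    (forall z L, nc z < 1 -> nc (chi z) < layer_radius K L ->
       exists2 k, k \in lattice K L & nc (h z) <= cst * lam * \sum_(i < 3) nc (XX i k z)) ->
    (normL q ups h <= (3 * (cst * lam) * B)%:E)%E.
  move=> cchi chi1 ch Hh.
  have cl0 : 0 <= cst * lam by rewrite mulr_ge0 ?ltW.
  rewrite normL_le//; last by rewrite mulr_ge0// mulr_ge0.
  apply: (@integral_disc_exhaustion _ ups chi (fun z => nc (h z) `^ q) K) => //.
    exact: (measurableT_comp (measurable_powR q) (ccont_nc_measurable ch)).
    by move=> z; exact: powR_ge0.
  move=> L.
  pose S (i : 'I_3) (x : R * R) := let z := (x.1 +i* x.2)%C in
    sign_mean q (fun k => XX i k z) (lattice K L) 0.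
  have S0 i x : 0 <= S i x by exact: sign_mean_ge0.
  pose A3 := (cst * lam) `^ q * 3 `^ (q - 1).
  have A30 : 0 <= A3 by rewrite mulr_ge0 ?powR_ge0.
  have mD := @measurable_disc R.
  have mS i : measurable_fun (@disc2 R) (fun x => (S i x)%:E).
    by apply/measurable_EFinP; exact: mXX.
  pose Z : set (R * R) := [set x | disc2 x /\ nc (chi (x.1 +i* x.2)%C) < layer_radius K L].
  have mZ : measurable Z.
    have := @ccont_nc_measurable R chi cchi mD `]-oo, (layer_radius K L)[%classic (measurable_itv _).
    by congr measurable; apply/seteqP; split => x; rewrite /Z /= in_itv.
  have ZD : Z `<=` @disc2 R by move=> x [].
  apply: (@le_trans _ _ (\int[ups]_(x in Z) (A3%:E * \sum_(i < 3) (S i x)%:E))%E).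
    apply: ge0_le_integral => //.
    - by move=> x _; rewrite lee_fin powR_ge0.
    - apply: measurable_funS ZD _ => //; apply/measurable_EFinP.
      exact: (measurableT_comp (measurable_powR q) (ccont_nc_measurable ch)).
    - apply: measurable_funS ZD _ => //; apply: measurable_funeM.
      by apply: emeasurable_sum => i; exact: mS.
    move=> x [x1 xL]; set z := (x.1 +i* x.2)%C; rewrite sumEFin -EFinM lee_fin.
    have [k kL Hk] := Hh z L x1 xL.
    apply: (@le_trans _ _ ((cst * lam * \sum_(i < 3) nc (XX i k z)) `^ q)).
      apply: ge0_ler_powR; rewrite ?nnegrE ?nc_ge0 ?(ltW q0)//.
      by rewrite mulr_ge0// sumr_ge0// => i _; exact: nc_ge0.
    rewrite powRM//; last by apply: sumr_ge0 => i _; exact: nc_ge0.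
    rewrite /A3 -[X in _ <= X]mulrA ler_wpM2l ?powR_ge0//.
    apply: (le_trans (powR_sum3 _)); first by move=> i; exact: nc_ge0.
    rewrite ler_wpM2l ?powR_ge0//; apply: ler_sum => i _.
    exact: (@sign_mean_ge_term R _ q (fun k => XX i k z) (lattice K L) 0 k q1 kL).
  have AS0 x : (0 <= \sum_(i < 3) (S i x)%:E)%E by apply: sume_ge0 => i _; rewrite lee_fin.
  apply: (@le_trans _ _ (\int[ups]_(x in @disc2 R) (A3%:E * \sum_(i < 3) (S i x)%:E))%E).
    apply: ge0_subset_integral => //.
    - by apply: measurable_funeM; apply: emeasurable_sum => i; exact: mS.
    - by move=> x _; rewrite mule_ge0// lee_fin.
  rewrite ge0_integralZl_EFin//; last by apply: emeasurable_sum => i; exact: mS.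
  rewrite ge0_integral_sum//; last by move=> i x _; rewrite lee_fin.
  have -> : (3 * (cst * lam) * B) `^ q = A3 * (3 * B `^ q).
    have E3 : 3 `^ q = 3 `^ (q - 1) * 3 :> R.
      have := @powRD R 3 (q - 1) 1; rewrite subrK powRr1//; apply.
      by apply/implyP.
    rewrite powRM//; last by rewrite mulr_ge0.
    by rewrite (@powRM R 3)// E3 /A3; ring.
  rewrite [X in (_ <= X)%E]EFinM; apply: lee_wpmul2l; first by rewrite lee_fin.
  have -> : ((3 * B `^ q)%:E = \sum_(i < 3) (B `^ q)%:E)%E.
    by rewrite sumEFin sumr_const card_ord mulr_natl.
  by apply: lee_sum => i _; exact: SB.
(* The scale [d] is 1 for the composition and [mesh] for the differentiation. *)
have bound (y d : R) k z : 0 <= y -> 0 <= d ->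
    y <= d * (cst * \sum_(i < 3) nc (mixed M (u0 z * at_ k (phi z) ^+ M)
      (u1 z * sl k * at_ k (psi z) ^+ M.+1) (at_ k (phi z)) (at_ k (psi z)) i)) ->
    c k.1 k.2 * y <= d * (cst * lam * \sum_(i < 3) nc (XX i k z)).
  move=> y0 d0 H; rewrite (eq_bigr _ (fun i _ => XXE i k z)) -mulr_sumr /a.
  apply: le_trans (ler_wpM2l (c0 _ _) H) _; set Sg := \sum_(i < 3) _.
  by rewrite le_eqVlt; apply/orP; left; apply/eqP; field; rewrite gt_eqF.
split.
- apply: (key _ phi) => //.
  + by move=> z z1; exact: holoD_ccont.
  + move=> z z1; apply: ccontM; first exact: holoD_ccont.
    apply: (@ccont_comp _ f); first exact: holoD_ccont.
    by apply: holoD_ccont => //; exact: phi1.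
  move=> z L z1 zL; have [k kL [k1 k2]] := inL _ _ (phi1 _ z1) zL; exists k => //.
  have [fk _] := cw _ _ _ k1 k2.
  have [H _] := atom_point_bound M k.1 k.2 (u0 z) (u1 z) K1 (phi1 _ z1) (psi1 _ z1).
  rewrite /wcomp ncM mulrC; apply: (@le_trans _ _ (c k.1 k.2 * nc (u0 z))).
    by rewrite ler_wpM2r ?nc_ge0.
  rewrite -[leRHS]mul1r; apply: bound => //; first exact: nc_ge0.
  by rewrite mul1r; exact: H.
- apply: (key _ psi) => //.
  + by move=> z z1; exact: holoD_ccont.
  + move=> z z1; apply: ccontM; first exact: holoD_ccont.
    apply: (@ccont_comp _ (derive1 f)); first exact: holoD_ccont.
    apply: (@derivative_ccont _ f) => //; last exact: psi1.
    by move=> w w1; exact: holoD_cdiff.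
  move=> z L z1 zL; have [k kL [k1 k2]] := inL _ _ (psi1 _ z1) zL; exists k => //.
  have [_ /(_ _ (holoD_cdiff hf (psi1 _ z1))) fk] := cw _ _ _ k1 k2.
  have [_ H] := atom_point_bound M k.1 k.2 (u0 z) (u1 z) K1 (phi1 _ z1) (psi1 _ z1).
  have m0 := mesh_gt0 K1 k.1.
  rewrite /wdiff ncM -(ler_pM2l m0).
  apply: (@le_trans _ _ (c k.1 k.2 * nc (u1 z))).
    by rewrite mulrCA mulrC ler_wpM2r ?nc_ge0// mulrC.
  by apply: bound; [exact: nc_ge0|exact: ltW|exact: H].
Qed.

End Summands.

Lemma le_pmul_addy {R : realType} (c : R) (x y : \bar R) :
  0 < c -> (0 <= y)%E -> (x <= c%:E * (+oo + y))%E.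
Proof.
move=> c0 y0; have ny : y != -oo%E by rewrite gt_eqF// (lt_le_trans _ y0)// ltNyr.
by rewrite (addye ny) gt0_muley ?lte_fin// leey.
Qed.

(** * Operator norms and the upper bound *)

Section OperatorNorms.
Context {R : realType}.
Variables (p q : R) (omega : R -> R).
Hypotheses (p1 : 1 < p) (q1 : 1 < q) (ow : radial_weight omega).
Variable ups : {measure set (R * R)%type -> \bar R}.

Let p0 : 0 < p. Proof. exact: lt_trans p1. Qed.
Let q0 : 0 < q. Proof. exact: lt_trans q1. Qed.

(** The zero function is in the unit ball, so the supremum is not over an empty set. *)
Lemma opnorm_ge0 T : (0 <= opnorm p q omega ups T)%E.
Proof.
apply: (@le_trans _ _ (normL q ups (T (fun=> 0)))); first exact: poweR_ge0.
apply: ereal_sup_ubound; exists (fun=> 0) => //; split.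
  by move=> z z1; have [] := cdiff_derivable (cdiff_cst 0 z).
rewrite normA_le1//; apply: (@le_trans _ _ 0%E); last by rewrite lee_fin pi_ge0.
rewrite /disc_moment le_eqVlt; apply/orP; left; apply/eqP.
by apply: integral0_eq => x _; rewrite nc0 powR0 ?gt_eqF// mul0r.
Qed.

(** A triangle inequality with constant 2: pointwise [|x + y|^q <= 2^q (|x|^q + |y|^q)], and
    [a^q + b^q <= (a + b)^q]. *)
Lemma normL_wsum_le (phi psi u0 u1 f : Cx R -> Cx R) (a b : R) :
  selfmapD phi -> selfmapD psi -> holoD u0 -> holoD u1 -> holoD f -> 0 <= a -> 0 <= b ->
  (normL q ups (wcomp u0 phi f) <= a%:E)%E -> (normL q ups (wdiff u1 psi f) <= b%:E)%E ->
  (normL q ups (wsum u0 phi u1 psi f) <= (2 * (a + b))%:E)%E.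
Proof.
move=> [hphi phi1] [hpsi psi1] hu0 hu1 hf a0 b0.
have ab0 : 0 <= a + b by rewrite addr_ge0.
have ab2 : 0 <= 2 * (a + b) by rewrite mulr_ge0.
set g := wcomp u0 phi f; set h := wdiff u1 psi f.
rewrite (@normL_le R ups q a g q0 a0) (@normL_le R ups q b h q0 b0) => Ha Hb.
rewrite (@normL_le R ups q _ _ q0 ab2).
have cg z : nc z < 1 -> ccont g z.
  move=> z1; apply: ccontM; first exact: holoD_ccont.
  apply: (@ccont_comp _ f); first exact: holoD_ccont.
  by apply: holoD_ccont => //; exact: phi1.
have ch z : nc z < 1 -> ccont h z.
  move=> z1; apply: ccontM; first exact: holoD_ccont.
  apply: (@ccont_comp _ (derive1 f)); first exact: holoD_ccont.
  apply: (@derivative_ccont _ f) => //; last exact: psi1.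
  by move=> w w1; exact: holoD_cdiff.
have mD := @measurable_disc R.
have mN (F : R[i] -> R[i]) : (forall z, nc z < 1 -> ccont F z) ->
    measurable_fun (@disc2 R) (fun x : R * R => (nc (F (x.1 +i* x.2)%C) `^ q)%:E).
  move=> cF; apply/measurable_EFinP.
  exact: (measurableT_comp (measurable_powR q) (ccont_nc_measurable cF)).
pose N F (x : R * R) := (nc (F (x.1 +i* x.2)%C) `^ q)%:E.
have N0 F x : (0 <= N F x)%E by rewrite lee_fin powR_ge0.
have pt (x y : R[i]) : nc (x + y) `^ q <= 2 `^ q * (nc x `^ q + nc y `^ q).
  wlog xy : x y / nc x <= nc y.
    move=> H; case: (leP (nc x) (nc y)) => [|/ltW] /H//.
    by rewrite addrC [nc x `^ q + _]addrC.
  apply: (@le_trans _ _ ((2 * nc y) `^ q)).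
    apply: ge0_ler_powR; rewrite ?nnegrE ?nc_ge0 ?(ltW q0) ?mulr_ge0 ?nc_ge0//.
    by rewrite (le_trans (ncD _ _))// mulr_natl mulr2n lerD2r.
  by rewrite powRM ?nc_ge0// ler_wpM2l ?powR_ge0// lerDr powR_ge0.
apply: (@le_trans _ _ ((2 `^ q)%:E * (\int[ups]_(x in @disc2 R) N g x + \int[ups]_(x in @disc2 R) N h x))%E).
  rewrite -ge0_integralD//; [|exact: mN cg|exact: mN ch].
  rewrite -ge0_integralZl_EFin ?powR_ge0//; last 2 first.
  - by move=> x _; rewrite adde_ge0.
  - by apply: emeasurable_funD; [exact: mN cg|exact: mN ch].
  apply: ge0_le_integral => //.
  - by move=> x _; rewrite lee_fin powR_ge0.
  - by apply: (mN (fun z => g z + h z)) => z z1; apply: ccontD; [exact: cg|exact: ch].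
  - apply: measurable_funeM.
    by apply: emeasurable_funD; [exact: mN cg|exact: mN ch].
  by move=> x _; rewrite /N -EFinD -EFinM lee_fin; exact: pt.
apply: (@le_trans _ _ ((2 `^ q)%:E * ((a `^ q)%:E + (b `^ q)%:E))%E).
  by apply: lee_wpmul2l; [rewrite lee_fin powR_ge0|exact: leeD].
rewrite -EFinD -EFinM lee_fin powRM// ler_wpM2l ?powR_ge0//.
have split x : 0 <= x -> x `^ q = x `^ (q - 1) * x.
  move=> x0; have := @powRD R x (q - 1) 1; rewrite subrK powRr1//; apply.
  by apply/implyP => /eqP E; move: q0; rewrite E ltxx.
have mono x : 0 <= x -> x <= a + b -> x `^ q <= (a + b) `^ (q - 1) * x.
  move=> x0 xab; rewrite split// ler_wpM2r//.
  by apply: ge0_ler_powR; rewrite ?nnegrE ?subr_ge0 ?(ltW q1).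
by rewrite [X in _ <= X]split// mulrDr lerD// mono// ?lerDl ?lerDr.
Qed.

End OperatorNorms.

Theorem theorem3p1 (R : realType) (p q : R) (omega : R -> R) :
  1 < p -> 1 < q -> classD omega ->
  exists c : R, 0 < c /\
    forall (ups : {measure set (R * R)%type -> \bar R})
           (phi psi u0 u1 : Cx R -> Cx R),
      selfmapD phi -> selfmapD psi -> holoD u0 -> holoD u1 ->
      (opnorm p q omega ups (wsum u0 phi u1 psi)
         <= c%:E * (opnorm p q omega ups (wcomp u0 phi)
                    + opnorm p q omega ups (wdiff u1 psi)))%E /\
      (opnorm p q omega ups (wcomp u0 phi)
         + opnorm p q omega ups (wdiff u1 psi)
         <= c%:E * opnorm p q omega ups (wsum u0 phi u1 psi))%E.
Proof.
move=> p1 q1 cD; have ow : radial_weight omega by case: cD => -[].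
have [A A0 HA] := summands_bound p1 q1 cD.
have c0 : 0 < 2 * (1 + A) by rewrite mulr_gt0// addr_gt0.
(* One constant for both directions: 2 from the triangle inequality, [2 A] from adding the bounds
   for the two summands. *)
exists (2 * (1 + A)); split => // ups phi psi u0 u1 hphi hpsi hu0 hu1.
have O0 := opnorm_ge0 q p1 ow ups (wcomp u0 phi).
have O1 := opnorm_ge0 q p1 ow ups (wdiff u1 psi).
have OS := opnorm_ge0 q p1 ow ups (wsum u0 phi u1 psi).
have ub T f : holoD f -> (normA p omega f <= 1)%E -> (normL q ups (T f) <= opnorm p q omega ups T)%E.
  by move=> hf fA; apply: ereal_sup_ubound; exists f.
split.
- have U0 := @ub (wcomp u0 phi); have U1 := @ub (wdiff u1 psi).
  case: (opnorm p q omega ups (wcomp u0 phi)) O0 U0 => [a||//] O0 U0; last first.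
    exact: (@le_pmul_addy R _ _ _ c0 O1).
  case: (opnorm p q omega ups (wdiff u1 psi)) O1 U1 => [b||//] O1 U1; last first.
    by rewrite addeC; exact: (@le_pmul_addy R _ _ _ c0 O0).
  apply: ge_ereal_sup => _ [f [hf fA] <-].
  apply: (@le_trans _ _ (2 * (a + b))%:E).
    by apply: normL_wsum_le => //; [exact: U0|exact: U1].
  rewrite -EFinD -EFinM lee_fin ler_wpM2r ?addr_ge0// ler_peMr// lerDl ltW//.
- have US := @ub (wsum u0 phi u1 psi).
  case: (opnorm p q omega ups (wsum u0 phi u1 psi)) OS US => [B||//] OS US; last first.
    by rewrite -[+oo%E]adde0; exact: (@le_pmul_addy R _ _ _ c0 (lexx _)).
  have H f (hf : holoD f) (fA : (normA p omega f <= 1)%E) :=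
    HA ups phi psi u0 u1 B hphi hpsi hu0 hu1 OS (fun F hF FA => US F hF FA) f hf fA.
  apply: (@le_trans _ _ ((A * B)%:E + (A * B)%:E)%E).
    apply: leeD; apply: ge_ereal_sup => _ [f [hf fA] <-]; have [Hc Hd] := H f hf fA.
      exact: Hc.
    exact: Hd.
  rewrite -EFinD -EFinM lee_fin (_ : A * B + A * B = 2 * A * B); last by ring.
  by rewrite ler_wpM2r// ler_pM2l// lerDr.
Qed.
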